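(* Let $N\ge2$ and let $\Omega\subset\mathbb{R}^N$ be a bounded and smooth domain with distance function to the boundary $\rho(x)=\inf_{y\in\partial\Omega}|y-x|$. For each $p>N$ let $u_p$ denote a positive extremal function of $\Lambda_p(\Omega)$ and $x_p$ its unique maximum point. Let $p_n\to\infty$, $x_*\in\Omega$ and $u_\infty\in W_0^{1,\infty}(\Omega)$ be such that: (a) $u_{p_n}\to u_\infty$ weakly in $W_0^{1,r}(\Omega)$ for any $r>N$ and uniformly in $\overline\Omega$; (b) $\|\nabla u_\infty\|_\infty=1/\|\rho\|_\infty$; (c) $0\le u_\infty\le\rho/\|\rho\|_\infty$ a.e. in $\Omega$; (d) $x_{p_n}\to x_*$; (e) $u_\infty(x_* )=1=\|u_\infty\|_\infty$ and $\rho(x_* )=\|\rho\|_\infty$. Then $u_\infty$ satisfies $$\begin{cases}\Delta_\infty v=0&\text{in }\Omega\setminus\{x_*\}\\ v=\dfrac{\rho}{\|\rho\|_\infty}&\text{on }\{x_*\}\cup\partial\Omega\end{cases}$$ in the viscosity sense.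
   Context: $\|\cdot\|_s$ denotes the norm of $L^s(\Omega)$. For $p>N$, $\Lambda_p(\Omega)=\min\{\|\nabla u\|_p^p:u\in W_0^{1,p}(\Omega),\ \|u\|_\infty=1\}$. A positive extremal function of $\Lambda_p(\Omega)$ is a function $u_p\in W_0^{1,p}(\Omega)$ with $u_p>0$ in $\Omega$, $\|u_p\|_\infty=1$ and $\|\nabla u_p\|_p^p=\Lambda_p(\Omega)$; such functions exist, are continuous on $\overline\Omega$, and have a unique maximum point $x_p\in\Omega$. Data $(p_n),x_*,u_\infty$ satisfying (a)–(e) always exist. For $\phi\in C^2$, $\Delta_\infty\phi(x_0):=\sum_{i,j=1}^N\frac{\partial\phi}{\partial x_i}(x_0)\frac{\partial\phi}{\partial x_j}(x_0)\frac{\partial^2\phi}{\partial x_i\partial x_j}(x_0)$. Let $D$ be a bounded domain and $u\in C(\overline D)$. A function $\phi\in C^2(D)$ touches $u$ at $x_0\in D$ from below (resp. above) if $\phi(x_0)=u(x_0)$ and $\phi(x)<u(x)$ (resp. $\phi(x)>u(x)$) for all $x\in D\setminus\{x_0\}$. One says that $\Delta_\infty u=0$ in $D$ in the viscosity sense ($u$ is $\infty$-harmonic) if $\Delta_\infty\phi(x_0)\ge0$ whenever $\phi\in C^2(D)$ touches $u$ from above at $x_0\in D$, and $\Delta_\infty\phi(x_0)\le0$ whenever $\phi\in C^2(D)$ touches $u$ from below at $x_0\in D$. Boundary values are attained pointwise by the continuous function $u$. *)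

(* Defs.v *)
From HB Require Import structures.
From mathcomp Require Import all_boot all_order all_algebra.
From mathcomp Require Import all_classical all_reals all_analysis.

Set Implicit Arguments.
Unset Strict Implicit.
Unset Printing Implicit Defensive.
Import Order.TTheory GRing.Theory Num.Theory.
Import numFieldNormedType.Exports.

Local Open Scope classical_set_scope.
Local Open Scope ring_scope.


(* The sigma-algebra on R^n generated by the coordinates, as the library does
   for tuples; it is the Borel sigma-algebra. *)
Definition measure_rV_display : measure_display.
Proof. exact: default_measure_display. Qed.

Section measurable_rV.
Context {R : realType} (n : nat).

Let coors : 'I_n -> 'rV[R]_n -> measurableTypeR R := fun i v => v ord0 i.

Let rV_set0 : g_sigma_preimage coors set0.
Proof. exact: sigma_algebra0. Qed.

Let rV_setC A : g_sigma_preimage coors A -> g_sigma_preimage coors (~` A).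
Proof. exact: sigma_algebraC. Qed.

Let rV_bigcup (F : (set 'rV[R]_n)^nat) :
  (forall i, g_sigma_preimage coors (F i)) ->
  g_sigma_preimage coors (\bigcup_i (F i)).
Proof. exact: sigma_algebra_bigcup. Qed.

HB.instance Definition _ := @isMeasurable.Build measure_rV_display
  'rV[R]_n (g_sigma_preimage coors) rV_set0 rV_setC rV_bigcup.

Lemma measurable_coord (i : 'I_n) :
  measurable_fun [set: 'rV[R]_n] (coors i).
Proof.
move=> _ Y mY; rewrite setTI; apply: sub_sigma_algebra => /=.
rewrite -bigcup_seq/=; exists i => /=; first by rewrite mem_index_enum.
by exists Y => //; rewrite setTI.
Qed.

Lemma measurable_fun_rV d (T : measurableType d) (f : T -> 'rV[R]_n) :
  (forall i, measurable_fun [set: T] (coors i \o f)) ->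
  measurable_fun [set: T] f.
Proof.
move=> mf _ A mA; rewrite setTI.
suff : g_sigma_preimage (fun i => coors i \o f) `<=` measurable.
  by apply; rewrite g_sigma_preimage_comp; exists A => //; rewrite setTI.
apply: smallest_sub; first exact: sigma_algebra_measurable.
rewrite -bigcup_seq; apply: bigcup_sub => i _ _ [B mB <-].
exact: mf.
Qed.

End measurable_rV.

Section lebesgue_rV.
Context {R : realType}.
Local Open Scope ereal_scope.

Section lebesgue_rVS.
Variables (n : nat) (mu : {sigma_finite_measure set 'rV[R]_n -> \bar R}).

Definition cons_rV (p : measurableTypeR R * 'rV[R]_n) : 'rV[R]_n.+1 :=
  \row_i if unlift ord0 i is Some j then p.2 ord0 j else p.1.

Definition uncons_rV (v : 'rV[R]_n.+1) : measurableTypeR R * 'rV[R]_n :=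
  (v ord0 ord0, \row_i v ord0 (lift ord0 i)).

Lemma cons_rV0 p : cons_rV p ord0 ord0 = p.1.
Proof. by rewrite mxE unlift_none. Qed.

Lemma cons_rVS p i : cons_rV p ord0 (lift ord0 i) = p.2 ord0 i.
Proof. by rewrite mxE liftK. Qed.

Lemma cons_rVK : cancel cons_rV uncons_rV.
Proof.
move=> [a v]; rewrite /uncons_rV cons_rV0; congr pair.
by apply/rowP => i; rewrite mxE cons_rVS.
Qed.

Lemma measurable_cons_rV : measurable_fun [set: _] cons_rV.
Proof.
apply: measurable_fun_rV => i.
have [j ->|->] := unliftP ord0 i.
  rewrite (_ : _ \o _ = (fun v : 'rV[R]_n => v ord0 j) \o snd).
    by apply: measurableT_comp => //; exact: measurable_coord.
  by apply/funext => p /=; rewrite cons_rVS.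
rewrite (_ : _ \o _ = fst) //.
by apply/funext => p /=; rewrite cons_rV0.
Qed.

Lemma measurable_uncons_rV : measurable_fun [set: _] uncons_rV.
Proof.
apply: measurable_fun_pair; first exact: measurable_coord.
apply: measurable_fun_rV => i.
rewrite (_ : _ \o _ = (fun v : 'rV[R]_n.+1 => v ord0 (lift ord0 i))).
  exact: measurable_coord.
by apply/funext => v /=; rewrite mxE.
Qed.

Definition lebesgue_rVS : set 'rV[R]_n.+1 -> \bar R :=
  pushforward (@lebesgue_measure R \x mu) cons_rV.


Let lebesgue_rVS0 : lebesgue_rVS set0 = 0.
Proof. by rewrite /lebesgue_rVS /pushforward preimage_set0 measure0. Qed.

Let lebesgue_rVS_ge0 A : 0 <= lebesgue_rVS A.
Proof. exact: (measure_ge0 (@lebesgue_measure R \x mu)). Qed.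

Let lebesgue_rVS_sigma_additive : semi_sigma_additive lebesgue_rVS.
Proof.
have mc A : measurable A -> measurable (cons_rV @^-1` A).
  by move=> mA; rewrite -[X in measurable X]setTI; exact: measurable_cons_rV.
move=> F mF tF mUF; rewrite /lebesgue_rVS /pushforward preimage_bigcup.
apply: measure_semi_sigma_additive => [n0||]; first exact: mc.
- apply/trivIsetP => /= i j _ _ ij; rewrite -preimage_setI.
  by move/trivIsetP : tF => /(_ _ _ _ _ ij) ->//; rewrite preimage_set0.
- by rewrite -preimage_bigcup; exact: mc.
Qed.

HB.instance Definition _ := isMeasure.Build _ _ _ lebesgue_rVS
  lebesgue_rVS0 lebesgue_rVS_ge0 lebesgue_rVS_sigma_additive.

Let lebesgue_rVS_sigma_finite : sigma_finite setT lebesgue_rVS.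
Proof.
have /sigma_finiteP[F [TF ndF Foo]] := sigma_finiteT (@lebesgue_measure R).
have /sigma_finiteP[G [TG ndG Goo]] := sigma_finiteT mu.
exists (fun k => uncons_rV @^-1` (F k `*` G k)).
  rewrite -preimage_bigcup -[LHS](preimage_setT uncons_rV); congr preimage.
  apply/seteqP; split=> // -[x y] _.
  have [i _ Fix] : (\bigcup_i F i) x by rewrite -TF.
  have [j _ Gjy] : (\bigcup_j G j) y by rewrite -TG.
  exists (maxn i j) => //; split=> /=.
  - by move: x Fix; exact/subsetPset/ndF/leq_maxl.
  - by move: y Gjy; exact/subsetPset/ndG/leq_maxr.
move=> k; have [mF Fk] := Foo k; have [mG Gk] := Goo k; split.
  rewrite -[X in measurable X]setTI; apply: measurable_uncons_rV => //.
  exact: measurableX.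
rewrite /lebesgue_rVS /pushforward -comp_preimage.
rewrite (_ : uncons_rV \o cons_rV = id); last exact/funext/cons_rVK.
by rewrite preimage_id product_measure1E// lte_mul_pinfty// ge0_fin_numE.
Qed.

HB.instance Definition _ := Measure_isSigmaFinite.Build _ _ _ lebesgue_rVS
  lebesgue_rVS_sigma_finite.

End lebesgue_rVS.

(* Iterated product of the one-dimensional Lebesgue measure; the base case is
   the unit mass on the one-point space R^0. *)
Fixpoint lebesgue_rV (n : nat) : {sigma_finite_measure set 'rV[R]_n -> \bar R} :=
  match n with
  | 0 => \d_(0%R : 'rV[R]_0)
  | k.+1 => lebesgue_rVS (lebesgue_rV k)
  end.

Lemma lebesgue_rV_box (n : nat) (A : 'I_n -> set (measurableTypeR R)) :
  (forall i, measurable (A i)) ->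
  lebesgue_rV n [set v : 'rV[R]_n | forall i, A i (v ord0 i)] =
  \prod_(i < n) lebesgue_measure (A i).
Proof.
elim: n A => [A _|n IHn A mA].
  by rewrite big_ord0 /= diracE mem_set //= => -[].
rewrite big_ord_recl -IHn; last by move=> i; exact: mA.
rewrite -product_measure1E.
- rewrite /= /lebesgue_rVS /pushforward; congr (_ _).
  apply/seteqP; split=> [[a v] /= Aav|[a v] /= [Aa Av] i].
    split; first by have := Aav ord0; rewrite cons_rV0.
    by move=> i; have := Aav (lift ord0 i); rewrite cons_rVS.
  by have [j ->|->] := unliftP ord0 i; rewrite (cons_rVS, cons_rV0).
- exact: mA.
- suff -> : [set v : 'rV[R]_n | forall i, A (lift ord0 i) (v ord0 i)] =
      \bigcap_(i in [set: 'I_n])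
        ((fun v : 'rV[R]_n => v ord0 i) @^-1` A (lift ord0 i)).
    apply: fin_bigcap_measurable => // i _; rewrite -[X in measurable X]setTI.
    by apply: measurable_coord => //; exact: mA.
  by apply/seteqP; split=> v /= Av i; [move=> _; exact: Av|exact: Av].
Qed.

End lebesgue_rV.


Section euclidean.
Context {R : realType}.

(* The library norm on 'rV[R]_n is the sup norm. *)
Definition enorm n (v : 'rV[R]_n) : R := Num.sqrt (\sum_i v ord0 i ^+ 2).

Definition boundary n (A : set 'rV[R]_n) : set 'rV[R]_n := closure A `\` interior A.

Definition dist_boundary n (A : set 'rV[R]_n) (x : 'rV[R]_n) : R :=
  inf [set enorm (y - x) | y in boundary A].

Definition partial n (i : 'I_n) (f : 'rV[R]_n -> R) : 'rV[R]_n -> R :=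
  fun x => 'D_(delta_mx ord0 i) f x.

Fixpoint class_C n (k : nat) (D : set 'rV[R]_n) (f : 'rV[R]_n -> R) : Prop :=
  (forall x, D x -> {for x, continuous f}) /\
  if k is k'.+1 then
    forall i : 'I_n, (forall x, D x -> derivable f x (delta_mx ord0 i)) /\
                     class_C k' D (partial i f)
  else True.

Definition smooth n (D : set 'rV[R]_n) (f : 'rV[R]_n -> R) :=
  forall k, class_C k D f.

(* Near each boundary point, up to the choice of an axis i and of its
   orientation s, the set is the region above the graph of a smooth function of
   the other coordinates. *)
Definition smooth_boundary n (A : set 'rV[R]_n) :=
  forall y, boundary A y ->
  exists (r : R) (i : 'I_n) (s : bool) (g : 'rV[R]_n.-1 -> R),
    [/\ 0 < r, smooth setT g &
        forall x, enorm (x - y) < r ->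
          A x <-> g (col' i x) < (-1) ^+ s * x ord0 i].

Definition bounded_smooth_domain n (A : set 'rV[R]_n) :=
  [/\ A !=set0, open A, connected A, bounded_set A & smooth_boundary A].

Definition test_function n (A : set 'rV[R]_n) (phi : 'rV[R]_n -> R) :=
  [/\ smooth setT phi, compact (closure [set x | phi x != 0]) &
      closure [set x | phi x != 0] `<=` A].

End euclidean.


Section sobolev.
Context {R : realType} {N : nat} (Omega : set 'rV[R]_N).
Local Notation mu := (lebesgue_rV N).
Implicit Types (u v w : 'rV[R]_N -> R) (g : 'rV[R]_N -> 'rV[R]_N).

(* The norm of L^s(Omega), as an extended real number. *)
Definition Lnorm_on (s : \bar R) u : \bar R := 'N[mu]_s[EFin \o (u \_ Omega)].

Definition locally_integrable u :=
  measurable_fun Omega u /\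
  forall K, compact K -> K `<=` Omega -> mu.-integrable K (EFin \o u).

Definition is_weak_gradient u g :=
  locally_integrable u /\
  forall i : 'I_N, locally_integrable (fun x => g x ord0 i) /\
    forall phi, test_function Omega phi ->
      \int[mu]_(x in Omega) (u x * partial i phi x) =
      - \int[mu]_(x in Omega) (g x ord0 i * phi x).

(* A choice of the weak gradient, which is unique almost everywhere when it
   exists. *)
Definition weak_gradient u : 'rV[R]_N -> 'rV[R]_N :=
  xget (fun=> 0) [set g | is_weak_gradient u g].

Definition grad_norm u : 'rV[R]_N -> R := fun x => enorm (weak_gradient u x).

Definition sobolev_norm (s : \bar R) u : \bar R :=
  (Lnorm_on s u + Lnorm_on s (grad_norm u))%E.

Definition sobolev (s : \bar R) u :=
  [/\ measurable_fun Omega u, (exists g, is_weak_gradient u g) &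
      (sobolev_norm s u < +oo)%E].

(* W_0^{1,p}(Omega), p finite: the closure of the test functions. *)
Definition sobolev0 (p : R) u :=
  sobolev p%:E u /\
  exists phi : nat -> 'rV[R]_N -> R,
    (forall k, test_function Omega (phi k)) /\
    sobolev_norm p%:E (u \- phi k) @[k --> \oo] --> 0%E.

(* W_0^{1,oo}(Omega): the closure of the test functions for the norm of
   W^{1,oo} would only contain C^1 functions; the usual convention is to take
   the functions of W^{1,oo} with zero trace. *)
Definition sobolev0_infty u := sobolev +oo%E u /\ sobolev0 1 u.

(* Continuous linear functionals on W_0^{1,p}(Omega). By the bound they do not
   distinguish functions that are equal almost everywhere in Omega. *)
Definition sobolev0_dual (p : R) (l : ('rV[R]_N -> R) -> R) :=
  (forall (a : R) v w, sobolev0 p v -> sobolev0 p w ->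
    l (fun x => a * v x + w x) = a * l v + l w) /\
  exists C : R, forall v, sobolev0 p v ->
    (`|l v|%:E <= C%:E * sobolev_norm p%:E v)%E.

(* Membership of v_n is only required for large n, since u_{p_n} belongs to
   W_0^{1,r} only once p_n >= r. *)
Definition weak_cvg_sobolev0 (p : R) (v : nat -> 'rV[R]_N -> R) u :=
  [/\ \forall n \near \oo, sobolev0 p (v n), sobolev0 p u &
      forall l, sobolev0_dual p l -> l (v n) @[n --> \oo] --> l u].

Definition Lambda (p : R) : \bar R :=
  ereal_inf [set (Lnorm_on p%:E (grad_norm v) `^ p)%E |
             v in [set v | sobolev0 p v /\ Lnorm_on +oo%E v = 1%E]].

Definition positive_extremal (p : R) u :=
  [/\ sobolev0 p u, (forall x, Omega x -> 0 < u x), Lnorm_on +oo%E u = 1%E &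
      (Lnorm_on p%:E (grad_norm u) `^ p)%E = Lambda p].

Definition maximum_point u (x : 'rV[R]_N) :=
  Omega x /\ forall y, Omega y -> u y <= u x.

Definition dist_norm : R := fine (Lnorm_on +oo%E (dist_boundary Omega)).

End sobolev.


Section viscosity.
Context {R : realType} {N : nat} (D : set 'rV[R]_N).
Implicit Types (u phi : 'rV[R]_N -> R) (x : 'rV[R]_N).

Definition infty_laplacian phi x : R :=
  \sum_(i < N) \sum_(j < N)
    partial i phi x * partial j phi x * partial i (partial j phi) x.

Definition touches_below phi u x :=
  [/\ D x, class_C 2 D phi, phi x = u x &
      forall y, D y -> y != x -> phi y < u y].

Definition touches_above phi u x :=
  [/\ D x, class_C 2 D phi, phi x = u x &
      forall y, D y -> y != x -> u y < phi y].

Definition infty_harmonic u :=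
  [/\ {within closure D, continuous u},
      (forall phi x, touches_above phi u x -> 0 <= infty_laplacian phi x) &
      (forall phi x, touches_below phi u x -> infty_laplacian phi x <= 0)].

End viscosity.

(* Main.v *)
(* Suppose phi touches u_oo from above at x0, with Delta_oo phi(x0) < 0. A
   second-order Taylor expansion replaces phi by a quadratic Q that touches u_oo
   strictly, and |DQ|^2 Delta Q + (p - 2) Delta_oo Q <= -1 near x0 once p is
   large, so that div(|DQ|^(p-2) DQ) < 0 there. By uniform convergence,
   u_p - Q + c is positive near x0 and negative near the boundary of a small ball
   which, as x_p tends to x_*, misses the maximum point x_p. Lowering u_p by a smooth
   truncation of (u_p - Q + c)_+ in that ball then keeps max |u_p| = 1 but, by convexity of
   |.|^p and integration by parts against |DQ|^(p-2) DQ, strictly decreases the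
   p-energy, contradicting the extremality of u_p. To avoid a chain rule for weak
   gradients, the truncation is performed on test functions approximating u_p in
   W^{1,p}, with errors controlled by the distance of approximation. Touching
   from below is the same argument for -u_p. The boundary values follow from
   0 <= u_oo <= rho / |rho|_oo and the continuity of u_oo. *)

Require Import Defs.
From HB Require Import structures.
From mathcomp Require Import all_boot all_order all_algebra.
From mathcomp Require Import all_classical all_reals all_analysis.
From mathcomp Require Import measurable_realfun ess_sup_inf ring lra.

Set Implicit Arguments.
Unset Strict Implicit.
Unset Printing Implicit Defensive.
Import Order.TTheory GRing.Theory Num.Theory.
Import numFieldNormedType.Exports.

Local Open Scope classical_set_scope.
Local Open Scope ring_scope.

(** * Boxes and measurability in R^n *)

Section boxes.
Context {R : realType} {n : nat}.
Implicit Types (c d x : 'rV[R]_n) (U : set 'rV[R]_n).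

(** Lowering a test function [psi] by [cut (psi - Q + c)] replaces [D psi] by [(1 - w) D psi + w DQ]
    with [w = dcut (psi - Q + c)]. Convexity applies because [0 <= dcut <= 1]; this is why
    [cut t = exp(-1/t)] stands for the positive part: it is smooth, vanishes for [t <= 0], and its
    slope never exceeds 1. The obstacle is that [psi] is close to [u_p] only in the Sobolev norm,
    not uniformly. Signs of [u_p - Q + c] do not pass to [psi], so pointwise facts are stated up to
    the defect [|u_p - psi|], whose integral is small by Hoelder. Likewise nothing is known about
    [psi] at [x_p] itself: a small mean defect only yields some point near [x_p] where
    [|psi| >= 1 - d]. With [p] fixed, the energy gained by truncation does not depend on the
    accuracy [e] of the approximation, while all losses vanish with [d] and [e]; [d] is fixed before
    [e], because the required [e] depends on the neighbourhood of [x_p] that [d] determines. A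
    strictly negative [Delta_oo Q] at [x0] also forces [DQ] to be nonzero there, so that
    [|DQ|^(p-2) DQ] is differentiable near [x0]. *)

Definition box c d : set 'rV[R]_n :=
  [set v | forall i, c ord0 i < v ord0 i < d ord0 i].

Definition cbox c d : set 'rV[R]_n :=
  [set v | forall i, c ord0 i <= v ord0 i <= d ord0 i].

Lemma box_cbox c d : box c d `<=` cbox c d.
Proof. by move=> v cvd i; have /andP[/ltW-> /ltW->] := cvd i. Qed.

Lemma ball_rVP x (e : R) y : 0 < e ->
  ball x e y <-> forall i, `|x ord0 i - y ord0 i| < e.
Proof.
move=> e0; split=> [[_ xy] i|xy]; first exact: xy.
by split=> // i j; rewrite (ord1 i); exact: xy.
Qed.

Lemma ball_box x (e : R) : 0 < e ->
  ball x e = box (x - const_mx e) (x + const_mx e).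
Proof.
move=> e0; apply/seteqP; split=> [y /(ball_rVP _ _ e0) xy i|y xy].
  by have := xy i; rewrite !mxE ltr_distlC.
by apply/(ball_rVP _ _ e0) => i; have := xy i; rewrite !mxE ltr_distlC.
Qed.

Lemma setI_box c d c' d' : box c d `&` box c' d' =
  box (\row_i Num.max (c ord0 i) (c' ord0 i)) (\row_i Num.min (d ord0 i) (d' ord0 i)).
Proof.
apply/seteqP; split=> [v [h h'] i|v h].
  by rewrite !mxE gt_max lt_min; have /andP[-> ->] := h i; have /andP[-> ->] := h' i.
by split=> i; have := h i; rewrite !mxE gt_max lt_min => /andP[/andP[? ?] /andP[? ?]];
  apply/andP.
Qed.

Lemma measurable_coord_box (A : 'I_n -> set (measurableTypeR R)) :
  (forall i, measurable (A i)) ->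
  measurable [set v : 'rV[R]_n | forall i, A i (v ord0 i)].
Proof.
move=> mA; suff -> : [set v : 'rV[R]_n | forall i, A i (v ord0 i)] =
   \bigcap_(i in [set: 'I_n]) ((fun v : 'rV[R]_n => v ord0 i) @^-1` A i).
  apply: fin_bigcap_measurable => // i _; rewrite -[X in measurable X]setTI.
  exact: measurable_coord.
by apply/seteqP; split=> v /= Av i; [move=> _; exact: Av|exact: Av].
Qed.

Lemma boxE c d : box c d =
  [set v | forall i, (fun j => `]c ord0 j, d ord0 j[%classic) i (v ord0 i)].
Proof. by apply/seteqP; split=> v h i; have := h i; rewrite /= in_itv. Qed.

Lemma cboxE c d : cbox c d =
  [set v | forall i, (fun j => `[c ord0 j, d ord0 j]%classic) i (v ord0 i)].
Proof. by apply/seteqP; split=> v h i; have := h i; rewrite /= in_itv. Qed.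

Lemma measurable_box c d : measurable (box c d).
Proof.
rewrite boxE.
apply: (@measurable_coord_box (fun j => `]c ord0 j, d ord0 j[%classic)) => i.
exact: measurable_itv.
Qed.

Lemma measurable_cbox c d : measurable (cbox c d).
Proof.
rewrite cboxE.
apply: (@measurable_coord_box (fun j => `[c ord0 j, d ord0 j]%classic)) => i.
exact: measurable_itv.
Qed.

Lemma compact_cbox c d : compact (cbox c d).
Proof.
rewrite cboxE.
apply: (@rV_compact _ _ (fun j => `[c ord0 j, d ord0 j]%classic)) => i.
exact: segment_compact.
Qed.

Lemma lebesgue_box_fin c d : lebesgue_rV n (box c d) \is a fin_num.
Proof.
rewrite boxE (@lebesgue_rV_box R n (fun j => `]c ord0 j, d ord0 j[%classic)); last first.
  by move=> i; exact: measurable_itv.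
elim/big_ind: _ => [|a b a0 b0|i _]; rewrite ?fin_numM//.
by rewrite lebesgue_measure_itv/=; case: ifP.
Qed.

Lemma lebesgue_ball_gt0 x e : 0 < e -> (0 < lebesgue_rV n (ball x e))%E.
Proof.
move=> e0; rewrite ball_box// boxE.
rewrite (@lebesgue_rV_box R n (fun j => `](x - const_mx e) ord0 j, (x + const_mx e) ord0 j[%classic)); last first.
  by move=> i; exact: measurable_itv.
elim/big_ind: _ => [|a b a0 b0|i _]; rewrite ?lte01 ?mule_gt0//.
rewrite lebesgue_measure_itv/= !mxE lte_fin ltrD2l gtrN// -EFinB lte_fin.
by move: e0; lra.
Qed.

Definition ratbox (q : 'rV[rat]_n * 'rV[rat]_n) :=
  (map_mx (ratr : rat -> R) q.1, map_mx (ratr : rat -> R) q.2).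

(** Boxes with rational corners form a countable base, which links the topology to the sigma-algebra
    generated by the coordinates. The index set asks for the closed box to lie in [U], since local
    integrability and test functions need compact subsets. *)
Lemma open_ratbox U : open U -> U =
  \bigcup_(q in [set q | cbox (ratbox q).1 (ratbox q).2 `<=` U])
     box (ratbox q).1 (ratbox q).2.
Proof.
move=> oU; apply/seteqP; split=> [x Ux|x [q qU qx]]; last exact/qU/box_cbox.
have /nbhs_ballP[e e0 xeU] : nbhs x U by exact: open_nbhs_nbhs.
have L i : exists q : rat, ratr q \in `](x ord0 i - e), x ord0 i[%R.
  by apply: rat_in_itvoo; rewrite ltrBlDr ltrDl.
have H i : exists q : rat, ratr q \in `]x ord0 i, (x ord0 i + e)[%R.
  by apply: rat_in_itvoo; rewrite ltrDl.
exists (\row_i xchoose (L i), \row_i xchoose (H i)); last first.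
  move=> i; rewrite !mxE; have := xchooseP (L i); have := xchooseP (H i).
  by rewrite !in_itv/= => /andP[-> _] /andP[_ ->].
move=> y xy; apply: xeU; apply/ball_rVP => // i.
have := xy i; rewrite !mxE; have := xchooseP (L i); have := xchooseP (H i).
rewrite !in_itv/= => /andP[_ h1] /andP[h2 _] /andP[h3 h4].
by rewrite ltr_distlC (lt_le_trans h2 h3) (le_lt_trans h4 h1).
Qed.

Lemma open_measurable_rV U : open U -> measurable U.
Proof.
move=> /open_ratbox ->; rewrite bigcup_mkcond.
apply: countable_bigcupT_measurable; first exact: countableP.
by move=> q; case: ifP => // _; exact: measurable_box.
Qed.

Lemma continuous_measurable_rV (f : 'rV[R]_n -> R) :
  continuous f -> measurable_fun setT f.
Proof.
move=> cf; apply: (measurability _ (RGenOpens.measurableE R)).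
move=> _ [_ [a [b ->]] <-]; rewrite setTI.
by apply: open_measurable_rV; apply: open_comp => // x _; exact: cf.
Qed.

End boxes.

(** * Integration by parts *)

Section bounded_support.
Context {R : realType}.

(** Bounded support is phrased with coordinates so that it survives freezing one coordinate, as the
    induction on the dimension requires. *)
Definition bsupp n (f : 'rV[R]_n -> R) :=
  exists M : R, forall x : 'rV[R]_n, (exists i, M <= `|x ord0 i|) -> f x = 0.

Lemma continuous_bsupp_integrable n (f : 'rV[R]_n -> R) :
  continuous f -> bsupp f -> (lebesgue_rV n).-integrable setT (EFin \o f).
Proof.
move=> cf [M Mf]; pose B : set 'rV[R]_n := box (const_mx (- M)) (const_mx M).
have fB : f = f \_ B.
  apply/funext => x; rewrite patchE; case: ifPn => // /negP xB; apply: Mf.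
  apply: contrapT => /forallNP h; apply: xB; rewrite inE => i; rewrite !mxE -ltr_norml ltNge.
  by apply/negP/h.
have mB : measurable B by exact: measurable_box.
rewrite fB -restrict_EFin; apply/(integrable_mkcond _ mB).
apply: measurable_bounded_integrable => //.
- by rewrite ltey_eq lebesgue_box_fin.
- by apply: measurable_funTS; exact: continuous_measurable_rV.
- have : bounded_set (f @` cbox (const_mx (- M)) (const_mx M)).
    apply: compact_bounded; apply: continuous_compact; last exact: compact_cbox.
    exact: continuous_subspaceT.
  move=> [K [Kr AK]]; exists K; split=> // y /AK Ay x Bx; apply: Ay.
  by exists x => //; exact: box_cbox.
Qed.

Lemma is_derive_line n (f : 'rV[R]_n -> R) x v t df :
  is_derive (x + t *: v) v f df ->
  is_derive t 1 (fun s : R => f (x + s *: v)) df.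
Proof.
move=> [fd <-].
have E : (fun h : R => h^-1 *: ((fun s => f (x + s *: v)) (h *: 1 + t) - f (x + t *: v))) =
         (fun h => h^-1 *: (f (h *: v + (x + t *: v)) - f (x + t *: v))).
  apply/funext => h; congr (_ *: (f _ - _)).
  by rewrite scalerDl /GRing.scale /= mulr1 addrCA addrA.
by split; [rewrite /derivable E|rewrite /derive E].
Qed.

Lemma bsupp_partial n (f : 'rV[R]_n -> R) i : bsupp f -> bsupp (partial i f).
Proof.
(* The bound grows by 1 so that [f] vanishes on a neighbourhood of [x], not only at [x]. *)
move=> [M Mf]; exists (M + 1) => x [j Mx]; rewrite /partial.
transitivity ('D_(delta_mx ord0 i) (cst 0 : 'rV[R]_n -> R) x); last exact: derive_cst.
have e0 : delta_mx ord0 i != 0 :> 'rV[R]_n.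
  by apply/eqP => /rowP/(_ i)/eqP; rewrite !mxE !eqxx oner_eq0.
apply: near_eq_derive => //.
have xM : M < `|x ord0 j| by apply: lt_le_trans Mx; rewrite ltrDl.
have cj : (fun y : 'rV[R]_n => y ord0 j) @ x --> x ord0 j by exact: coord_continuous.
have cv : (fun y : 'rV[R]_n => `|y ord0 j|) @ x --> `|x ord0 j|.
  exact: (cvg_norm cj).
by apply: filterS (cvgr_gt _ cv _ xM) => y /= My; rewrite Mf//; exists j; exact: ltW.
Qed.

Lemma integral_line_derive (F D : R -> R) (M : R) : 0 < M ->
  (forall a : R, is_derive a 1 F (D a)) -> continuous D ->
  (forall a : R, M <= `|a| -> F a = 0) -> (forall a : R, M <= `|a| -> D a = 0) ->
  (\int[lebesgue_measure]_a (D a)%:E = 0)%E.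
Proof.
move=> M0 FD cD F0 D0.
rewrite (_ : (fun a => (D a)%:E) = (EFin \o D) \_ (`[- M, M]%classic : set R)); last first.
  apply/funext => a; rewrite patchE; case: ifPn => //; rewrite notin_setE /= in_itv /= => /negP.
  by rewrite -ler_norml -ltNge => /ltW/D0 ->.
rewrite -integral_mkcond.
rewrite (@continuous_FTC2 R D F (- M) M); first by rewrite !F0 ?subee// ?normrN ger0_norm// ltW.
- by rewrite gtrN.
- exact: continuous_subspaceT.
- have cF : continuous F.
    by move=> a; apply/differentiable_continuous/derivable1_diffP; have [] := FD a.
  split.
  + by move=> a _; have [] := FD a.
  + by apply: cvg_at_right_filter; exact: cF.
  + by apply: cvg_at_left_filter; exact: cF.
- by move=> a _; rewrite derive1E; have [] := FD a.
Qed.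

Lemma cons_rV_continuous n (v : 'rV[R]_n) : continuous (fun a : R => cons_rV (a, v)).
Proof.
move=> a; apply/cvg_ballP => e e0; near=> b.
apply/ball_rVP => // i; have [j ->|->] := unliftP ord0 i.
  by rewrite !cons_rVS/= subrr normr0.
by rewrite !cons_rV0/=; near: b; apply/cvgr_dist_lt => //; exact: cvg_id.
Unshelve. all: by end_near. Qed.

Lemma cons_rV_continuous2 n (a : R) : continuous (fun v : 'rV[R]_n => cons_rV (a, v)).
Proof.
move=> v A /nbhs_ballP[e e0 eA]; apply/nbhs_ballP; exists e => // w vw; apply: eA.
move: vw => /(ball_rVP _ _ e0) vw.
apply/ball_rVP => // i; have [j ->|->] := unliftP ord0 i.
  by rewrite !cons_rVS/=.
by rewrite !cons_rV0/= subrr normr0.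
Qed.

(** The measure on ['rV_n.+1] is the image of a product measure under [cons_rV]; transferring
    integrals back makes Fubini available. *)
Lemma integrable_cons_rV n (h : 'rV[R]_n.+1 -> R) :
  (lebesgue_rV n.+1).-integrable setT (EFin \o h) ->
  (@lebesgue_measure R \x lebesgue_rV n)%E.-integrable setT (EFin \o h \o @cons_rV R n).
Proof.
move=> /integrableP[mh hoo]; apply/integrableP; split.
  move=> _ A mA; have m1 := mh measurableT A mA; rewrite setTI in m1.
  have := @measurable_cons_rV R n measurableT _ m1.
  by rewrite !setTI.
rewrite -(@ge0_integral_pushforward _ _ _ _ _ _ (@measurable_cons_rV R n) _ setT (abse \o (EFin \o h)))//.
  exact: measurableT_comp.
by move=> y _; exact: abse_ge0.
Qed.

Lemma integral_cons_rV n (h : 'rV[R]_n.+1 -> R) :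
  (lebesgue_rV n.+1).-integrable setT (EFin \o h) ->
  (\int[lebesgue_rV n.+1]_x (h x)%:E =
   \int[@lebesgue_measure R \x lebesgue_rV n]_p (h (cons_rV p))%:E)%E.
Proof.
move=> ih; have [mh _] := integrableP _ _ _ ih.
rewrite -(@integral_pushforward _ _ _ _ _ _ (@measurable_cons_rV R n) (@lebesgue_measure R \x lebesgue_rV n)%E setT (EFin \o h))//; last exact: integrable_cons_rV.
Qed.

(** By Fubini. If [i] is coordinate zero, integrating along it first gives zero by the fundamental
    theorem of calculus; otherwise freezing coordinate zero leaves the same claim in dimension
    [n]. *)
Lemma integral_partial n (f : 'rV[R]_n -> R) i :
  (forall x, derivable f x (delta_mx ord0 i)) -> continuous f ->
  continuous (partial i f) -> bsupp f ->
  (\int[lebesgue_rV n]_x (partial i f x)%:E = 0)%E.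
Proof.
elim: n f i => [f []//|n IH f i df cf cdf bf].
have ip := continuous_bsupp_integrable cdf (bsupp_partial i bf).
rewrite integral_cons_rV//; have ip2 := integrable_cons_rV ip.
have [M1 hM1] := bf; have [M2 hM2] := bsupp_partial i bf.
pose M := Num.max 1 (Num.max M1 M2).
have M0 : 0 < M by rewrite lt_max ltr01.
have [j ij|i0] := unliftP ord0 i; last first.
  rewrite -integral21_prod_meas1// /fubini_G.
  rewrite (_ : (fun y => _) = cst 0%E) ?integral0//; apply/funext => v /=.
  apply: (@integral_line_derive (fun a => f (cons_rV (a, v))) _ M) => //.
  - move=> a.
    have E b : cons_rV (b, v) = cons_rV (0, v) + b *: delta_mx ord0 ord0.
      apply/rowP => k; rewrite !mxE; case: unliftP => [l ->|->] /=.
        by rewrite mulr0 addr0.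
      by rewrite mulr1 add0r.
    rewrite (_ : (fun a => _) = fun b => f (cons_rV (0, v) + b *: delta_mx ord0 ord0)).
      by apply: is_derive_line; rewrite -E -i0; exact: DeriveDef.
    by apply/funext => b; rewrite -E.
  - by move=> a; apply: (continuous_comp (@cons_rV_continuous n v a)); exact: cdf.
  - move=> a Ma; apply: hM1; exists ord0; rewrite cons_rV0/=.
    by apply: le_trans Ma; rewrite !le_max lexx orbT.
  - move=> a Ma; apply: hM2; exists ord0; rewrite cons_rV0/=.
    by apply: le_trans Ma; rewrite !le_max lexx !orbT.
rewrite -integral12_prod_meas1// /fubini_F.
rewrite (_ : (fun y => _) = cst 0%E) ?integral0//; apply/funext => a /=.
have E h v : h *: delta_mx ord0 i + cons_rV (a, v) =
             cons_rV (a, h *: delta_mx ord0 j + v).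
  apply/rowP => k; rewrite !mxE; case: unliftP => [l ->|->] /=.
    by rewrite !mxE ij (inj_eq lift_inj).
  by rewrite ij (negbTE (neq_lift _ _)) mulr0 add0r.
have E2 v : partial i f (cons_rV (a, v)) = partial j (fun v => f (cons_rV (a, v))) v.
  rewrite /partial /derive.
  rewrite (_ : (fun h => h^-1 *: _) =
    (fun h => h^-1 *: (f (cons_rV (a, h *: delta_mx ord0 j + v)) - f (cons_rV (a, v)))))//.
  by apply/funext => h; rewrite /= E.
under eq_integral do rewrite E2.
apply: IH.
- move=> v; have := df (cons_rV (a, v)); rewrite /derivable.
  rewrite (_ : (fun h => h^-1 *: (f (h *: delta_mx ord0 i + _) - _)) =
    (fun h => h^-1 *: (f (cons_rV (a, h *: delta_mx ord0 j + v)) - f (cons_rV (a, v)))))//.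
  by apply/funext => h; rewrite E.
- by move=> v; apply: (continuous_comp (@cons_rV_continuous2 n a v)); exact: cf.
- rewrite (_ : partial j _ = (fun v => partial i f (cons_rV (a, v)))).
    by move=> v; apply: (continuous_comp (@cons_rV_continuous2 n a v)); exact: cdf.
  by apply/funext => v; rewrite E2.
- exists M1 => v [k Mk]; apply: hM1; exists (lift ord0 k).
  by rewrite cons_rVS.
Qed.

End bounded_support.

(** * Smooth functions *)

Section directional.
Context {R : realType} {n : nat}.
Implicit Types (f g : 'rV[R]_n -> R) (x v : 'rV[R]_n).

(** Moves directional derivatives to functions of one real variable, where the chain rule and the
    mean value theorem are available. *)
Lemma is_derive_lineP f x v (t df : R) :
  is_derive (x + t *: v) v f df <->
  is_derive t 1 (fun s : R => f (x + s *: v)) df.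
Proof.
have E : (fun h : R => h^-1 *: ((fun s => f (x + s *: v)) (h *: 1 + t) - f (x + t *: v))) =
         (fun h => h^-1 *: (f (h *: v + (x + t *: v)) - f (x + t *: v))).
  apply/funext => h; congr (_ *: (f _ - _)).
  by rewrite scalerDl /GRing.scale /= mulr1 addrCA addrA.
split=> -[fd <-].
  by split; [rewrite /derivable E|rewrite /derive E].
by split; [move: fd; rewrite /derivable E|rewrite /derive E].
Qed.

Lemma is_derive_comp1 (G : R -> R) f x v (dG df : R) :
  is_derive (f x) 1 G dG -> is_derive x v f df ->
  is_derive x v (G \o f) (dG * df).
Proof.
move=> hG hf.
have E : x = x + 0 *: v by rewrite scale0r addr0.
rewrite {1}E; apply/is_derive_lineP.
have hl : is_derive (0 : R) 1 (fun s : R => f (x + s *: v)) df.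
  by apply/is_derive_lineP; rewrite -E.
have := @is_derive1_comp R G (fun s : R => f (x + s *: v)) 0 dG df.
rewrite scale0r addr0; exact.
Qed.

Lemma class_C_cst k (D : set 'rV[R]_n) (c : R) : class_C k D (fun=> c).
Proof.
elim: k c => [|k IH] c /=; (split; first by move=> x _; exact: cst_continuous) => //.
move=> i; split=> [x _|]; first exact: derivable_cst.
rewrite (_ : partial i _ = fun=> 0) //; apply/funext => x; exact: derive_cst.
Qed.

Lemma class_CS k (D : set 'rV[R]_n) f : class_C k.+1 D f -> class_C k D f.
Proof.
elim: k f => [|k IH] f /= [cf hf]; split=> // i.
by have [df /IH] := hf i.
Qed.

Lemma class_CD k f g : class_C k setT f -> class_C k setT g ->
  class_C k setT (fun x => f x + g x).
Proof.
elim: k f g => [|k IH] f g /= [cf hf] [cg hg].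
  by split=> // x _; apply: continuousD; [exact: cf|exact: cg].
split=> [x _|i]; first by apply: continuousD; [exact: cf|exact: cg].
have [df pf] := hf i; have [dg pg] := hg i.
split=> [x _|]; first by apply: derivableD; [exact: df|exact: dg].
rewrite (_ : partial i _ = fun x => partial i f x + partial i g x); first exact: IH.
by apply/funext => x; rewrite /partial deriveD//; [exact: df|exact: dg].
Qed.

Lemma class_CM k f g : class_C k setT f -> class_C k setT g ->
  class_C k setT (fun x => f x * g x).
Proof.
elim: k f g => [|k IH] f g Cf Cg; have := Cf; have := Cg; move=> /= [cg hg] [cf hf].
  by split=> // x _; apply: continuousM; [exact: cf|exact: cg].
split=> [x _|i]; first by apply: continuousM; [exact: cf|exact: cg].
have [df pf] := hf i; have [dg pg] := hg i.
split=> [x _|]; first by apply: derivableM; [exact: df|exact: dg].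
rewrite (_ : partial i _ = fun x => f x * partial i g x + g x * partial i f x).
  by apply: class_CD; apply: IH => //; exact: class_CS.
by apply/funext => x; rewrite /partial deriveM//; [exact: df|exact: dg].
Qed.

Lemma partial_coord (i j : 'I_n) x :
  is_derive x (delta_mx ord0 i) (fun y : 'rV[R]_n => y ord0 j) ((i == j)%:R).
Proof.
have E : x = x + 0 *: delta_mx ord0 i by rewrite scale0r addr0.
rewrite {1}E; apply/is_derive_lineP.
rewrite (_ : (fun s : R => _) = (fun s : R => x ord0 j + s * (i == j)%:R)).
  have := @is_deriveD R R R (cst (x ord0 j)) (fun s => s * (i == j)%:R) 0 1 0 (i == j)%:R.
  rewrite add0r; apply; have := is_deriveM (is_derive_id (0 : R) 1) (is_derive_cst ((i == j)%:R : R) (0 : R) 1).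
  by rewrite scaler0 add0r /GRing.scale /= mulr1.
by apply/funext => s; rewrite !mxE eqxx /= eq_sym.
Qed.

Lemma class_C_coord k (j : 'I_n) : class_C k setT (fun x : 'rV[R]_n => x ord0 j).
Proof.
case: k => [|k] /=; (split; first by move=> x _; exact: coord_continuous) => // i.
have H x := @partial_coord i j x.
split=> [x _|]; first by have [] := H x.
rewrite (_ : partial i _ = fun=> (i == j)%:R); first exact: class_C_cst.
by apply/funext => x; have [_ ] := H x.
Qed.

Lemma class_C_comp k (G : nat -> R -> R) j f :
  (forall m (t : R), is_derive t 1 (G m) (G m.+1 t)) ->
  class_C k setT f -> class_C k setT (fun x => G j (f x)).
Proof.
move=> hG; elim: k j f => [|k IH] j f Cf; have := Cf => -[cf hf].
  split=> // x _; apply: (@continuous_comp _ _ _ f (G j)); first exact: cf.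
  by apply/differentiable_continuous/derivable1_diffP; have [] := hG j (f x).
split=> [x _|i].
  apply: (@continuous_comp _ _ _ f (G j)); first exact: cf.
  by apply/differentiable_continuous/derivable1_diffP; have [] := hG j (f x).
have [df pf] := hf i.
have H x : is_derive x (delta_mx ord0 i) (G j \o f) (G j.+1 (f x) * partial i f x).
  by apply: is_derive_comp1 => //; apply: DeriveDef => //; exact: df.
split=> [x _|]; first by have [] := H x.
rewrite (_ : partial i _ = fun x => G j.+1 (f x) * partial i f x).
  by apply: class_CM => //; apply: IH; exact: class_CS.
by apply/funext => x; have [_] := H x.
Qed.

Lemma smooth_cst (c : R) : smooth setT ((fun=> c) : 'rV[R]_n -> R).
Proof. by move=> k; exact: class_C_cst. Qed.

Lemma smoothD f g : smooth setT f -> smooth setT g -> smooth setT (fun x => f x + g x).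
Proof. by move=> sf sg k; apply: class_CD. Qed.

Lemma smoothM f g : smooth setT f -> smooth setT g -> smooth setT (fun x => f x * g x).
Proof. by move=> sf sg k; apply: class_CM. Qed.

Lemma smoothN f : smooth setT f -> smooth setT (fun x => - f x).
Proof.
move=> sf; rewrite (_ : (fun x => _) = fun x => -1 * f x).
  by apply: smoothM => //; exact: smooth_cst.
by apply/funext => x; rewrite mulN1r.
Qed.

Lemma smoothB f g : smooth setT f -> smooth setT g -> smooth setT (fun x => f x - g x).
Proof. by move=> sf sg; apply: smoothD => //; exact: smoothN. Qed.

Lemma smooth_sum I (r : seq I) (F : I -> 'rV[R]_n -> R) :
  (forall i, smooth setT (F i)) -> smooth setT (fun x => \sum_(i <- r) F i x).
Proof.
move=> sF; elim: r => [|a r IH].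
  by under eq_fun do rewrite big_nil; exact: smooth_cst.
by under eq_fun do rewrite big_cons; exact: smoothD.
Qed.

Lemma smooth_prod I (r : seq I) (F : I -> 'rV[R]_n -> R) :
  (forall i, smooth setT (F i)) -> smooth setT (fun x => \prod_(i <- r) F i x).
Proof.
move=> sF; elim: r => [|a r IH].
  by under eq_fun do rewrite big_nil; exact: smooth_cst.
by under eq_fun do rewrite big_cons; exact: smoothM.
Qed.

Lemma smooth_coord (j : 'I_n) : smooth setT (fun x : 'rV[R]_n => x ord0 j).
Proof. by move=> k; exact: class_C_coord. Qed.

Lemma smooth_continuous f : smooth setT f -> continuous f.
Proof. by move=> /(_ 0%N)[cf _] x; exact: cf. Qed.

Lemma smooth_derivable f i x : smooth setT f -> derivable f x (delta_mx ord0 i).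
Proof. by move=> /(_ 1%N)[_ /(_ i)[df _]]; exact: df. Qed.

Lemma smooth_partial f i : smooth setT f -> smooth setT (partial i f).
Proof. by move=> sf k; have [_ /(_ i)[]] := sf k.+1. Qed.

Lemma smooth_is_derive f i x : smooth setT f ->
  is_derive x (delta_mx ord0 i) f (partial i f x).
Proof. by move=> sf; apply: DeriveDef => //; exact: smooth_derivable. Qed.

End directional.

(** * Flat functions, the smooth truncation and the smooth step *)

Section flat.
Context {R : realType}.
Implicit Types (p : {poly R}) (s t : R).

(** The functions [P(1/t) exp(-1/t)] extended by zero: a family that contains [exp(-1/t)] and is
    closed under differentiation. *)
Definition flat p t : R := if t <= 0 then 0 else p.[t^-1] * expR (- t^-1).

(** For [m > 0] this is [s/m <= exp(s/m)] raised to the power [m]. *)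
Lemma exprn_expR_bound m s : 0 <= s -> s ^+ m <= m%:R ^+ m * expR s.
Proof.
case: m => [|m] s0; first by rewrite !expr0 mul1r -[leLHS]expR0 ler_expR.
have -> : expR s = expR (s / m.+1%:R) ^+ m.+1.
  by rewrite -expRM_natl mulrCA divff ?mulr1.
rewrite -exprMn lerXn2r ?nnegrE ?mulr_ge0 ?expR_ge0//.
rewrite -ler_pdivrMl// mulrC; apply: le_trans (expR_ge1Dx _).
by rewrite lerDr.
Qed.

Lemma horner_expR_bound p : exists2 C : R, 0 <= C &
  forall s, 0 <= s -> `|p.[s]| * expR (- s) <= C.
Proof.
exists (\sum_(i < size p) `|p`_i| * i%:R ^+ i).
  by apply: sumr_ge0 => i _; rewrite mulr_ge0// exprn_ge0.
move=> s s0; rewrite expRN ler_pdivrMr ?expR_gt0// horner_coef.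
apply: le_trans (ler_norm_sum _ _ _) _; rewrite mulr_suml; apply: ler_sum => i _.
rewrite normrM -mulrA ler_wpM2l// normrX ger0_norm//; exact: exprn_expR_bound.
Qed.

Lemma flat_le0 p t : t <= 0 -> flat p t = 0.
Proof. by rewrite /flat => ->. Qed.

(** The exponential absorbs the extra factor ['X^2]. A bound by [t^2] makes the difference quotient
    at the origin tend to zero. *)
Lemma flat_quadratic_bound p : exists2 C : R, 0 <= C &
  forall t, `|flat p t| <= C * t ^+ 2.
Proof.
have [C C0 hC] := horner_expR_bound (p * 'X^2).
exists C => // t; rewrite /flat; case: ifPn => [_|]; first by rewrite normr0 mulr_ge0// sqr_ge0.
rewrite -ltNge => t0; have := hC t^-1; rewrite invr_ge0 ltW// => /(_ isT).
rewrite hornerM hornerXn normrM [`|t^-1 ^+ 2|]ger0_norm ?sqr_ge0// => h.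
rewrite normrM [`|expR _|]ger0_norm ?expR_ge0//.
by rewrite -ler_pdivrMr ?exprn_gt0// -exprVn mulrAC.
Qed.

(** For [t > 0] the chain rule gives [t^-2 (P - P')(1/t) exp(-1/t)]; at the origin the quadratic
    bound gives derivative zero. *)
Lemma is_derive_flat p t : is_derive t 1 (flat p) (flat ('X^2 * (p - p^`())) t).
Proof.
have [t0|t0|->] := ltgtP t 0.
- rewrite [flat _ t]flat_le0 ?ltW//.
  apply: (@near_eq_is_derive _ _ _ (cst 0)).
  - by near=> u; rewrite flat_le0// ltW//; near: u; exact: (cvgr_lt _ (@cvg_id _ (nbhs t)) _ t0).
- have t0' : t != 0 by rewrite gt_eqF.
  rewrite [X in is_derive _ _ _ X]/flat leNgt t0 /=.
  have hV : is_derive t 1 (fun u : R => u^-1) (- t ^- 2).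
    apply: DeriveDef; first exact: (@derivableV _ _ id).
    by rewrite (@deriveV _ _ id)// derive_id /GRing.scale /= mulr1.
  have hp := is_derive1_comp (is_derive_poly p t^-1) hV.
  have hN : is_derive t 1 (fun u : R => - u^-1) (- - t ^- 2) := is_deriveN hV.
  have he := @is_derive1_comp R expR (fun u => - u^-1) t _ _ (is_derive_expR _) hN.
  have H := is_deriveM hp he.
  apply: near_eq_is_derive (is_derive_eq H _).
  - near=> u; rewrite /flat leNgt ifF//; apply/negbTE; rewrite negbK; near: u.
    exact: (cvgr_gt _ (@cvg_id _ (nbhs t)) _ t0).
  - rewrite /GRing.scale /= hornerM hornerXn hornerD hornerN -exprVn; ring.
- rewrite [flat _ 0]flat_le0//.
  have [C C0 hC] := flat_quadratic_bound p.
  have L : h^-1 *: (flat p (h *: 1 + 0) - flat p 0) @[h --> 0^'] --> (0 : R).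
    apply/cvgr0Pnorm_le => e e0; near=> h.
    rewrite [flat p 0]flat_le0// subr0 addr0 /GRing.scale /= mulr1 normrM normfV.
    have h0 : h != 0 by near: h; exact: nbhs_dnbhs_neq.
    rewrite ler_pdivrMl ?normr_gt0//; apply: le_trans (hC h) _.
    have he : `|h| <= e / (C + 1) by near: h; apply: dnbhs0_le; rewrite divr_gt0// ltr_wpDl.
    have {}he : C * `|h| <= e.
      move: he; rewrite ler_pdivlMr ?ltr_wpDl// => he; apply: le_trans he.
      by rewrite mulrC ler_wpM2l// lerDl.
    by rewrite -real_normK ?num_real// expr2 mulrCA ler_wpM2l.
  split; [exact: cvgP L|exact: cvg_lim L].
Unshelve. all: by end_near. Qed.

Definition dflat m : R -> R := flat (iter m (fun p => 'X^2 * (p - p^`())) 1).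

Lemma is_derive_dflat m t : is_derive t 1 (dflat m) (dflat m.+1 t).
Proof. exact: is_derive_flat. Qed.

(** The function [exp(-1/t)], a smooth substitute for the positive part. Its derivative [dcut] takes
    values in [[0, 1]] and serves as a convex weight. *)
Definition cut : R -> R := dflat 0.
Definition dcut : R -> R := dflat 1.

#[global] Arguments cut : simpl never.
#[global] Arguments dcut : simpl never.

Lemma cutE t : 0 < t -> cut t = expR (- t^-1).
Proof. by move=> t0; rewrite /cut /dflat /flat leNgt t0 /= hornerC mul1r. Qed.

Lemma dcutE t : 0 < t -> dcut t = t^-1 ^+ 2 * expR (- t^-1).
Proof.
move=> t0; rewrite /dcut /dflat /flat leNgt t0 /=.
by rewrite hornerM hornerXn derivC subr0 hornerC mulr1.
Qed.

Lemma cut_le0 t : t <= 0 -> cut t = 0.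
Proof. exact: flat_le0. Qed.

Lemma dcut_le0 t : t <= 0 -> dcut t = 0.
Proof. exact: flat_le0. Qed.

Lemma cut_gt0 t : 0 < t -> 0 < cut t.
Proof. by move=> t0; rewrite cutE// expR_gt0. Qed.

Lemma cut_ge0 t : 0 <= cut t.
Proof. by have [/cut_le0 ->//|/cut_gt0/ltW] := leP t 0. Qed.

Lemma dcut_ge0 t : 0 <= dcut t.
Proof.
have [/dcut_le0 ->//|t0] := leP t 0; rewrite dcutE//.
by rewrite mulr_ge0 ?sqr_ge0// expR_ge0.
Qed.

(** With [1/t = 4 y], the claim [(4 y)^2 <= exp(4 y)] follows from [4 y <= (1 + y)^2] and
    [1 + y <= exp y]. *)
Lemma dcut_le1 t : dcut t <= 1.
Proof.
have [/dcut_le0 ->//|t0] := leP t 0; rewrite dcutE// expRN ler_pdivrMr ?expR_gt0// mul1r.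
set s := t^-1; have s0 : 0 <= s by rewrite invr_ge0 ltW.
rewrite (_ : s = 4%:R * (s / 4)); last by rewrite mulrC divfK.
have := expR_ge1Dx (s / 4); set y := s / 4 => h.
have y0 : 0 <= y by rewrite divr_ge0.
rewrite expRM_natl (_ : 4 = 2 * 2)%N// exprM lerXn2r ?nnegrE ?mulr_ge0 ?sqr_ge0//.
apply: (@le_trans _ _ ((1 + y) ^+ 2)); first by rewrite natrM -subr_ge0 (_ : _ - _ = (1 - y) ^+ 2) ?sqr_ge0//; ring.
by rewrite lerXn2r ?nnegrE ?expR_ge0// addr_ge0.
Qed.

Lemma cut_lip s t : s <= t -> 0 <= cut t - cut s <= t - s.
Proof.
move=> st; have [//||c _ ->] := @MVT_segment R cut dcut s t st.
- by move=> x _; exact: is_derive_dflat.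
- apply: continuous_subspaceT => x; apply/differentiable_continuous/derivable1_diffP.
  by have [] := is_derive_dflat 0 x.
have ts : 0 <= t - s by rewrite subr_ge0.
by rewrite mulr_ge0 ?dcut_ge0//= ler_piMl// dcut_le1.
Qed.

(* A smooth step function, from 0 on the negative half-line to 1 on [1, +oo[;
   both plateaus come from [cut] vanishing on the negative half-line. *)
Definition step t : R := 1 - (cut (cut 1))^-1 * cut (cut 1 - cut t).

#[global] Arguments step : simpl never.

Let cc0 : 0 < cut (cut 1).
Proof. by rewrite !cut_gt0. Qed.

Lemma step_le0 t : t <= 0 -> step t = 0.
Proof.
by move=> t0; rewrite /step (cut_le0 t0) subr0 mulVf ?subrr// gt_eqF.
Qed.

Lemma step_ge1 t : 1 <= t -> step t = 1.
Proof.
move=> t1; rewrite /step [cut (_ - _)]cut_le0 ?mulr0 ?subr0//.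
by rewrite subr_le0 -subr_ge0; have /andP[] := cut_lip t1.
Qed.

Lemma step_ge0 t : 0 <= step t.
Proof.
rewrite /step subr_ge0 mulrC ler_pdivrMr// mul1r -subr_ge0.
suff st : cut 1 - cut t <= cut 1 by have /andP[] := cut_lip st.
by rewrite gerBl cut_ge0.
Qed.

Lemma step_le1 t : step t <= 1.
Proof. by rewrite gerBl mulr_ge0 ?cut_ge0// invr_ge0 ltW. Qed.

Section smooth_step.
Context {n : nat}.
Implicit Types (f : 'rV[R]_n -> R).

Lemma smooth_cut f : smooth setT f -> smooth setT (fun x => cut (f x)).
Proof. by move=> sf k; apply: (class_C_comp 0 is_derive_dflat). Qed.

Lemma smooth_dcut f : smooth setT f -> smooth setT (fun x => dcut (f x)).
Proof. by move=> sf k; apply: (class_C_comp 1 is_derive_dflat). Qed.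

Lemma partial_cut f i x : smooth setT f ->
  partial i (fun x => cut (f x)) x = dcut (f x) * partial i f x.
Proof.
move=> sf.
by have [_] := is_derive_comp1 (is_derive_dflat 0 (f x)) (smooth_is_derive i x sf).
Qed.

Lemma smooth_step f : smooth setT f -> smooth setT (fun x => step (f x)).
Proof.
move=> sf; apply: smoothB; first exact: smooth_cst.
apply: smoothM; first exact: smooth_cst.
by apply/smooth_cut/smoothB; [exact: smooth_cst|exact: smooth_cut].
Qed.

Lemma partial_step_ge1 f i x : smooth setT f -> 1 <= f x ->
  partial i (fun x => step (f x)) x = 0.
Proof.
move=> sf f1.
have sh : smooth setT (fun x => cut 1 - cut (f x)).
  by apply: smoothB; [exact: smooth_cst|exact: smooth_cut].
have H := smooth_is_derive i x (smooth_cut sh).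
have := is_deriveB (is_derive_cst (1 : R) x (delta_mx ord0 i))
  (is_deriveM (is_derive_cst (cut (cut 1))^-1 x (delta_mx ord0 i)) H).
move=> [_]; rewrite /partial => ->.
rewrite -/(partial i _ x) partial_cut// dcut_le0; last first.
  by rewrite subr_le0 -subr_ge0; have /andP[] := cut_lip f1.
by rewrite mul0r !scaler0 addr0 subr0.
Qed.

End smooth_step.

End flat.

(** * Weak gradients *)

Section density.
Context d (T : measurableType d) (R : realType).
Variables (mu : {measure set T -> \bar R}) (f : T -> \bar R).
Hypotheses (mf : measurable_fun setT f) (f0 : forall x, (0 <= f x)%E).

(** Turning the positive and negative parts of a function into measures allows comparing them on a
    generating pi-system only. *)
Definition density (A : set T) : \bar R := (\int[mu]_(x in A) f x)%E.

Let density0 : density set0 = 0%E.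
Proof. by rewrite /density integral_set0. Qed.

Let density_ge0 A : (0 <= density A)%E.
Proof. by apply: integral_ge0 => x _; exact: f0. Qed.

Let density_sigma_additive : semi_sigma_additive density.
Proof.
move=> F mF tF mUF; rewrite /density ge0_integral_bigcup//.
- by apply: is_cvg_nneseries => k _ _; exact: density_ge0.
- exact: measurable_funTS.
Qed.

HB.instance Definition _ := isMeasure.Build _ _ _ density
  density0 density_ge0 density_sigma_additive.

Definition density_measure : {measure set T -> \bar R} := density.

End density.

Section vanish.
Context d (T : measurableType d) (R : realType) (mu : {measure set T -> \bar R}).
Local Open Scope ereal_scope.

Lemma integral_vanish (A B : set T) (F : T -> \bar R) : B `<=` A ->
  (forall x, A x -> ~ B x -> F x = 0) -> \int[mu]_(x in A) F x = \int[mu]_(x in B) F x.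
Proof.
move=> BA F0; rewrite integral_mkcond [RHS]integral_mkcond; apply: eq_integral => x _.
rewrite !patchE; case: ifPn => xA; case: ifPn => xB //.
  by rewrite F0//; [exact: set_mem|rewrite notin_setE in xB].
by rewrite (mem_set (BA _ (set_mem xB))) in xA.
Qed.

End vanish.

Section sigma_boxes.
Context {R : realType} {n : nat}.

Definition boxes : set (set 'rV[R]_n) := [set box p.1 p.2 | p in [set: 'rV[R]_n * 'rV[R]_n]].

Lemma boxesP c d : boxes (box c d).
Proof. by exists (c, d). Qed.

Lemma setI_closed_boxes : setI_closed boxes.
Proof. by move=> _ _ [p _ <-] [q _ <-]; rewrite setI_box; exact: boxesP. Qed.

Lemma bigcup_box : \bigcup_k box (const_mx (- k%:R) : 'rV[R]_n) (const_mx k%:R) = setT.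
Proof.
apply/seteqP; split=> // x _.
exists (Num.trunc (\sum_i `|x ord0 i|)).+1 => // i; rewrite !mxE -ltr_norml.
apply: le_lt_trans (truncnS_gt _); rewrite (bigD1 i)//= lerDl.
by apply: sumr_ge0.
Qed.

(** A half-space [x_i > a] is the countable union of the boxes of half-side [k] cut at [a] in
    direction [i]. *)
Lemma measurable_sigma_boxes (A : set 'rV[R]_n) : measurable A -> <<s boxes >> A.
Proof.
apply: smallest_sub; first exact: smallest_sigma_algebra.
rewrite -bigcup_seq; apply: bigcup_sub => i _ _ [B mB <-].
have mc : measurable_fun setT
    ((fun v : 'rV[R]_n => v ord0 i) : g_sigma_algebraType boxes -> measurableTypeR R).
  apply: (measurability _ (RGenOInfty.measurableE R)) => _ [_ [a ->] <-].
  rewrite setTI.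
  rewrite (_ : _ @^-1` _ = \bigcup_k box
    (\row_j if j == i then a else - k%:R) (const_mx k%:R : 'rV[R]_n)); last first.
    apply/seteqP; split=> [x /=|x [k _ /(_ i)]]; rewrite /= in_itv/= andbT; last first.
      by rewrite !mxE eqxx => /andP[].
    move=> ax; have : setT x by []. rewrite -bigcup_box => -[k _ kx].
    exists k => // j; have := kx j; rewrite !mxE => /andP[h1 h2].
    by case: eqP => [->|_]; rewrite ?ax ?h1 ?h2 //; have := kx i; rewrite !mxE => /andP[].
  apply: bigcupT_measurable => k; apply: sub_sigma_algebra; exact: boxesP.
by have := mc measurableT B mB.
Qed.

End sigma_boxes.

(** * The fundamental lemma of the calculus of variations *)

Section fundamental.
Context {R : realType} {n : nat}.
Local Notation mu := (@lebesgue_rV R n).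
Implicit Types (Omega : set 'rV[R]_n) (h phi : 'rV[R]_n -> R) (c d : 'rV[R]_n).

Lemma test_function_of (A K : set 'rV[R]_n) phi : smooth setT phi ->
  compact K -> K `<=` A -> (forall x, ~ K x -> phi x = 0) -> test_function A phi.
Proof.
move=> sphi cK KA phi0.
have clK : closed K by apply: compact_closed => //; exact: norm_hausdorff.
have sub : closure [set x | phi x != 0] `<=` K.
  rewrite (_ : K = closure K); last exact/closure_id.
  by apply: closure_subset => x /= /eqP h; apply: contrapT => /phi0.
split=> //; last exact: subset_trans KA.
by apply: subclosed_compact cK sub; exact: closed_closure.
Qed.

(** A product of one-dimensional smooth plateaus, converging pointwise to the indicator of the open
    box as [k] grows. *)
Definition bump c d (k : nat) (x : 'rV[R]_n) : R :=
  \prod_i (step (k%:R * (x ord0 i - c ord0 i)) * step (k%:R * (d ord0 i - x ord0 i))).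

Lemma smooth_bump c d k : smooth setT (bump c d k).
Proof.
apply: smooth_prod => i; apply: smoothM; apply: smooth_step.
  apply: smoothM; first exact: smooth_cst.
  by apply: smoothB; [exact: smooth_coord|exact: smooth_cst].
apply: smoothM; first exact: smooth_cst.
by apply: smoothB; [exact: smooth_cst|exact: smooth_coord].
Qed.

Lemma bump01 c d k x : 0 <= bump c d k x <= 1.
Proof.
rewrite /bump; elim/big_ind: _ => [|a b /andP[a0 a1] /andP[b0 b1]|i _].
- by rewrite ler01 lexx.
- by rewrite mulr_ge0//= mulr_ile1.
- by rewrite mulr_ge0 ?step_ge0//= mulr_ile1 ?step_ge0 ?step_le1.
Qed.

Lemma bump_out c d k x : ~ box c d x -> bump c d k x = 0.
Proof.
move=> /existsNP[i /negP]; rewrite negb_and -!leNgt => hi.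
suff F0 : step (k%:R * (x ord0 i - c ord0 i)) * step (k%:R * (d ord0 i - x ord0 i)) = 0.
  by apply/eqP/prodf_eq0; exists i => //; apply/eqP.
move: hi => /orP[h|h].
  have -> : step (k%:R * (x ord0 i - c ord0 i)) = 0.
    by apply: step_le0; rewrite mulr_ge0_le0// subr_le0.
  by rewrite mul0r.
have -> : step (k%:R * (d ord0 i - x ord0 i)) = 0.
  by apply: step_le0; rewrite mulr_ge0_le0// subr_le0.
by rewrite mulr0.
Qed.

Lemma bump_cvg c d x : box c d x -> bump c d k x @[k --> \oo] --> (1 : R).
Proof.
move=> cdx; apply: cvg_near_cst.
have H (e : R) : 0 < e -> \forall k \near \oo, 1 <= k%:R * e.
  move=> e0; near=> k; rewrite -ler_pdivrMr//; near: k; exact: nbhs_infty_ger.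
have : \forall k \near \oo, forall i, 1 <= k%:R * (x ord0 i - c ord0 i) /\
    1 <= k%:R * (d ord0 i - x ord0 i).
  apply: filter_forall => i; have /andP[h1 h2] := cdx i.
  rewrite -subr_gt0 in h1; rewrite -subr_gt0 in h2.
  by apply: filterS2 (H _ h1) (H _ h2) => k; split.
apply: filterS => k hk; rewrite /bump big1// => i _; have [h1 h2] := hk i.
by rewrite !step_ge1 ?mulr1.
Unshelve. all: by end_near. Qed.

Lemma bump_test Omega c d k : cbox c d `<=` Omega -> test_function Omega (bump c d k).
Proof.
move=> cdO; apply: (@test_function_of _ (cbox c d)) => //.
- exact: smooth_bump.
- exact: compact_cbox.
- by move=> x xcd; apply: bump_out => /box_cbox.
Qed.

(** Dominated convergence along the functions [bump c d k], with bound [|h|], integrable because the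
    closed box is a compact subset of [Omega]. *)
Lemma integral_box_eq0 Omega h c d :
  Defs.locally_integrable Omega h ->
  (forall phi, test_function Omega phi -> \int[mu]_(x in Omega) (h x * phi x) = 0) ->
  cbox c d `<=` Omega -> (\int[mu]_(x in box c d) (h x)%:E = 0)%E.
Proof.
move=> [_ /(_ (cbox c d) (@compact_cbox _ _ _ _)) ih] h0 cdO.
have mB := measurable_box c d.
have {}ih : mu.-integrable (box c d) (EFin \o h).
  by apply: integrableS (ih cdO) => //; [exact: measurable_cbox|exact: box_cbox].
have [mh _] := integrableP _ _ _ ih.
have mhk k : measurable_fun (box c d) (fun x => (h x * bump c d k x)%:E).
  apply/measurable_EFinP; apply: measurable_funM; first exact/measurable_EFinP.
  by apply: measurable_funTS; apply: continuous_measurable_rV; apply: smooth_continuous; exact: smooth_bump.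
have hk k : (\int[mu]_(x in box c d) (h x * bump c d k x)%:E = 0)%E.
  have : mu.-integrable (box c d) (fun x => (h x * bump c d k x)%:E).
    apply: le_integrable ih => // x _; rewrite /= lee_fin normrM ler_piMr//.
    by have /andP[b0 b1] := bump01 c d k x; rewrite ger0_norm.
  (* [Rintegral] sends infinite values to 0, so integrability is needed to conclude that the
     extended integral is zero. *)
  move=> ihk; have := h0 _ (bump_test k cdO); rewrite /Rintegral.
  rewrite (@integral_vanish _ _ _ _ _ (box c d)).
  - by move=> /eqP; rewrite fine_eq0 ?integrable_fin_num// => /eqP.
  - exact: subset_trans (@box_cbox _ _ _ _) cdO.
  - by move=> x _ /bump_out ->; rewrite mulr0.
have iah : mu.-integrable (box c d) (fun x => `|h x|%:E).
  by rewrite (_ : (fun x => _) = abse \o (EFin \o h))//; exact: integrable_abse.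
have c1 : {ae mu, forall x, box c d x ->
    (h x * bump c d k x)%:E @[k --> \oo] --> (EFin \o h) x}.
  apply: aeW => x xcd /=; apply/fine_cvgP; split; first exact: nearW.
  rewrite -[X in _ --> X]mulr1; apply: cvgM; first exact: cvg_cst.
  exact: bump_cvg.
have c2 : {ae mu, forall x (k : nat), box c d x ->
    (`|(h x * bump c d k x)%:E| <= `|h x|%:E)%E}.
  apply: aeW => x k _; rewrite /= lee_fin normrM ler_piMr//.
  by have /andP[b0 b1] := bump01 c d k x; rewrite ger0_norm.
have [_ _] := @dominated_convergence _ _ _ mu (box c d) mB
  (fun k x => (h x * bump c d k x)%:E) (EFin \o h) (fun x => `|h x|%:E) mhk mh c1 iah c2.
rewrite /= (_ : (fun k => _) = cst 0%E); last by apply/funext => k; rewrite /= hk.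
by move=> /cvg_lim <-//; rewrite lim_cst.
Qed.

(** The measures with densities [f^+] and [f^-] agree on boxes, a generating pi-system that exhausts
    the space, hence everywhere. On [f > 0] the second one vanishes, so [f^+] has zero integral
    there and the set is null; the set [f < 0] is symmetric. *)
Lemma ae_eq0_of_boxes (f : 'rV[R]_n -> \bar R) : mu.-integrable setT f ->
  (forall c d, \int[mu]_(x in box c d) f x = 0)%E -> {ae mu, forall x, f x = 0%E}.
Proof.
move=> intf f0; have [mf foo] := integrableP _ _ _ intf.
have mfp : measurable_fun setT (f^\+)%E by exact: measurable_funepos.
have mfn : measurable_fun setT (f^\-)%E by exact: measurable_funeneg.
pose m1 := density_measure mu mfp (funepos_ge0 f).
pose m2 := density_measure mu mfn (funeneg_ge0 f).
have finp (A : set 'rV[R]_n) : measurable A -> m1 A \is a fin_num.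
  move=> mA; apply: integrable_fin_num => //; apply: integrable_funepos => //.
  exact: integrableS intf.
have finn (A : set 'rV[R]_n) : measurable A -> m2 A \is a fin_num.
  move=> mA; apply: integrable_fin_num => //; apply: integrable_funeneg => //.
  exact: integrableS intf.
have m12 (A : set 'rV[R]_n) : measurable A -> m1 A = m2 A.
  move=> mA.
  apply: (g_sigma_algebra_measure_unique boxes _
    (fun k => box (const_mx (- k%:R)) (const_mx k%:R))).
  - by move=> _ [p _ <-]; exact: measurable_box.
  - by move=> k; exact: boxesP.
  - exact: bigcup_box.
  - exact: setI_closed_boxes.
  - move=> _ [p _ <-]; have mB := measurable_box p.1 p.2.
    have := f0 p.1 p.2; rewrite integralE => /eqP.
    have h1 := finp _ mB; have h2 := finn _ mB.
    change ((m1 (box p.1 p.2) - m2 (box p.1 p.2))%E == 0%E ->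
      m1 (box p.1 p.2) = m2 (box p.1 p.2)).
    by rewrite -(fineK h1) -(fineK h2) -EFinB eqe subr_eq0 => /eqP ->.
  - by move=> k; rewrite ltey_eq finp//; exact: measurable_box.
  - exact: measurable_sigma_boxes.
have half (g : 'rV[R]_n -> \bar R) (A : set 'rV[R]_n) : measurable A ->
    (forall x, A x -> g x != 0%E) -> measurable_fun setT g -> (forall x, (0 <= g x)%E) ->
    (\int[mu]_(x in A) g x = 0)%E -> mu.-negligible A.
  move=> mA gA mg g0 gi.
  have /(ae_eq_integral_abs mu mA (measurable_funTS mg)) : (\int[mu]_(x in A) `|g x| = 0)%E.
    by under eq_integral do rewrite gee0_abs//.
  apply: negligibleS => x Ax /=; apply/not_implyP; split=> //.
  by apply/eqP/gA.
have mpos : measurable [set x | (0 < f x)%E].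
  by rewrite -[X in measurable X]setTI; apply: emeasurable_fun_o_infty.
have mneg : measurable [set x | (f x < 0)%E].
  by rewrite -[X in measurable X]setTI; apply: emeasurable_fun_infty_o.
have np : mu.-negligible [set x | (0 < f x)%E].
  apply: (half (f^\+)%E) => //.
  - by move=> x /= fx; rewrite funeposE (max_l (ltW fx)) gt_eqF.
  - rewrite -[LHS]/(m1 _) m12//; apply: integral0_eq => x /= fx.
    by rewrite funenegE; apply: max_r; rewrite leeNl oppe0 ltW.
have nn : mu.-negligible [set x | (f x < 0)%E].
  apply: (half (f^\-)%E) => //.
  - move=> x /= fx; have fx' : (0 < - f x)%E by rewrite oppe_gt0.
    by rewrite funenegE (max_l (ltW fx')) gt_eqF.
  - rewrite -[LHS]/(m2 _) -m12//; apply: integral0_eq => x /= fx.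
    by rewrite funeposE; apply: max_r; rewrite ltW.
apply: negligibleS (negligibleU np nn) => x /= /eqP; rewrite neq_lt => /orP[h|h]; [right|left]; exact: h.
Qed.

(** Countably many rational boxes with closure in [Omega] cover it, and in each of them [h] has zero
    integral over every smaller box. *)
Lemma fundamental_lemma Omega h : open Omega ->
  Defs.locally_integrable Omega h ->
  (forall phi, test_function Omega phi -> \int[mu]_(x in Omega) (h x * phi x) = 0) ->
  {ae mu, forall x, Omega x -> h x = 0}.
Proof.
move=> oO lh h0.
have loc c d : cbox c d `<=` Omega -> mu.-negligible (box c d `&` [set x | h x != 0]).
  move=> cdO; have mB := measurable_box c d.
  have ih : mu.-integrable setT ((EFin \o h) \_ (box c d)).
    apply/(integrable_mkcond _ mB).
    apply: integrableS (lh.2 _ (@compact_cbox _ _ c d) cdO) => //; first exact: measurable_cbox.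
    exact: box_cbox.
  have := ae_eq0_of_boxes ih => /(_ _)/wrap[].
    move=> c' d'; rewrite -integral_mkcondr setIC setI_box.
    apply: (integral_box_eq0 lh h0) => x xcd; apply: cdO => i; have := xcd i.
    by rewrite !mxE ge_max le_min => /andP[/andP[-> _] /andP[-> _]].
  apply: negligibleS => x [Bx /eqP hx] /=; rewrite patchE mem_set//= => -[]; exact: hx.
(* Enumerates the rational boxes; codes of inadmissible boxes give the empty set. *)
pose F (k : nat) : set 'rV[R]_n :=
  if @unpickle ('rV[rat]_n * 'rV[rat]_n)%type k is Some q then
    if `[< cbox (ratbox (R := R) q).1 (ratbox q).2 `<=` Omega >] then
      box (ratbox q).1 (ratbox q).2 `&` [set x | h x != 0] else set0
  else set0.
have : mu.-negligible (\bigcup_k F k).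
  apply: negligible_bigcup => k; rewrite /F; case: unpickle => [q|]; last exact: negligible_set0.
  by case: asboolP => [/loc//|_]; exact: negligible_set0.
apply: negligibleS => x /not_implyP[Ox hx].
have := Ox; rewrite (open_ratbox oO) => -[q qO qx].
exists (pickle q) => //; rewrite /F pickleK asboolT//; split=> //; exact/eqP.
Qed.

End fundamental.

(** * The Euclidean norm and scalar product *)

Section enorm.
Context {R : realType} {n : nat}.
Implicit Types (a b : 'rV[R]_n).

Definition dotp a b : R := \sum_i a ord0 i * b ord0 i.

Lemma enorm_ge0 a : 0 <= enorm a.
Proof. exact: sqrtr_ge0. Qed.

Lemma sqr_enorm a : enorm a ^+ 2 = dotp a a.
Proof.
rewrite /enorm sqr_sqrtr; last by apply: sumr_ge0 => i _; exact: sqr_ge0.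
by apply: eq_bigr => i _; rewrite expr2.
Qed.

Lemma dotp_ge0 a : 0 <= dotp a a.
Proof. by rewrite -sqr_enorm sqr_ge0. Qed.

Lemma enorm0 : enorm (0 : 'rV[R]_n) = 0.
Proof. by rewrite /enorm big1 ?sqrtr0// => i _; rewrite mxE expr0n. Qed.

Lemma enormZ (k : R) a : enorm (k *: a) = `|k| * enorm a.
Proof.
rewrite /enorm -sqrtr_sqr -sqrtrM ?sqr_ge0// mulr_sumr.
by congr Num.sqrt; apply: eq_bigr => i _; rewrite mxE exprMn.
Qed.

Lemma enormN a : enorm (- a) = enorm a.
Proof. by rewrite -scaleN1r enormZ normrN1 mul1r. Qed.

(** Cauchy-Schwarz: the squared length of [|b|^2 a - (a.b) b] equals
    [|b|^2 (|a|^2 |b|^2 - (a.b)^2)]. *)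
Lemma dotp_le a b : dotp a b <= enorm a * enorm b.
Proof.
have [b0|b0] := eqVneq (dotp b b) 0.
  have bz i : b ord0 i = 0.
    move: b0; rewrite /dotp => /eqP; rewrite psumr_eq0; last first.
      by move=> j _; rewrite -expr2 sqr_ge0.
    by move=> /allP/(_ i (mem_index_enum _)); rewrite mulf_eq0 orbb => /eqP.
  rewrite /dotp big1; last by move=> i _; rewrite bz mulr0.
  by rewrite mulr_ge0 ?enorm_ge0.
have bp : 0 < dotp b b by rewrite lt_neqAle eq_sym b0 dotp_ge0.
apply: le_trans (ler_norm _) _.
rewrite -(@ler_pXn2r _ 2)// ?nnegrE ?mulr_ge0 ?enorm_ge0//.
rewrite real_normK ?num_real// exprMn !sqr_enorm.
have : 0 <= \sum_i (dotp b b * a ord0 i - dotp a b * b ord0 i) ^+ 2.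
  by apply: sumr_ge0 => i _; exact: sqr_ge0.
have -> : \sum_i (dotp b b * a ord0 i - dotp a b * b ord0 i) ^+ 2 =
    dotp b b * (dotp a a * dotp b b - dotp a b ^+ 2).
  rewrite (eq_bigr (fun i => dotp b b ^+ 2 * (a ord0 i * a ord0 i) +
    ((- 2 * dotp b b * dotp a b) * (a ord0 i * b ord0 i) +
     dotp a b ^+ 2 * (b ord0 i * b ord0 i)))); last by move=> i _; ring.
  by rewrite !big_split/= -!mulr_sumr -!/(dotp _ _); ring.
by rewrite pmulr_rge0// subr_ge0.
Qed.

Lemma enormD a b : enorm (a + b) <= enorm a + enorm b.
Proof.
rewrite -(@ler_pXn2r _ 2)// ?nnegrE ?addr_ge0 ?enorm_ge0//.
rewrite sqrrD !sqr_enorm.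
have -> : dotp (a + b) (a + b) = dotp a a + dotp a b *+ 2 + dotp b b.
  rewrite /dotp -sumrMnl -!big_split; apply: eq_bigr => i _; rewrite !mxE/=; ring.
by rewrite lerD2r lerD2l lerMn2r dotp_le.
Qed.

Lemma ler_coord_enorm a i : `|a ord0 i| <= enorm a.
Proof.
rewrite -(@ler_pXn2r _ 2)// ?nnegrE ?enorm_ge0// sqr_enorm real_normK ?num_real//.
rewrite /dotp (bigD1 i)//= expr2 lerDl; apply: sumr_ge0 => j _.
by rewrite -expr2 sqr_ge0.
Qed.

End enorm.

(** * Norms of bounded functions with bounded support *)

Section bounded_integrable.
Context {R : realType} {n : nat}.
Local Notation mu := (@lebesgue_rV R n).
Implicit Types (f g : 'rV[R]_n -> R).

Definition bounded_bsupp f :=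
  [/\ measurable_fun setT f, exists C : R, forall x, `|f x| <= C & bsupp f].

Lemma continuous_bounded_bsupp f : continuous f -> bsupp f -> bounded_bsupp f.
Proof.
move=> cf bf; split=> //; first exact: continuous_measurable_rV.
have [M Mf] := bf.
have : bounded_set (f @` cbox (const_mx (- M)) (const_mx M)).
  apply: compact_bounded; apply: continuous_compact; last exact: compact_cbox.
  exact: continuous_subspaceT.
move=> [K [Kr AK]]; exists (Num.max 0 (K + 1)) => x.
have [xB|xB] := pselect (cbox (const_mx (- M)) (const_mx M) x).
  by rewrite le_max; apply/orP; right; apply: (AK (K + 1)); [rewrite ltrDl|exists x].
rewrite Mf ?normr0 ?le_max ?lexx//; move: xB => /existsNP[i /negP].
by rewrite !mxE -ler_norml -ltNge => h; exists i; exact: ltW.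
Qed.

Lemma bounded_bsupp_integrable f : bounded_bsupp f -> mu.-integrable setT (EFin \o f).
Proof.
move=> [mf [C Cf] [M Mf]]; pose B : set 'rV[R]_n := box (const_mx (- M)) (const_mx M).
have fB : f = f \_ B.
  apply/funext => x; rewrite patchE; case: ifPn => // /negP xB; apply: Mf.
  apply: contrapT => /forallNP h; apply: xB; rewrite inE => i; rewrite !mxE -ltr_norml ltNge.
  by apply/negP/h.
have mB : measurable B by exact: measurable_box.
rewrite fB -restrict_EFin; apply/(integrable_mkcond _ mB).
apply: measurable_bounded_integrable => //.
- by rewrite ltey_eq lebesgue_box_fin.
- exact: measurable_funTS.
- by exists C; split; [exact: num_real|move=> y Cy x _; exact: le_trans (Cf x) (ltW Cy)].
Qed.

Lemma bounded_bsupp_powR f (p : R) : 0 < p -> bounded_bsupp f ->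
  bounded_bsupp (fun x => `|f x| `^ p).
Proof.
move=> p0 [mf [C Cf] [M Mf]]; split.
- apply: (@measurableT_comp _ _ _ _ _ _ (@powR R ^~ p)) => //.
  exact: measurableT_comp.
- exists (C `^ p) => x; rewrite ger0_norm ?powR_ge0// ge0_ler_powR ?nnegrE ?(ltW p0)//.
  exact: le_trans (Cf x).
- by exists M => x /Mf ->; rewrite normr0 powR0// gt_eqF.
Qed.

Lemma LnormE f (p : R) : 0 < p -> bounded_bsupp f ->
  'N[mu]_p%:E[EFin \o f]%E = ((\int[mu]_x (`|f x| `^ p)) `^ p^-1)%:E.
Proof.
move=> p0 bf; rewrite unlock /= -poweR_EFin; congr (_ `^ _)%E.
by rewrite /Rintegral fineK// integrable_fin_num//; apply/bounded_bsupp_integrable/bounded_bsupp_powR.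
Qed.

Lemma le_Lnorm d (T : measurableType d) (nu : {measure set T -> \bar R}) (f g : T -> R) (p : R) :
  0 < p -> measurable_fun setT f -> measurable_fun setT g ->
  (forall x, `|f x| <= `|g x|) -> ('N[nu]_p%:E[EFin \o f] <= 'N[nu]_p%:E[EFin \o g])%E.
Proof.
move=> p0 mf mg fg; rewrite unlock.
have mp (h : T -> R) : measurable_fun setT h ->
    measurable_fun setT (fun x => (`|(EFin \o h) x| `^ p)%E).
  move=> mh; apply: (@measurableT_comp _ _ _ _ _ _ (@poweR R ^~ p)) => //.
    exact: measurable_poweR.
  by apply: measurableT_comp => //; exact/measurable_EFinP.
have fin0 (h : T -> R) : (0 <= \int[nu]_x (`|(EFin \o h) x| `^ p))%E.
  by apply: integral_ge0 => x _; exact: poweR_ge0.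
have p1 : 0 <= p^-1 by rewrite invr_ge0 ltW.
have fitv (h : T -> R) : (\int[nu]_x (`|(EFin \o h) x| `^ p))%E \in `[0%E, +oo%E].
  by rewrite in_itv /= leey fin0.
apply: (gt0_ler_poweR p1 (fitv f) (fitv g)).
apply: ge0_le_integral => //; try exact: mp.
  by move=> x _; exact: poweR_ge0.
by move=> x _; rewrite /= lee_fin ge0_ler_powR ?(ltW p0) ?nnegrE.
Qed.

Lemma ae_eq_Lnorm d (T : measurableType d) (nu : {measure set T -> \bar R}) (f g : T -> R) (p : R) :
  0 < p -> measurable_fun setT f -> measurable_fun setT g ->
  {ae nu, forall x, f x = g x} -> ('N[nu]_p%:E[EFin \o f] = 'N[nu]_p%:E[EFin \o g])%E.
Proof.
move=> p0 mf mg fg; rewrite unlock.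
have mp (h : T -> R) : measurable_fun setT h ->
    measurable_fun setT (fun x => (`|(EFin \o h) x| `^ p)%E).
  move=> mh; apply: (@measurableT_comp _ _ _ _ _ _ (@poweR R ^~ p)) => //.
    exact: measurable_poweR.
  by apply: measurableT_comp => //; exact/measurable_EFinP.
have -> // : (\int[nu]_x (`|(EFin \o f) x| `^ p) = \int[nu]_x (`|(EFin \o g) x| `^ p))%E.
apply: ae_eq_integral => //; try exact: mp.
by apply: filterS fg => x /= -> _.
Qed.

End bounded_integrable.

(** * Uniqueness and linearity of weak gradients *)

Section gradients.
Context {R : realType} {n : nat} (Omega : set 'rV[R]_n).
Hypothesis oO : open Omega.
Local Notation mu := (@lebesgue_rV R n).
Implicit Types (u v phi psi : 'rV[R]_n -> R) (g : 'rV[R]_n -> 'rV[R]_n).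

Let mO : measurable Omega := open_measurable_rV oO.

Definition grad phi (x : 'rV[R]_n) : 'rV[R]_n := \row_i partial i phi x.

Lemma ler_coord_norm (x : 'rV[R]_n) i : `|x ord0 i| <= `|x|.
Proof.
by rewrite [leRHS]/Num.norm /= mx_normrE; apply/bigmax_geP; right; exists (ord0, i).
Qed.

Lemma compact_measurable_rV (K : set 'rV[R]_n) : compact K -> measurable K.
Proof.
move=> cK; rewrite -[K]setCK; apply: measurableC; apply: open_measurable_rV.
by rewrite openC; apply: compact_closed => //; exact: norm_hausdorff.
Qed.

Lemma locally_integrableB u v : Defs.locally_integrable Omega u ->
  Defs.locally_integrable Omega v -> Defs.locally_integrable Omega (fun x => u x - v x).
Proof.
move=> [mu_ iu] [mv iv]; split; first exact: measurable_funB.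
move=> K cK KO; have mK := compact_measurable_rV cK.
by apply: (integrableB mK (iu K cK KO) (iv K cK KO)).
Qed.

Lemma continuous_locally_integrable u : continuous u -> Defs.locally_integrable Omega u.
Proof.
move=> cu; have m_ := continuous_measurable_rV cu.
split; first exact: measurable_funTS.
move=> K cK KO; have mK := compact_measurable_rV cK.
have [M KM] : exists M : R, forall x, K x -> forall i, `|x ord0 i| <= M.
  have [M [Mr hM]] := compact_bounded cK; exists (M + 1) => x Kx i.
  apply: le_trans (ler_coord_norm x i) _.
  by apply: (hM (M + 1) _ x Kx); rewrite ltrDl.
apply: measurable_bounded_integrable => //.
- have sub : K `<=` box (const_mx (- (M + 1))) (const_mx (M + 1)).
    by move=> x Kx i; rewrite !mxE -ltr_norml (le_lt_trans (KM x Kx i))// ltrDl.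
  apply: le_lt_trans (le_measure _ _ _ sub) _; rewrite ?inE//.
    exact: measurable_box.
  by rewrite ltey_eq lebesgue_box_fin.
- exact: measurable_funTS.
- have : bounded_set (u @` K).
    by apply: compact_bounded; apply: continuous_compact => //; exact: continuous_subspaceT.
  move=> [C [Cr AK]]; exists C; split=> // y /AK Ay x Kx; apply: Ay; by exists x.
Qed.

Lemma test_function_bsupp phi : test_function Omega phi -> bsupp phi.
Proof.
move=> [_ /compact_bounded [M [Mr hM]] _]; exists (M + 2) => x [i xi].
apply/eqP; apply: contrapT => /negP phx.
have := hM (M + 1) _ x (@subset_closure _ _ x phx); rewrite ltrDl ltr01 => /(_ isT) xM.
have := le_trans (ler_coord_norm x i) xM; have := xi; lra.
Qed.

Lemma partial_out_supp phi i x : ~ closure [set y | phi y != 0] x -> partial i phi x = 0.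
Proof.
move=> ncl; transitivity ('D_(delta_mx ord0 i) (cst 0 : 'rV[R]_n -> R) x); last exact: derive_cst.
apply: near_eq_derive; have : nbhs x (~` closure [set y | phi y != 0]).
  by apply: open_nbhs_nbhs; split=> //; apply: closed_openC; exact: closed_closure.
apply: filterS => y /= ny; apply/eqP; apply: contrapT => /negP h.
by apply: ny; exact: subset_closure.
Qed.

Lemma integrable_test_mul u phi : Defs.locally_integrable Omega u -> continuous phi ->
  (exists2 K, compact K /\ K `<=` Omega & forall x, ~ K x -> phi x = 0) ->
  mu.-integrable Omega (fun x => (u x * phi x)%:E).
Proof.
move=> [mu_ iu] cphi [K [cK KO] phi0]; have mK := compact_measurable_rV cK.
have mp := continuous_measurable_rV cphi.
have mup : measurable_fun Omega (fun x => (u x * phi x)%:E).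
  by apply/measurable_EFinP/measurable_funM => //; exact: measurable_funTS.
apply/integrableP; split=> //.
rewrite (@integral_vanish _ _ _ _ _ K)//; last first.
  by move=> x _ /phi0 ->; rewrite mulr0 abse0.
have : bounded_set (phi @` K).
  by apply: compact_bounded; apply: continuous_compact => //; exact: continuous_subspaceT.
move=> [C [Cr AK]].
have := iu K cK KO => /integrableZl => /(_ mK (`|C| + 1)) /integrableP[_].
apply: le_lt_trans; apply: ge0_le_integral => //.
- by apply: measurableT_comp => //; exact: measurable_funS mup.
- apply: measurableT_comp => //; apply: measurable_funeM => //; have [//] := integrableP _ _ _ (iu K cK KO).
- move=> x Kx; rewrite /= lee_fin !normrM mulrC ler_wpM2r//.
  rewrite [leRHS]ger0_norm ?addr_ge0//; apply: (AK (`|C| + 1)); last by exists x.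
  by rewrite (le_lt_trans (ler_norm C))// ltrDl.
Qed.

Lemma test_function_compact phi : test_function Omega phi ->
  exists2 K, compact K /\ K `<=` Omega & forall x, ~ K x -> phi x = 0.
Proof.
move=> [_ cK KO]; exists (closure [set x | phi x != 0]) => // x nx.
by apply/eqP; apply: contrapT => /negP h; apply: nx; exact: subset_closure.
Qed.

Lemma test_partial_compact phi i : test_function Omega phi ->
  exists2 K, compact K /\ K `<=` Omega & forall x, ~ K x -> partial i phi x = 0.
Proof.
move=> [_ cK KO]; exists (closure [set x | phi x != 0]) => // x nx.
exact: partial_out_supp.
Qed.

(** The fundamental lemma applied to each component of [g - g']. It identifies the arbitrary choice
    [weak_gradient] almost everywhere. *)
Lemma is_weak_gradient_unique u g g' : is_weak_gradient Omega u g ->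
  is_weak_gradient Omega u g' -> {ae mu, forall x, Omega x -> g x = g' x}.
Proof.
move=> [lu hg] [_ hg'].
suff H i : {ae mu, forall x, Omega x -> g x ord0 i = g' x ord0 i}.
  have : {ae mu, forall x, forall i, Omega x -> g x ord0 i = g' x ord0 i}.
    exact: filter_forall.
  by apply: filterS => x hx Ox; apply/rowP => i; exact: hx.
have [lg ig] := hg i; have [lg' ig'] := hg' i.
have := fundamental_lemma oO (locally_integrableB lg lg') => /(_ _)/wrap[].
  move=> phi tphi; have sphi : smooth setT phi by case: tphi.
  have c := smooth_continuous sphi.
  have I1 := integrable_test_mul lg c (test_function_compact tphi).
  have I2 := integrable_test_mul lg' c (test_function_compact tphi).
  under eq_Rintegral do rewrite mulrBl.
  rewrite RintegralB//.
  have := ig phi tphi; rewrite (ig' phi tphi) => /oppr_inj ->.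
  by rewrite subrr.
by apply: filterS => x h Ox; apply/eqP; rewrite -subr_eq0 h.
Qed.

Lemma is_weak_gradientB u v g g' : is_weak_gradient Omega u g ->
  is_weak_gradient Omega v g' -> is_weak_gradient Omega (u \- v) (fun x => g x - g' x).
Proof.
move=> [lu hg] [lv hg']; split; first exact: locally_integrableB.
move=> i; have [lg ig] := hg i; have [lg' ig'] := hg' i.
split.
  rewrite (_ : (fun x => _) = fun x => g x ord0 i - g' x ord0 i).
    exact: locally_integrableB.
  by apply/funext => x; rewrite !mxE.
move=> phi tphi; have sphi : smooth setT phi by case: tphi.
have c := smooth_continuous sphi; have cd := smooth_continuous (smooth_partial i sphi).
have I1 := integrable_test_mul lg c (test_function_compact tphi).
have I2 := integrable_test_mul lg' c (test_function_compact tphi).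
have I3 := integrable_test_mul lu cd (test_partial_compact i tphi).
have I4 := integrable_test_mul lv cd (test_partial_compact i tphi).
under eq_Rintegral do rewrite /= mulrBl.
under [in RHS]eq_Rintegral do rewrite !mxE mulrBl.
by rewrite !RintegralB// ig// ig'// opprB opprK addrC.
Qed.

(** The product [psi * phi] has bounded support, so its partial derivative integrates to zero over
    the whole space; outside [Omega] the integrand is zero. *)
Lemma is_weak_gradient_smooth psi : smooth setT psi -> is_weak_gradient Omega psi (grad psi).
Proof.
move=> spsi; have cpsi := smooth_continuous spsi.
split; first exact: continuous_locally_integrable.
move=> i; have cdpsi := smooth_continuous (smooth_partial i spsi).
have E : (fun x => grad psi x ord0 i) = partial i psi by apply/funext => x; rewrite mxE.
rewrite E; split; first exact: continuous_locally_integrable.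
move=> phi tphi; have sphi : smooth setT phi by case: tphi.
have c := smooth_continuous sphi; have cd := smooth_continuous (smooth_partial i sphi).
have lpsi := continuous_locally_integrable cpsi.
have ldpsi := continuous_locally_integrable cdpsi.
have I1 := integrable_test_mul lpsi cd (test_partial_compact i tphi).
have I2 := integrable_test_mul ldpsi c (test_function_compact tphi).
under [in RHS]eq_Rintegral do rewrite mxE.
apply/eqP; rewrite -subr_eq0 opprK -RintegralD//; apply/eqP.
have sf := smoothM spsi sphi.
have P x : partial i (fun y => psi y * phi y) x = psi x * partial i phi x + partial i psi x * phi x.
  by rewrite /partial deriveM; [congr (_ + _); rewrite /GRing.scale /= mulrC|exact: smooth_derivable..].
have [M Mphi] := test_function_bsupp tphi.
have := @integral_partial R n _ i (fun x => @smooth_derivable R n _ i x sf) (smooth_continuous sf)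
  (smooth_continuous (smooth_partial i sf)).
have bf : bsupp (fun y => psi y * phi y) by exists M => x /Mphi ->; rewrite mulr0.
move=> /(_ bf); rewrite /Rintegral.
rewrite (funext P).
rewrite (@integral_vanish _ _ _ _ setT Omega) => [->//|//|x _ Ox].
have [K [_ KO] K0] := test_function_compact tphi.
have [K' [_ KO'] K0'] := test_partial_compact i tphi.
by rewrite K0 ?K0' ?mulr0 ?addr0// => [/KO'|/KO].
Qed.

Lemma weak_gradientP u : (exists g, is_weak_gradient Omega u g) ->
  is_weak_gradient Omega u (weak_gradient Omega u).
Proof. by move=> [g hg]; rewrite /weak_gradient; apply: (xgetPex (fun=> 0)); exists g. Qed.

Lemma weak_gradient_smooth psi : smooth setT psi ->
  {ae mu, forall x, Omega x -> weak_gradient Omega psi x = grad psi x}.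
Proof.
move=> spsi; have h := is_weak_gradient_smooth spsi.
exact: (is_weak_gradient_unique (weak_gradientP (ex_intro _ _ h)) h).
Qed.

Lemma weak_gradientB_smooth u psi : (exists g, is_weak_gradient Omega u g) -> smooth setT psi ->
  {ae mu, forall x, Omega x ->
    weak_gradient Omega (u \- psi) x = weak_gradient Omega u x - grad psi x}.
Proof.
move=> /weak_gradientP hu /is_weak_gradient_smooth hp.
have h := is_weak_gradientB hu hp.
exact: (is_weak_gradient_unique (weak_gradientP (ex_intro _ _ h)) h).
Qed.

End gradients.

(** * Sobolev functions and the Rayleigh quotient *)

Section sobolev_facts.
Context {R : realType} {n : nat} (Omega : set 'rV[R]_n).
Hypothesis oO : open Omega.
Local Notation mu := (@lebesgue_rV R n).
Implicit Types (u v f psi w : 'rV[R]_n -> R) (g : 'rV[R]_n -> 'rV[R]_n) (p : R).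

Let mO : measurable Omega := open_measurable_rV oO.

(** A nonempty open set contains a ball of positive measure, so it is not covered by a null set. *)
Lemma open_ae_ex (U : set 'rV[R]_n) (P : 'rV[R]_n -> Prop) x :
  open U -> U x -> {ae mu, forall y, P y} -> exists2 y, U y & P y.
Proof.
move=> oU Ux [N [mN N0 PN]]; apply: contrapT => /forall2NP H.
have /nbhs_ballP[e e0 xeU] : nbhs x U by exact: open_nbhs_nbhs.
have sub : ball x e `<=` N.
  move=> y /xeU Uy; apply: PN => /= Py; by have [] := H y.
have mb : measurable (ball x e) by apply: open_measurable_rV; exact: ball_open.
have : (mu (ball x e) <= mu N)%E by apply: le_measure => //; rewrite inE.
by rewrite N0 leNgt lebesgue_ball_gt0.
Qed.

(** [Lnorm] at [+oo] is the essential supremum only when the whole space has positive measure. *)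
Lemma lebesgue_setT_gt0 : (0 < mu setT)%E.
Proof.
apply: lt_le_trans (lebesgue_ball_gt0 0 ltr01) _; apply: le_measure; rewrite ?inE//.
by apply: open_measurable_rV; exact: ball_open.
Qed.

Lemma Lnorm_on_oo_le v (c : R) : 0 <= c -> (forall x, Omega x -> `|v x| <= c) ->
  (Lnorm_on Omega +oo%E v <= c%:E)%E.
Proof.
move=> c0 vc; rewrite /Lnorm_on unlock lebesgue_setT_gt0; apply/ess_supP.
apply: aeW => x /=; rewrite lee_fin patchE; case: ifPn => [/set_mem/vc//|_].
by rewrite normr0.
Qed.

(** A value above [c] would persist, by continuity, on an open set, and such a set is not null. *)
Lemma Lnorm_on_oo_ge v (c : R) x : (forall y, Omega y -> {for y, continuous v}) ->
  Omega x -> (Lnorm_on Omega +oo%E v <= c%:E)%E -> `|v x| <= c.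
Proof.
move=> cv Ox; rewrite /Lnorm_on unlock lebesgue_setT_gt0 => /ess_supP h.
rewrite leNgt; apply/negP => cx.
have : nbhs x [set y | Omega y /\ c < `|v y|].
  have cn : (fun y => `|v y|) @ x --> `|v x| by exact: (cvg_norm (cv x Ox)).
  apply: filterI; first exact: open_nbhs_nbhs.
  exact: (cvgr_gt _ cn _ cx).
rewrite nbhsE => -[U [oU Ux] UA].
have [y /UA[Oy cy]] := open_ae_ex oU Ux h.
by rewrite /= lee_fin patchE mem_set// leNgt cy.
Qed.

Lemma measurable_enorm (D : set 'rV[R]_n) g : (forall i, measurable_fun D (fun x => g x ord0 i)) ->
  measurable_fun D (fun x => enorm (g x)).
Proof.
move=> mg; apply: (@measurableT_comp _ _ _ _ _ _ (@Num.sqrt R)).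
  by apply: continuous_measurable_fun; exact: sqrt_continuous.
by apply: measurable_sum => i; apply: measurable_funX.
Qed.

Lemma measurable_patch f : measurable_fun Omega f -> measurable_fun setT (f \_ Omega).
Proof. by move=> mf; apply/(measurable_restrictT _ mO). Qed.

Lemma Lnorm_on_ae p f f' : 0 < p -> measurable_fun Omega f -> measurable_fun Omega f' ->
  {ae mu, forall x, Omega x -> f x = f' x} -> Lnorm_on Omega p%:E f = Lnorm_on Omega p%:E f'.
Proof.
move=> p0 mf mf' ff'; apply: ae_eq_Lnorm => //; try exact: measurable_patch.
by apply: filterS ff' => x h; rewrite !patchE; case: ifPn => // /set_mem/h.
Qed.

Lemma compact_bsupp (K : set 'rV[R]_n) f : compact K -> (forall x, ~ K x -> f x = 0) -> bsupp f.
Proof.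
move=> /compact_bounded [M [Mr hM]] f0; exists (M + 2) => x [i xi]; apply: f0 => Kx.
have := hM (M + 1) _ x Kx; rewrite ltrDl ltr01 => /(_ isT) xM.
have := le_trans (ler_coord_norm x i) xM; have := xi; lra.
Qed.

Lemma enorm_continuous g x : (forall i, {for x, continuous (fun y => g y ord0 i)}) ->
  {for x, continuous (fun y => enorm (g y))}.
Proof.
move=> cg; rewrite /enorm.
apply: (@continuous_comp _ _ _ (fun y => \sum_i g y ord0 i ^+ 2) (@Num.sqrt R)); last first.
  exact: sqrt_continuous.
elim: (index_enum _) => [|a r IH].
  rewrite (_ : (fun y => _) = cst 0); first exact: cst_continuous.
  by apply/funext => y; rewrite big_nil.
rewrite (_ : (fun y => _) =
  (fun y => g y ord0 a * g y ord0 a + \sum_(i <- r) g y ord0 i ^+ 2)).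
  by apply: continuousD => //; apply: continuousM; exact: cg.
by apply/funext => y; rewrite big_cons expr2.
Qed.

Lemma test_grad_bounded_bsupp psi : test_function Omega psi ->
  bounded_bsupp (fun x => enorm (grad psi x)).
Proof.
move=> tpsi; have spsi : smooth setT psi by case: tpsi.
apply: continuous_bounded_bsupp.
  move=> x; apply: enorm_continuous => i.
  rewrite (_ : (fun y => _) = partial i psi); last by apply/funext => y; rewrite mxE.
  exact: smooth_continuous (smooth_partial i spsi) x.
have [_ cK _] := tpsi; apply: compact_bsupp cK _ => x nx.
by rewrite (_ : grad psi x = 0) ?enorm0//; apply/rowP => i; rewrite !mxE partial_out_supp.
Qed.

Lemma test_bounded_bsupp psi : test_function Omega psi -> bounded_bsupp psi.
Proof.
move=> tpsi; have spsi : smooth setT psi by case: tpsi.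
by apply: continuous_bounded_bsupp; [exact: smooth_continuous|exact: test_function_bsupp tpsi].
Qed.

Lemma Lnorm_on_vanish p f : (forall x, ~ Omega x -> f x = 0) ->
  Lnorm_on Omega p%:E f = 'N[mu]_p%:E[EFin \o f]%E.
Proof.
move=> f0; congr Lnorm; apply/funext => x /=; congr EFin; rewrite patchE.
by case: ifPn => //; rewrite notin_setE => /f0 ->.
Qed.

Lemma test_grad_vanish psi x : test_function Omega psi -> ~ Omega x -> enorm (grad psi x) = 0.
Proof.
move=> [_ _ KO] Ox; rewrite (_ : grad psi x = 0) ?enorm0//.
by apply/rowP => i; rewrite !mxE partial_out_supp// => /KO.
Qed.

Lemma test_vanish psi x : test_function Omega psi -> ~ Omega x -> psi x = 0.
Proof.
move=> [_ _ KO] Ox; apply/eqP; apply: contrapT => /negP h; apply/Ox/KO.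
exact: subset_closure.
Qed.

Lemma measurable_weak_gradient u g i : is_weak_gradient Omega u g ->
  measurable_fun Omega (fun x => g x ord0 i).
Proof. by move=> [_ /(_ i)[[]]]. Qed.

Lemma grad_norm_test p psi : 0 < p -> test_function Omega psi ->
  Lnorm_on Omega p%:E (grad_norm Omega psi) = 'N[mu]_p%:E[EFin \o (fun x => enorm (grad psi x))]%E.
Proof.
move=> p0 tpsi; have spsi : smooth setT psi by case: tpsi.
have h := is_weak_gradient_smooth oO spsi.
have h2 := weak_gradientP (ex_intro _ _ h).
rewrite -Lnorm_on_vanish; last by move=> x; exact: test_grad_vanish.
apply: Lnorm_on_ae => //.
- by apply: measurable_enorm => i; exact: measurable_weak_gradient h2.
- by apply: measurable_enorm => i; exact: measurable_weak_gradient h.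
- by apply: filterS (weak_gradient_smooth oO spsi) => x hx Ox; rewrite /grad_norm hx.
Qed.

Lemma sobolev0_test p psi : 1 <= p -> test_function Omega psi -> sobolev0 Omega p psi.
Proof.
move=> p1 tpsi; have spsi : smooth setT psi by case: tpsi.
have p0 : 0 < p by exact: lt_le_trans p1.
have cpsi := smooth_continuous spsi.
have h := is_weak_gradient_smooth oO spsi.
split.
  split; [|by exists (grad psi)|].
    by apply: measurable_funTS; exact: continuous_measurable_rV.
  rewrite /sobolev_norm grad_norm_test// Lnorm_on_vanish; last first.
    by move=> x; exact: test_vanish.
  rewrite !LnormE//; first by rewrite -EFinD ltry.
    exact: test_grad_bounded_bsupp.
  exact: test_bounded_bsupp.
exists (fun=> psi); split=> //.
rewrite (_ : (fun k => _) = cst 0%E); first exact: cvg_cst.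
apply/funext => k /=; rewrite /sobolev_norm.
have N0 : Lnorm_on Omega p%:E (fun=> 0) = 0%E.
  rewrite Lnorm_on_vanish//; apply: Lnorm0; by rewrite eqe gt_eqF.
have -> : psi \- psi = (fun=> 0) by apply/funext => x /=; rewrite subrr.
(* The chosen weak gradient of the zero function is known to vanish only almost everywhere. *)
rewrite N0 add0e -[RHS]N0; have h0 : is_weak_gradient Omega (fun=> 0) (fun=> 0).
  have := is_weak_gradient_smooth oO (smooth_cst (0 : R) (n := n)).
  rewrite (_ : grad _ = fun=> 0)//; apply/funext => x; apply/rowP => i; rewrite !mxE.
  exact: derive_cst.
have h2 := weak_gradientP (ex_intro _ _ h0).
apply: Lnorm_on_ae => //.
  by apply: measurable_enorm => i; exact: measurable_weak_gradient h2.
by apply: filterS (is_weak_gradient_unique oO h2 h0) => x hx Ox; rewrite /grad_norm hx// enorm0.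
Qed.

(** The closure defining [sobolev0] provides [psi], and Minkowski bounds its energy norm by that of
    [u] plus the distance. Nothing else about the weak gradient of [u] enters the truncation
    argument. *)
Lemma sobolev0_approx p u (L : R) : 1 <= p -> sobolev0 Omega p u ->
  Lnorm_on Omega p%:E (grad_norm Omega u) = L%:E ->
  forall e : R, 0 < e -> exists psi, [/\ test_function Omega psi,
    (Lnorm_on Omega p%:E (u \- psi)%R <= e%:E)%E &
    ('N[mu]_p%:E[EFin \o (fun x => enorm (grad psi x))] <= (L + e)%:E)%E].
Proof.
move=> p1 [[mu_ exg fin] [phi [tphi cphi]]] uL e e0.
have p0 : 0 < p by exact: lt_le_trans p1.
have [k hk] : exists k, (sobolev_norm Omega p%:E (u \- phi k)%R < e%:E)%E.
  have : \forall k \near \oo, (sobolev_norm Omega p%:E (u \- phi k)%R < e%:E)%E.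
    have /fine_cvgP[fn cf] := cphi.
    apply: filterS2 fn (cvgr_lt _ cf _ e0) => k hfin hlt.
    by rewrite -(fineK hfin) lte_fin.
  by move=> [k _ /(_ k (leqnn k))]; exists k.
have tk := tphi k; have sk : smooth setT (phi k) by case: tk.
exists (phi k); split=> //.
  apply: le_trans (ltW hk); rewrite /sobolev_norm leeDl//; exact: Lnorm_ge0.
have hB := weak_gradientP exg.
have hk' := is_weak_gradient_smooth oO sk.
have hd := is_weak_gradientB oO hB hk'.
have hd' := weak_gradientP (ex_intro _ _ hd).
have m1 : measurable_fun Omega (grad_norm Omega u).
  by apply: measurable_enorm => i; exact: measurable_weak_gradient hB.
have m2 : measurable_fun Omega (fun x => enorm (weak_gradient Omega u x - grad (phi k) x)).
  by apply: measurable_enorm => i; exact: measurable_weak_gradient hd.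
have m3 : measurable_fun Omega (fun x => enorm (grad (phi k) x)).
  by apply: measurable_enorm => i; exact: measurable_weak_gradient hk'.
rewrite -Lnorm_on_vanish; last by move=> x; exact: test_grad_vanish.
pose A : 'rV[R]_n -> R := grad_norm Omega u \_ Omega.
pose B : 'rV[R]_n -> R :=
  (fun x => enorm (weak_gradient Omega u x - grad (phi k) x)) \_ Omega.
have mA : measurable_fun setT A by exact: measurable_patch.
have mB : measurable_fun setT B by exact: measurable_patch.
have H1 : (Lnorm_on Omega p%:E (fun x => enorm (grad (phi k) x)) <=
    'N[mu]_p%:E[EFin \o (A \+ B)%R])%E.
  apply: le_Lnorm => //; first exact: measurable_patch.
    exact: measurable_funD.
  move=> x /=; rewrite /A /B !patchE; case: ifPn => // _; last by rewrite addr0.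
  rewrite ger0_norm ?enorm_ge0// ger0_norm ?addr_ge0 ?enorm_ge0// /grad_norm.
  rewrite -[X in _ <= _ + X]enormN opprB.
  by apply: le_trans (enormD _ _); rewrite addrC subrK.
apply: (le_trans H1); apply: (le_trans (minkowski_EFin mu mA mB p1)).
rewrite EFinD leeD//; first by rewrite -uL.
have -> : 'N[mu]_p%:E[EFin \o B]%E = Lnorm_on Omega p%:E (grad_norm Omega (u \- phi k)).
  apply: Lnorm_on_ae => //.
    by apply: measurable_enorm => i; exact: measurable_weak_gradient hd'.
  apply: filterS (weak_gradientB_smooth oO exg sk) => x hx Ox.
  by rewrite /grad_norm hx.
by apply: le_trans (ltW hk); rewrite /sobolev_norm leeDr//; exact: Lnorm_ge0.
Qed.

Lemma partialZ (c : R) f i x : smooth setT f ->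
  partial i (fun y => c * f y) x = c * partial i f x.
Proof.
move=> sf; have [_] := is_deriveM (is_derive_cst c x (delta_mx ord0 i)) (smooth_is_derive i x sf).
by rewrite scaler0 addr0.
Qed.

Lemma Lnorm_scale p (c : R) f : 0 < p -> 0 <= c -> measurable_fun setT f ->
  'N[mu]_p%:E[EFin \o (fun x => (c * f x)%R)]%E = (c%:E * 'N[mu]_p%:E[EFin \o f])%E.
Proof.
move=> p0 c0 mf; rewrite unlock.
have mp : measurable_fun setT (fun x => (`|(EFin \o f) x| `^ p)%E).
  apply: (@measurableT_comp _ _ _ _ _ _ (@poweR R ^~ p)) => //.
    exact: measurable_poweR.
  by apply: measurableT_comp => //; exact/measurable_EFinP.
have -> : (\int[mu]_x (`|(EFin \o (fun x => (c * f x)%R)) x| `^ p))%E =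
    ((c `^ p)%:E * \int[mu]_x (`|(EFin \o f) x| `^ p))%E.
  rewrite -ge0_integralZl//; last by rewrite lee_fin powR_ge0.
    apply: eq_integral => x _; rewrite /= normrM (ger0_norm c0).
    by rewrite powRM.
  by move=> x _; exact: poweR_ge0.
rewrite poweRM ?lee_fin ?powR_ge0//; last by apply: integral_ge0 => x _; exact: poweR_ge0.
by rewrite poweR_EFin -powRrM mulfV ?gt_eqF// powRr1.
Qed.

(* Normalizing a test function makes it admissible in the definition of Lambda. *)
Lemma Lambda_le_test p (L : R) w y : 1 <= p ->
  (L%:E `^ p)%E = Lambda Omega p -> 0 <= L ->
  test_function Omega w ->
  ((L * `|w y|)%:E <= 'N[mu]_p%:E[EFin \o (fun x => enorm (grad w x))])%E.
Proof.
move=> p1 LL L0 tw; have p0 : 0 < p by exact: lt_le_trans p1.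
have [sw cK KO] := tw; have cw := smooth_continuous sw.
have [->|wy0] := eqVneq (w y) 0; first by rewrite normr0 mulr0 Lnorm_ge0.
pose K := closure [set x | w x != 0].
have Ky : K y by exact: subset_closure.
have cn : {within K, continuous (fun x => `|w x|)}.
  by apply: continuous_subspaceT => x; apply: (continuous_comp (cw x)); exact: norm_continuous.
have [y0 Ky0 ymax] := EVT_max_rV (ex_intro _ y Ky) cK cn.
have maxw x : `|w x| <= `|w y0|.
  have [Kx|nKx] := pselect (K x); first by apply: ymax; rewrite inE.
  suff -> : w x = 0 by rewrite normr0.
  by apply/eqP; apply: contrapT => /negP h; apply: nKx; exact: subset_closure.
(* The maximum of [|w|] is attained on its compact support, so division by [M] gives sup norm
   exactly 1. *)
pose M := `|w y0|.
have M0 : 0 < M by apply: lt_le_trans (maxw y); rewrite normr_gt0.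
have Oy0 : Omega y0 by apply: KO; rewrite inE in Ky0.
pose v x := M^-1 * w x.
have sv : smooth setT v by apply: smoothM => //; exact: smooth_cst.
have tv : test_function Omega v.
  apply: (@test_function_of _ _ _ K) => // x nKx; rewrite /v (_ : w x = 0) ?mulr0//.
  by apply/eqP; apply: contrapT => /negP h; apply: nKx; exact: subset_closure.
have vM x : `|v x| <= 1.
  by rewrite /v normrM ger0_norm ?invr_ge0 ?(ltW M0)// ler_pdivrMl// mulr1.
have v1 : `|v y0| = 1.
  by rewrite /v normrM ger0_norm ?invr_ge0 ?(ltW M0)// mulVf// gt_eqF.
have voo : Lnorm_on Omega +oo%E v = 1%E.
  apply/eqP; rewrite eq_le Lnorm_on_oo_le//= leNgt; apply/negP => h.
  have ge0 : (0 <= Lnorm_on Omega +oo%E v)%E by exact: Lnorm_ge0.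
  have fin : Lnorm_on Omega +oo%E v \is a fin_num by rewrite ge0_fin_numE// (lt_trans h)// ltry.
  have : `|v y0| <= fine (Lnorm_on Omega +oo%E v).
    apply: Lnorm_on_oo_ge => //; last by rewrite fineK.
    by move=> x _; exact: smooth_continuous.
  by rewrite v1 leNgt -lte_fin fineK// h.
have gv x : enorm (grad v x) = M^-1 * enorm (grad w x).
  rewrite (_ : grad v x = M^-1 *: grad w x).
    by rewrite enormZ ger0_norm// invr_ge0 ltW.
  apply/rowP => i; rewrite !mxE /partial /v.
  exact: partialZ.
have bw := test_grad_bounded_bsupp tw; have bv := test_grad_bounded_bsupp tv.
have Lv : (Lambda Omega p <= Lnorm_on Omega p%:E (grad_norm Omega v) `^ p)%E.
  by apply: ereal_inf_lbound; exists v => //; split=> //; exact: sobolev0_test.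
have E : 'N[mu]_p%:E[EFin \o (fun x => enorm (grad v x))]%E =
    (M^-1%:E * 'N[mu]_p%:E[EFin \o (fun x => enorm (grad w x))])%E.
  rewrite -Lnorm_scale ?invr_ge0 ?(ltW M0)//; last by case: bw.
  by congr Lnorm; apply/funext => x; rewrite /= gv.
rewrite -LL grad_norm_test// E in Lv.
move: Lv; rewrite LnormE// -EFinM -poweR_EFin lee_fin.
set a := (X in _ * X); move=> h.
have a0 : 0 <= a by exact: powR_ge0.
have LM : L <= M^-1 * a.
  rewrite leNgt; apply/negP => lt; move: h; apply/negP; rewrite -ltNge.
  by apply: gt0_ltr_powR; rewrite ?nnegrE ?mulr_ge0 ?invr_ge0 ?(ltW M0).
rewrite lee_fin; apply: le_trans (ler_wpM2l L0 (maxw y)) _.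
by rewrite -/M mulrC -ler_pdivlMl.
Qed.

End sobolev_facts.

(** * Strict quadratic majorants *)

Section taylor.
Context {R : realType} {n : nat}.
Implicit Types (f : 'rV[R]_n -> R) (x v w z : 'rV[R]_n) (D : set 'rV[R]_n).

Lemma is_derive_sum_fun (V : normedModType R) I (r : seq I) (F : I -> V -> R)
    (dF : I -> R) (x v : V) :
  (forall i, is_derive x v (F i) (dF i)) ->
  is_derive x v (fun y => \sum_(i <- r) F i y) (\sum_(i <- r) dF i).
Proof.
move=> h; elim: r => [|a r IH].
  rewrite big_nil (_ : (fun y => _) = cst 0); first exact: is_derive_cst.
  by apply/funext => y; rewrite big_nil.
rewrite big_cons (_ : (fun y => _) = F a \+ (fun y => \sum_(i <- r) F i y)).
  exact: is_deriveD.
by apply/funext => y; rewrite big_cons.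
Qed.

Lemma is_derive_scale f x v (d c : R) : is_derive x v f d ->
  is_derive x (c *: v) f (c * d).
Proof.
have E u : x = x + 0 *: u by rewrite scale0r addr0.
move=> h; rewrite (E (c *: v)); apply/is_derive_lineP.
rewrite (E v) in h; move/is_derive_lineP : h => h.
have hc : is_derive (0 : R) 1 (fun s : R => s * c) c.
  have := is_deriveM (is_derive_id (0 : R) 1) (is_derive_cst (c : R) (0 : R) 1).
  by rewrite scaler0 add0r /GRing.scale /= mulr1.
have h' : is_derive ((fun s : R => s * c) 0) 1 (fun s : R => f (x + s *: v)) d.
  by rewrite /= mul0r.
have := @is_derive1_comp R (fun s : R => f (x + s *: v)) (fun s : R => s * c) 0 d c h' hc.
rewrite mulrC (_ : _ \o _ = (fun s : R => f (x + s *: (c *: v))))//.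
by apply/funext => s /=; rewrite scalerA.
Qed.

Lemma MVT_line f x v (df : R -> R) :
  (forall t : R, 0 <= t <= 1 -> is_derive (x + t *: v) v f (df t)) ->
  exists2 c : R, 0 <= c <= 1 & f (x + v) - f x = df c.
Proof.
move=> h; have H (t : R) : 0 <= t <= 1 -> is_derive t 1 (fun s : R => f (x + s *: v)) (df t).
  by move=> t01; apply/is_derive_lineP/h.
have [||c cI] := @MVT_segment R (fun s => f (x + s *: v)) df 0 1 ler01.
- by move=> t; rewrite in_itv /= => /andP[t0 t1]; apply: H; rewrite !ltW.
- apply: derivable_within_continuous => t; rewrite in_itv /= => t01.
  by have [] := H t t01.
rewrite subr0 mulr1 scale1r scale0r addr0 => E.
by exists c => //; move: cI; rewrite in_itv.
Qed.

(** The increment splits into one along [w] and one, [g], along the axis. By the mean value theorem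
    [g h] is [a] times the partial derivative at a point tending to [x], where that partial is
    continuous. *)
Lemma is_derive_add_axis D f x w (dw a : R) i : open D -> D x ->
  (forall y, D y -> derivable f y (delta_mx ord0 i)) ->
  {for x, continuous (partial i f)} ->
  is_derive x w f dw -> is_derive x (w + a *: delta_mx ord0 i) f (dw + a * partial i f x).
Proof.
move=> oD Dx df cp [dfw <-]; set e := delta_mx ord0 i.
pose g h := h^-1 *: (f (h *: w + x + h *: (a *: e)) - f (h *: w + x)) : R.
have L : g h @[h --> 0^'] --> a * partial i f x.
  apply/cvgrPdist_le => eps eps0.
  have a1 : 0 < `|a| + 1 by rewrite ltr_wpDl.
  have : nbhs x [set y | D y /\ `|partial i f x - partial i f y| <= eps / (`|a| + 1)].
    apply: filterI; first exact: open_nbhs_nbhs.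
    by move/cvgrPdist_le : cp; apply; rewrite divr_gt0.
  move=> /nbhs_ballP[r /= r0 xr]; near=> h.
  have h0 : h != 0 by near: h; exact: nbhs_dnbhs_neq.
  have inb (t : R) : 0 <= t <= 1 -> ball x r (h *: w + x + t *: ((h * a) *: e)).
    move=> /andP[t0 t1]; rewrite mx_norm_ball /ball_ /=.
    have -> : x - (h *: w + x + t *: ((h * a) *: e)) = - (h *: (w + (t * a) *: e)).
      by rewrite scalerDr !scalerA; apply/rowP => k; rewrite !mxE; ring.
    rewrite normrN normrZ; apply: (@le_lt_trans _ _ (`|h| * (`|w| + `|a| * `|e|))).
      rewrite ler_wpM2l//; apply: le_trans (ler_normD _ _) _; rewrite lerD2l normrZ.
      by rewrite ler_wpM2r// normrM ger0_norm// ler_piMl.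
    have c0 : 0 < `|w| + `|a| * `|e| + 1 by rewrite ltr_wpDl// addr_ge0// mulr_ge0.
    apply: (@le_lt_trans _ _ (`|h| * (`|w| + `|a| * `|e| + 1))).
      by rewrite ler_wpM2l// lerDl.
    rewrite -ltr_pdivlMr//; near: h; apply: dnbhs0_lt; exact: divr_gt0.
  have [t t01|c c01 E] := @MVT_line f (h *: w + x) ((h * a) *: e)
     (fun t => (h * a) * partial i f (h *: w + x + t *: ((h * a) *: e))).
    apply: is_derive_scale; apply: DeriveDef; last by [].
    by apply: df; have [] := xr _ (inb t t01).
  rewrite /g scalerA E /GRing.scale /= mulrA mulrA mulVf// mul1r -mulrBr normrM.
  have [_ hc] := xr _ (inb c c01).
  apply: le_trans (ler_wpM2l (normr_ge0 a) hc) _.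
  by rewrite mulrCA ler_piMr ?(ltW eps0)// ler_pdivrMr// mul1r lerDl.
have E : (fun h : R => h^-1 *: (f (h *: (w + a *: e) + x) - f x)) =
   (fun h => h^-1 *: (f (h *: w + x) - f x) + g h).
  apply/funext => h; rewrite /g -scalerDr; congr (_ *: _).
  have -> : h *: (w + a *: e) + x = h *: w + x + h *: (a *: e) by rewrite scalerDr addrAC.
  ring.
have T : h^-1 *: (f (h *: (w + a *: e) + x) - f x) @[h --> 0^'] -->
    'D_w f x + a * partial i f x.
  by rewrite E; apply: cvgD.
by split; [exact: cvgP T|exact: cvg_lim T].
Unshelve. all: by end_near. Qed.

(** [class_C] speaks of derivatives along the axes only; arbitrary directions are reached by adding
    one axis at a time. *)
Lemma is_derive_directional D f x v : open D -> D x ->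
  (forall i y, D y -> derivable f y (delta_mx ord0 i)) ->
  (forall i, {for x, continuous (partial i f)}) ->
  is_derive x v f (\sum_i v ord0 i * partial i f x).
Proof.
move=> oD Dx df cp; rewrite {1}(row_sum_delta v).
elim: (index_enum _) => [|i r IH].
  by rewrite !big_nil; exact: is_derive0.
rewrite !big_cons addrC [X in is_derive _ _ _ X]addrC.
exact: (is_derive_add_axis (v ord0 i) oD Dx (df i) (cp i) IH).
Qed.

Definition hess f x z : R :=
  \sum_i \sum_j partial i (partial j f) x * (z ord0 i * z ord0 j).

Lemma norm_mul_le (a b : R) : `|a * b| <= 2^-1 * (a * a + b * b).
Proof.
have h1 := sqr_ge0 (a - b); have h2 := sqr_ge0 (a + b).
by rewrite ler_norml; apply/andP; split; nra.
Qed.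

Lemma half_double (e d : R) m : e / 2 * (d *+ m + d *+ m) = e * m%:R * d.
Proof. by rewrite -[d *+ m]mulr_natr; field. Qed.

(** On the segment from [x0] to [y] the second derivative is at most [C], because the second
    partials are close to their values at [x0]. Two uses of the mean value theorem turn this into
    the bound on [f y]. *)
Lemma taylor_upper D f x0 (delta : R) : open D -> D x0 -> class_C 2 D f -> 0 < delta ->
  \forall y \near x0, f y <= f x0 + \sum_i (y - x0) ord0 i * partial i f x0
     + 2^-1 * hess f x0 (y - x0) + delta * dotp (y - x0) (y - x0).
Proof.
move=> oD Dx0 [cf hf] d0.
have df i y : D y -> derivable f y (delta_mx ord0 i) by have [+ _] := hf i; exact.
have cpf i y : D y -> {for y, continuous (partial i f)}.
  by have [_ [+ _]] := hf i; exact.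
have dpf i j y : D y -> derivable (partial i f) y (delta_mx ord0 j).
  by have [_ [_ /(_ j)[+ _]]] := hf i; exact.
have cppf i j y : D y -> {for y, continuous (partial j (partial i f))}.
  by have [_ [_ /(_ j)[_ [+ _]]]] := hf i; exact.
(* Summing [eta/2 (z_i^2 + z_j^2)] over [i] and [j] gives [eta n |z|^2], at most [2 delta |z|^2];
   [n.+1] keeps the denominator nonzero. *)
pose eta := 2 * delta / n.+1%:R.
have eta0 : 0 < eta by rewrite divr_gt0// mulr_gt0.
have : nbhs x0 [set y | D y /\ forall i j, `|partial j (partial i f) y - partial j (partial i f) x0| <= eta].
  apply: filterI; first exact: open_nbhs_nbhs.
  apply: (@filter_forall _ _ (fun i (y : 'rV[R]_n) => forall j,
    `|partial j (partial i f) y - partial j (partial i f) x0| <= eta) (nbhs x0) _) => i.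
  apply: (@filter_forall _ _ (fun j (y : 'rV[R]_n) =>
    `|partial j (partial i f) y - partial j (partial i f) x0| <= eta : Prop) (nbhs x0) _) => j.
  by have /cvgrPdistC_le := cppf i j x0 Dx0; apply.
move=> /nbhs_ballP[r /= r0 xr]; near=> y.
have : ball x0 r y by near: y; exact: nbhsx_ballx.
set z := y - x0; rewrite mx_norm_ball /ball_ /= distrC -/z => zr.
have yE : y = x0 + z by rewrite addrC subrK.
have inb (t : R) : 0 <= t <= 1 -> ball x0 r (x0 + t *: z).
  move=> /andP[t0 t1]; rewrite mx_norm_ball /ball_ /= opprD addNKr normrN normrZ ger0_norm//.
  by apply: le_lt_trans zr; rewrite ler_piMl.
pose g1 t := \sum_i z ord0 i * partial i f (x0 + t *: z).
pose g2 t := \sum_i z ord0 i * \sum_j z ord0 j * partial j (partial i f) (x0 + t *: z).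
have dg (t : R) : 0 <= t <= 1 -> is_derive t 1 (fun s => f (x0 + s *: z)) (g1 t).
  move=> t01; apply/is_derive_lineP; have [Dt _] := xr _ (inb t t01).
  by apply: (is_derive_directional _ oD Dt) => // i; exact: cpf.
have dg1 (t : R) : 0 <= t <= 1 -> is_derive t 1 g1 (g2 t).
  move=> t01; have [Dt _] := xr _ (inb t t01).
  have H i : is_derive t 1 (fun s => partial i f (x0 + s *: z))
      (\sum_j z ord0 j * partial j (partial i f) (x0 + t *: z)).
    apply/is_derive_lineP; apply: (is_derive_directional _ oD Dt) => [j y' Dy'|j].
      exact: dpf.
    exact: cppf.
  by apply: is_derive_sum_fun.
pose C := hess f x0 z + 2 * delta * dotp z z.
have g2C (t : R) : 0 <= t <= 1 -> g2 t <= C.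
  move=> t01; have [_ Ht] := xr _ (inb t t01).
  have -> : g2 t = \sum_i \sum_j partial i (partial j f) (x0 + t *: z) * (z ord0 i * z ord0 j).
    rewrite /g2; under eq_bigr do rewrite mulr_sumr.
    by rewrite exchange_big; apply: eq_bigr => i _; apply: eq_bigr => j _; ring.
  apply: (@le_trans _ _ (\sum_i \sum_j (partial i (partial j f) x0 * (z ord0 i * z ord0 j) +
     eta / 2 * (z ord0 i * z ord0 i + z ord0 j * z ord0 j)))).
    apply: ler_sum => i _; apply: ler_sum => j _; rewrite -lerBlDl -mulrBl.
    apply: le_trans (ler_norm _) _; rewrite normrM.
    apply: (@le_trans _ _ (eta * `|z ord0 i * z ord0 j|)); first by rewrite ler_wpM2r.
    by rewrite -mulrA ler_wpM2l ?(ltW eta0)// norm_mul_le.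
  under eq_bigr do rewrite big_split.
  rewrite big_split /= -/(hess f x0 z) lerD2l.
  have -> : \sum_i \sum_j eta / 2 * (z ord0 i * z ord0 i + z ord0 j * z ord0 j) =
      eta * n%:R * dotp z z.
    under eq_bigr do rewrite -mulr_sumr big_split /= sumr_const card_ord -/(dotp z z).
    rewrite -mulr_sumr big_split /= sumr_const card_ord sumrMnl -/(dotp z z).
    exact: half_double.
  rewrite ler_wpM2r ?dotp_ge0//.
  have E : eta * n.+1%:R = 2 * delta by rewrite /eta divfK// pnatr_eq0.
  by rewrite -E ler_wpM2l ?(ltW eta0)// ler_nat.
have g10 : g1 0 = \sum_i z ord0 i * partial i f x0.
  by rewrite /g1; under eq_bigr do rewrite scale0r addr0.
have g1C (t : R) : 0 <= t <= 1 -> g1 t - g1 0 - C * t <= 0.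
  move=> /andP[t0 t1].
  have [||c] := @MVT_segment R g1 g2 0 t t0.
  - move=> s; rewrite in_itv /= => /andP[s0 st]; apply: dg1.
    by rewrite (ltW s0) (ltW (lt_le_trans st t1)).
  - apply: derivable_within_continuous => s; rewrite in_itv /= => /andP[s0 st].
    by have [|//] := dg1 s; rewrite s0 (le_trans st t1).
  rewrite in_itv /= subr0 => /andP[c0 ct] ->; rewrite -mulrBl mulr_le0_ge0// subr_le0.
  by apply: g2C; rewrite c0 (le_trans ct t1).
(* The function on the segment minus the comparison parabola; its derivative is nonpositive by
   [g1C]. *)
pose k t := f (x0 + t *: z) - (g1 0 * t + 2^-1 * C * (t * t)).
have dk (t : R) : 0 <= t <= 1 -> is_derive t 1 k (g1 t - g1 0 - C * t).
  move=> /dg h.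
  have h1 := is_deriveM (is_derive_cst (g1 0) t 1) (is_derive_id t 1).
  have h2 := is_deriveM (is_derive_cst (2^-1 * C) t 1)
    (is_deriveM (is_derive_id t 1) (is_derive_id t 1)).
  apply: is_derive_eq (is_deriveB h (is_deriveD h1 h2)) _.
  by rewrite /GRing.scale /=; field.
have [||c cI E] := @MVT_segment R k (fun t => g1 t - g1 0 - C * t) 0 1 ler01.
- by move=> s; rewrite in_itv /= => /andP[s0 s1]; apply: dk; rewrite !ltW.
- apply: derivable_within_continuous => s; rewrite in_itv /= => s01.
  by have [] := dk s s01.
have : k 1 - k 0 <= 0.
  by rewrite E subr0 mulr1; apply: g1C; move: cI; rewrite in_itv.
rewrite /k scale1r scale0r addr0 -yE g10 /C; lra.
Unshelve. all: by end_near. Qed.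

Section quadratic.
Variables (x0 : 'rV[R]_n) (c0 : R) (b : 'I_n -> R) (A : 'I_n -> 'I_n -> R).

Definition quad (y : 'rV[R]_n) : R := c0 + \sum_i b i * (y ord0 i - x0 ord0 i) +
  \sum_i \sum_j A i j * ((y ord0 i - x0 ord0 i) * (y ord0 j - x0 ord0 j)).

Let sc i : smooth setT (fun y : 'rV[R]_n => y ord0 i - x0 ord0 i).
Proof. by apply: smoothB; [exact: smooth_coord|exact: smooth_cst]. Qed.

Let s1 : smooth setT (fun y : 'rV[R]_n => \sum_i b i * (y ord0 i - x0 ord0 i)).
Proof. by apply: smooth_sum => i; apply: smoothM => //; exact: smooth_cst. Qed.

Let s2 : smooth setT (fun y : 'rV[R]_n =>
  \sum_i \sum_j A i j * ((y ord0 i - x0 ord0 i) * (y ord0 j - x0 ord0 j))).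
Proof.
apply: smooth_sum => i; apply: smooth_sum => j; apply: smoothM; first exact: smooth_cst.
exact: smoothM.
Qed.

Lemma smooth_quad : smooth setT quad.
Proof. by apply: smoothD => //; apply: smoothD => //; exact: smooth_cst. Qed.

Let dcoord k i y : is_derive y (delta_mx ord0 k)
  (fun y : 'rV[R]_n => y ord0 i - x0 ord0 i) ((k == i)%:R).
Proof.
have := is_deriveB (partial_coord k i y) (is_derive_cst (x0 ord0 i) y (delta_mx ord0 k)).
by rewrite subr0.
Qed.

Lemma sum_delta (F : 'I_n -> R) k : \sum_i F i * (k == i)%:R = F k.
Proof.
rewrite (bigD1 k)//= eqxx mulr1 big1 ?addr0// => i /negbTE ik.
by rewrite eq_sym ik mulr0.
Qed.

Lemma partial_quad k y : partial k quad y =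
  b k + \sum_j (A k j + A j k) * (y ord0 j - x0 ord0 j).
Proof.
have H : is_derive y (delta_mx ord0 k) quad
  (0 + (\sum_i b i * (k == i)%:R) + \sum_i \sum_j A i j *
    ((y ord0 i - x0 ord0 i) * (k == j)%:R + (y ord0 j - x0 ord0 j) * (k == i)%:R)).
  apply: is_deriveD; first apply: is_deriveD.
  - apply: is_derive_sum_fun => i.
    have := is_deriveM (is_derive_cst (b i) y (delta_mx ord0 k)) (dcoord k i y).
    by rewrite scaler0 addr0.
  - apply: is_derive_sum_fun => i; apply: is_derive_sum_fun => j.
    have := is_deriveM (is_derive_cst (A i j) y (delta_mx ord0 k))
      (is_deriveM (dcoord k i y) (dcoord k j y)).
    by rewrite scaler0 addr0.
rewrite /partial; have [_ ->] := H; rewrite add0r sum_delta; congr (_ + _).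
under eq_bigr do under eq_bigr do rewrite mulrDr.
under eq_bigr do rewrite big_split.
rewrite big_split /=.
have -> : \sum_i \sum_j A i j * ((y ord0 i - x0 ord0 i) * (k == j)%:R) =
    \sum_i A i k * (y ord0 i - x0 ord0 i).
  apply: eq_bigr => i _; rewrite -[RHS](sum_delta (fun j => A i j * (y ord0 i - x0 ord0 i))).
  by apply: eq_bigr => j _; rewrite mulrA.
have -> : \sum_i \sum_j A i j * ((y ord0 j - x0 ord0 j) * (k == i)%:R) =
    \sum_j A k j * (y ord0 j - x0 ord0 j).
  rewrite exchange_big; apply: eq_bigr => j _.
  rewrite -[RHS](sum_delta (fun i => A i j * (y ord0 j - x0 ord0 j))).
  by apply: eq_bigr => i _; rewrite mulrA.
by rewrite -big_split; apply: eq_bigr => j _ /=; ring.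
Qed.

Lemma partial2_quad l k y : partial l (partial k quad) y = A k l + A l k.
Proof.
rewrite (funext (partial_quad k)).
have H : is_derive y (delta_mx ord0 l)
    (fun y : 'rV[R]_n => b k + \sum_j (A k j + A j k) * (y ord0 j - x0 ord0 j))
    (0 + \sum_j (A k j + A j k) * (l == j)%:R).
  apply: is_deriveD; apply: is_derive_sum_fun => i.
  have := is_deriveM (is_derive_cst (A k i + A i k) y (delta_mx ord0 l)) (dcoord l i y).
  by rewrite scaler0 addr0.
by rewrite /partial; have [_ ->] := H; rewrite add0r sum_delta.
Qed.

Lemma quad_center : quad x0 = c0.
Proof.
rewrite /quad big1 ?addr0; last by move=> i _; rewrite subrr mulr0.
by rewrite big1 ?addr0// => i _; rewrite big1// => j _; rewrite subrr mul0r mulr0.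
Qed.

Lemma infty_laplacian_quad_center : infty_laplacian quad x0 =
  2 * \sum_i \sum_j b i * b j * A i j.
Proof.
have P k : partial k quad x0 = b k.
  by rewrite partial_quad big1 ?addr0// => j _; rewrite subrr mulr0.
rewrite /infty_laplacian; under eq_bigr do under eq_bigr do rewrite !P partial2_quad mulrDr.
under eq_bigr do rewrite big_split.
rewrite big_split /= [X in X + _]exchange_big mulrDl mul1r; congr (_ + _).
by apply: eq_bigr => i _; apply: eq_bigr => j _; rewrite [b j * _]mulrC.
Qed.

End quadratic.

(** [Q] is the second-order Taylor polynomial plus [2 delta |y - x0|^2]: one [delta] pays for the
    Taylor error, the other leaves a strict margin away from [x0]. *)
Lemma quadratic_majorant D f x0 : open D -> D x0 -> class_C 2 D f ->
  infty_laplacian f x0 < 0 ->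
  exists Q : 'rV[R]_n -> R, exists delta : R, [/\ smooth setT Q, 0 < delta, Q x0 = f x0,
    infty_laplacian Q x0 < 0 &
    \forall y \near x0, f y <= Q y - delta * dotp (y - x0) (y - x0)].
Proof.
move=> oD Dx0 Cf lf.
pose b i := partial i f x0; pose B := \sum_i b i * b i.
have B0 : 0 <= B by apply: sumr_ge0 => i _; rewrite -expr2 sqr_ge0.
(* The added square changes the infinity-Laplacian at [x0] by [4 * delta * B], less than half of its
   absolute value for this [delta]; [B + 1] keeps the denominator positive. *)
pose delta := - infty_laplacian f x0 / (8 * (B + 1)).
have d0 : 0 < delta by rewrite divr_gt0 ?oppr_gt0// mulr_gt0// ltr_wpDl.
pose A i j := 2^-1 * partial i (partial j f) x0 + (2 * delta) * (i == j)%:R.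
exists (quad x0 (f x0) b A), delta.
split; [exact: smooth_quad|exact: d0|exact: quad_center| |].
- rewrite infty_laplacian_quad_center.
  have -> : \sum_i \sum_j b i * b j * A i j = 2^-1 * infty_laplacian f x0 + 2 * delta * B.
    under eq_bigr do under eq_bigr do rewrite /A mulrDr.
    under eq_bigr do rewrite big_split.
    rewrite big_split /=; congr (_ + _).
      rewrite /infty_laplacian mulr_sumr; apply: eq_bigr => i _; rewrite mulr_sumr.
      by apply: eq_bigr => j _; rewrite -/(b i) -/(b j); ring.
    rewrite mulr_sumr; apply: eq_bigr => i _.
    rewrite -(sum_delta (fun j => 2 * delta * (b i * b j)) i).
    by apply: eq_bigr => j _; ring.
  have E : delta * (8 * (B + 1)) = - infty_laplacian f x0.
    by rewrite /delta divfK// mulf_neq0// gt_eqF// ltr_wpDl.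
  nra.
- apply: filterS (taylor_upper oD Dx0 Cf d0) => y h; apply: le_trans h _.
  rewrite le_eqVlt; apply/orP; left; apply/eqP.
  rewrite /quad /hess -!addrA; congr (_ + (_ + _)).
    by apply: eq_bigr => i _; rewrite !mxE mulrC.
  have -> : \sum_i \sum_j A i j * ((y ord0 i - x0 ord0 i) * (y ord0 j - x0 ord0 j)) =
     2^-1 * hess f x0 (y - x0) + 2 * delta * dotp (y - x0) (y - x0).
    under eq_bigr do under eq_bigr do rewrite /A mulrDl.
    under eq_bigr do rewrite big_split.
    rewrite big_split /=; congr (_ + _).
      rewrite /hess mulr_sumr; apply: eq_bigr => i _; rewrite mulr_sumr.
      by apply: eq_bigr => j _; rewrite !mxE; ring.
    rewrite /dotp mulr_sumr; apply: eq_bigr => i _; rewrite !mxE.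
    rewrite -(sum_delta (fun j => 2 * delta * ((y ord0 i - x0 ord0 i) * (y ord0 j - x0 ord0 j))) i).
    by apply: eq_bigr => j _; ring.
  by rewrite -/(hess f x0 (y - x0)); ring.
Qed.

End taylor.

(** * Real inequalities *)

Section real_inequalities.
Context {R : realType}.
Implicit Types (p x y t : R).

(** Young's inequality for [x] and [y^(p-1)] with exponents [p] and [p/(p-1)]. Geometrically, the
    graph of the power [p] lies above its tangent at [y]. *)
Lemma powR_tangent p x y : 1 < p -> 0 <= x -> 0 <= y ->
  p * (x * y `^ (p - 1)) <= x `^ p + (p - 1) * y `^ p.
Proof.
move=> p1 x0 y0; have p0 : 0 < p by exact: lt_trans p1.
have pm : 0 < p - 1 by rewrite subr_gt0.
have := @conjugate_powR R x (y `^ (p - 1)) p (p / (p - 1)).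
rewrite x0 powR_ge0 p0 divr_gt0// => /(_ isT isT isT isT).
rewrite -powRrM mulrCA divff ?gt_eqF// mulr1.
have -> : p^-1 + (p / (p - 1))^-1 = 1 by field; rewrite !gt_eqF.
move=> /(_ erefl) h; rewrite mulrC -ler_pdivlMr//; apply: le_trans h _.
rewrite le_eqVlt; apply/orP; left; apply/eqP; field; by rewrite !gt_eqF.
Qed.

Lemma powR_mulr_sub1 p x : 1 < p -> 0 <= x -> x * x `^ (p - 1) = x `^ p.
Proof.
move=> p1 x0; have [->|xn] := eqVneq x 0.
  by rewrite mul0r powR0// gt_eqF// (lt_trans _ p1).
by rewrite -[X in X * _]powRr1// -powRD ?xn ?implybT// addrC subrK.
Qed.

(** The average of the tangent inequalities from the convex combination [s] to [x] and to [y]. *)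
Lemma powR_convex p t x y : 1 < p -> 0 <= t <= 1 -> 0 <= x -> 0 <= y ->
  ((1 - t) * x + t * y) `^ p <= (1 - t) * x `^ p + t * y `^ p.
Proof.
move=> p1 /andP[t0 t1] x0 y0; set s := _ + _.
have s0 : 0 <= s by rewrite addr_ge0// mulr_ge0// subr_ge0.
have h1 := powR_tangent p1 x0 s0; have h2 := powR_tangent p1 y0 s0.
have E : s * s `^ (p - 1) = s `^ p by exact: powR_mulr_sub1.
have h1' : (1 - t) * (p * (x * s `^ (p - 1))) <= (1 - t) * (x `^ p + (p - 1) * s `^ p).
  by rewrite ler_wpM2l// subr_ge0.
have h2' : t * (p * (y * s `^ (p - 1))) <= t * (y `^ p + (p - 1) * s `^ p).
  by rewrite ler_wpM2l.
have E2 : p * s `^ p = (1 - t) * (p * (x * s `^ (p - 1))) + t * (p * (y * s `^ (p - 1))).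
  by rewrite -E /s; ring.
lra.
Qed.

Lemma powR_lip p x y M : 1 < p -> 0 <= y -> y <= x -> x <= M ->
  x `^ p - y `^ p <= p * M `^ (p - 1) * (x - y).
Proof.
move=> p1 y0 yx xM; have x0 := le_trans y0 yx.
have p0 : 0 < p by exact: lt_trans p1.
have := powR_tangent p1 y0 x0.
rewrite -(powR_mulr_sub1 p1 x0).
move=> h; apply: (@le_trans _ _ (p * x `^ (p - 1) * (x - y))); first by nra.
rewrite ler_wpM2r ?subr_ge0// ler_wpM2l ?(ltW p0)//.
by rewrite ge0_ler_powR ?nnegrE ?subr_ge0 ?(ltW p1)// (le_trans x0).
Qed.

(** The arithmetic of the final contradiction. [A] is the main energy of the competitor, [1 - d] a
    lower bound for its maximum, [H] the gain and [e] the accuracy of the approximation. [d] depends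
    on [p], [L] and [H] only, and [e] is still free to shrink after [d] is known. *)
Lemma energy_gap p L H C2 C3 : 1 < p -> 0 <= L -> 0 < H -> 0 <= C2 -> 0 <= C3 ->
  exists2 d : R, 0 < d < 1 & exists2 e1 : R, 0 < e1 & forall e A, 0 < e -> e <= e1 -> 0 <= A ->
    L * (1 - d) <= A `^ p^-1 + C2 * e -> A <= (L + e) `^ p - H + C3 * e -> False.
Proof.
move=> p1 L0 H0 C20 C30; have p0 : 0 < p by exact: lt_trans p1.
pose W := p * (L + 1) `^ (p - 1).
have W0 : 0 < W by rewrite mulr_gt0// powR_gt0// ltr_wpDl.
have L1 : 0 < L + 1 by lra.
have den : 0 < 4 * W * (L + 1) by apply: mulr_gt0 => //; apply: mulr_gt0.
(* [W] is a Lipschitz constant of the power [p] on [[0, L + 1]]; the loss [W * d * L] is then at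
   most [H / 4]. *)
exists (Num.min 2^-1 (H / (4 * W * (L + 1)))).
  apply/andP; split; last by rewrite gt_min; apply/orP; left; lra.
  by rewrite lt_min invr_gt0 ltr0n divr_gt0.
set d := Num.min _ _.
have d0 : 0 <= d by rewrite le_min invr_ge0 ler0n divr_ge0 ?(ltW H0) ?(ltW den).
have d1 : d <= 2^-1 by rewrite ge_min lexx.
have dH : W * d * L <= H / 4.
  have : d <= H / (4 * W * (L + 1)) by rewrite ge_min lexx orbT.
  rewrite ler_pdivlMr// => h.
  rewrite ler_pdivlMr//; apply: le_trans h; have := mulr_ge0 (ltW W0) d0; nra.
(* [B] dominates all coefficients of [e], so the losses due to [e] are at most another [H / 4]. *)
pose B := W * (1 + C2) + C3 + 1.
have B0 : 0 < B by rewrite /B; have := mulr_ge0 (ltW W0) C20; lra.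
exists (Num.min 1 (H / (4 * B))).
  by rewrite lt_min ltr01 divr_gt0 ?mulr_gt0.
move=> e A e0; rewrite le_min => /andP[e1]; rewrite ler_pdivlMr ?mulr_gt0// => eB A0 h1 h2.
have C2e : 0 <= C2 * e by rewrite mulr_ge0// ltW.
(* The lower bound may be negative, while powers are compared on nonnegative numbers. *)
pose y := Num.max 0 (L * (1 - d) - C2 * e).
have y0 : 0 <= y by rewrite le_max lexx.
have dL : 0 <= d * L by rewrite mulr_ge0.
have yx : y <= L + e by rewrite ge_max; apply/andP; split; lra.
have yA : y <= A `^ p^-1.
  by rewrite ge_max powR_ge0/= lerBlDr.
have ypA : y `^ p <= A.
  apply: (@le_trans _ _ ((A `^ p^-1) `^ p)).
    by rewrite ge0_ler_powR ?nnegrE ?powR_ge0 ?(ltW p0).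
  by rewrite -powRrM mulVf ?gt_eqF// powRr1.
have xM : L + e <= L + 1 by rewrite lerD2l.
have h3 := powR_lip p1 y0 yx xM; rewrite -/W in h3.
have h4 : L + e - y <= (1 + C2) * e + d * L.
  have : L * (1 - d) - C2 * e <= y by rewrite le_max lexx orbT.
  lra.
have h5 : W * (L + e - y) <= W * ((1 + C2) * e + d * L) by rewrite ler_wpM2l// ltW.
have h6 : H <= W * ((1 + C2) * e + d * L) + C3 * e by lra.
have h7 : W * ((1 + C2) * e + d * L) + C3 * e <= B * e + H / 4.
  have -> : W * ((1 + C2) * e + d * L) + C3 * e = W * d * L + (B * e - e) by rewrite /B; ring.
  lra.
lra.
Qed.

End real_inequalities.

Section convex_vector.
Context {R : realType} {n : nat}.
Implicit Types (a b : 'rV[R]_n).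

(** Convexity along the segment, followed by the tangent inequality at [b] and Cauchy-Schwarz.
    [|b|^(p-2)] is written as a power of [|b|^2], the form that is differentiated in [pfield]. *)
Lemma enorm_powR_convex (p t : R) a b : 2 < p -> 0 <= t <= 1 ->
  enorm ((1 - t) *: a + t *: b) `^ p <=
  enorm a `^ p - p * (t * (dotp b b `^ ((p - 2) / 2) * dotp b (a - b))).
Proof.
move=> p2 /andP[t0 t1]; have p1 : 1 < p by lra.
have p0 : 0 < p by lra.
have nb : dotp b b `^ ((p - 2) / 2) = enorm b `^ (p - 2).
  rewrite -sqr_enorm -powR_mulrn ?enorm_ge0// -powRrM; congr (_ `^ _); by field.
have h1 : enorm ((1 - t) *: a + t *: b) `^ p <= (1 - t) * enorm a `^ p + t * enorm b `^ p.
  apply: (@le_trans _ _ (((1 - t) * enorm a + t * enorm b) `^ p)).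
    rewrite ge0_ler_powR ?nnegrE ?enorm_ge0 ?(ltW p0)//.
      by rewrite addr_ge0// mulr_ge0 ?enorm_ge0 ?subr_ge0.
    apply: le_trans (enormD _ _) _; rewrite !enormZ ger0_norm ?subr_ge0//.
    by rewrite ger0_norm.
  by apply: powR_convex; rewrite ?enorm_ge0 ?t0.
have h2 : enorm b `^ p <= enorm a `^ p - p * (enorm b `^ (p - 2) * dotp b (a - b)).
  have E1 : enorm b `^ (p - 2) * enorm b = enorm b `^ (p - 1).
    have [->|bn] := eqVneq (enorm b) 0; first by rewrite mulr0 powR0// gt_eqF// subr_gt0.
    rewrite -[X in _ * X]powRr1 ?enorm_ge0// -powRD ?bn ?implybT//; congr (_ `^ _); ring.
  have E2 : enorm b `^ (p - 1) * enorm b = enorm b `^ p.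
    by rewrite mulrC powR_mulr_sub1// enorm_ge0.
  have D : dotp b (a - b) = dotp b a - enorm b ^+ 2.
    by rewrite sqr_enorm /dotp -sumrB; apply: eq_bigr => i _; rewrite !mxE mulrBr.
  have hT := powR_tangent p1 (enorm_ge0 a) (enorm_ge0 b).
  have hC : enorm b `^ (p - 2) * dotp b a <= enorm a * enorm b `^ (p - 1).
    rewrite -E1 mulrCA ler_wpM2l ?powR_ge0//.
    by rewrite mulrC dotp_le.
  have hC' := ler_wpM2l (ltW p0) hC.
  rewrite D mulrBr expr2 mulrA E1 E2; move: hT hC'.
  move: (enorm b `^ (p - 2) * dotp b a) (enorm a * enorm b `^ (p - 1)).
  by move: (enorm a `^ p) (enorm b `^ p); clear; move=> *; lra.
have h3 := ler_wpM2l t0 h2; rewrite nb; move: h1 h3.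
move: (enorm ((1 - t) *: a + t *: b) `^ p) (enorm a `^ p) (enorm b `^ p).
by move: (enorm b `^ (p - 2)) (dotp b (a - b)); clear; move=> *; lra.
Qed.

End convex_vector.

(** * The p-Laplacian of a smooth function *)

Section cutoff.
Context {R : realType} {n : nat}.
Local Notation mu := (@lebesgue_rV R n).
Implicit Types (eta f : 'rV[R]_n -> R) (U K : set 'rV[R]_n).

Lemma for_continuousD eta f x : {for x, continuous eta} -> {for x, continuous f} ->
  {for x, continuous (fun y => eta y + f y)}.
Proof. by move=> ce cf; apply: continuousD. Qed.

Lemma for_continuousM eta f x : {for x, continuous eta} -> {for x, continuous f} ->
  {for x, continuous (fun y => eta y * f y)}.
Proof. by move=> ce cf; apply: continuousM. Qed.

Lemma for_continuous_near0 f x : (\forall y \near x, f y = 0) -> f x = 0 ->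
  {for x, continuous f}.
Proof.
move=> nf f0; suff : f y @[y --> x] --> (0 : R) by rewrite -f0.
have near : \forall y \near x, (cst 0 : 'rV[R]_n -> R) y = f y.
  by apply: filterS nf => y ->.
apply: (@cvg_trans _ ((cst 0 : 'rV[R]_n -> R) @ x)); last first.
  by have : {for x, continuous (cst 0 : 'rV[R]_n -> R)} by exact: cst_continuous.
exact: (near_eq_cvg near).
Qed.

Lemma partial_near_zero eta i x : (\forall y \near x, eta y = 0) -> partial i eta x = 0.
Proof.
move=> h; transitivity ('D_(delta_mx ord0 i) (cst 0 : 'rV[R]_n -> R) x); last exact: derive_cst.
by apply: near_eq_derive; apply: filterS h => y.
Qed.

Lemma closed_near_out K x : closed K -> ~ K x -> \forall y \near x, ~ K y.
Proof.
move=> cK nKx; have : nbhs x (~` K) by apply: open_nbhs_nbhs; split=> //; exact: closed_openC.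
exact.
Qed.

Lemma partial_out eta K i x : closed K -> (forall y, ~ K y -> eta y = 0) -> ~ K x ->
  partial i eta x = 0.
Proof.
move=> cK e0 nKx; apply: partial_near_zero.
by apply: filterS (closed_near_out cK nKx) => y; exact: e0.
Qed.

(** [f] is regular only on [U], but its product with [eta] vanishes off the compact [K] and is
    regular on the whole space. The intended [f] is a component of [|DQ|^(p-2) DQ], with [U] the set
    where [DQ] is nonzero. *)
Lemma integral_cutoff U K eta f i : open U -> compact K -> K `<=` U -> smooth setT eta ->
  (forall y, ~ K y -> eta y = 0) ->
  (forall y, U y -> derivable f y (delta_mx ord0 i)) ->
  (forall y, U y -> {for y, continuous f}) ->
  (forall y, U y -> {for y, continuous (partial i f)}) ->
  let F x := eta x * partial i f x + partial i eta x * f x in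
  bounded_bsupp F /\ (\int[mu]_x F x = 0).
Proof.
move=> oU cK KU seta e0 df cf cpf F.
have clK : closed K by apply: compact_closed => //; exact: norm_hausdorff.
have ceta := smooth_continuous seta; have cpeta := smooth_continuous (smooth_partial i seta).
have out x : ~ K x -> \forall y \near x, eta y * f y = 0.
  by move=> nK; apply: filterS (closed_near_out clK nK) => y /e0 ->; rewrite mul0r.
have H x : is_derive x (delta_mx ord0 i) (fun y => eta y * f y) (F x).
  have [/KU Ux|nK] := pselect (K x).
    have := is_deriveM (smooth_is_derive i x seta) (DeriveDef (df x Ux) erefl).
    by rewrite /GRing.scale /= [f x * _]mulrC.
  have F0 : F x = 0 by rewrite /F e0// (partial_out _ clK e0 nK) !mul0r addr0.
  rewrite F0; apply: (@near_eq_is_derive _ _ _ (cst 0)).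
  by apply: filterS (out x nK) => y /= ->.
have E : partial i (fun y => eta y * f y) = F.
  by apply/funext => x; rewrite /partial; have [_ ->] := H x.
have cF : continuous F.
  move=> x; have [/KU Ux|nK] := pselect (K x).
    by apply: for_continuousD; apply: for_continuousM;
      [exact: ceta|exact: cpf|exact: cpeta|exact: cf].
  have F0 y : ~ K y -> F y = 0.
    by move=> nKy; rewrite /F e0// (partial_out _ clK e0 nKy) !mul0r addr0.
  apply: for_continuous_near0; last exact: F0.
  by apply: filterS (closed_near_out clK nK) => y /F0 ->.
have cef : continuous (fun y => eta y * f y).
  move=> x; have [/KU Ux|nK] := pselect (K x).
    by apply: for_continuousM; [exact: ceta|exact: cf].
  apply: for_continuous_near0; [exact: out|by rewrite e0 ?mul0r].
have bef : bsupp (fun y => eta y * f y).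
  by apply: compact_bsupp cK _ => x /e0 ->; rewrite mul0r.
have bF : bsupp F by rewrite -E; exact: bsupp_partial.
split; first exact: continuous_bounded_bsupp.
have := @integral_partial R n _ i (fun x => let: DeriveDef h _ := H x in h) cef.
rewrite E => /(_ cF bef); rewrite /Rintegral => ->; by [].
Qed.

End cutoff.

Section p_laplace_field.
Context {R : realType} {n : nat}.
Variables (Q : 'rV[R]_n -> R) (p : R).
Hypotheses (sQ : smooth setT Q) (p4 : 4 <= p).
Implicit Types (x y : 'rV[R]_n).

Definition sqgrad y : R := dotp (grad Q y) (grad Q y).

Definition laplacian y : R := \sum_i partial i (partial i Q) y.

(* The i-th component of |DQ|^(p-2) DQ. *)
Definition pfield i y : R := sqgrad y `^ ((p - 2) / 2) * partial i Q y.

Definition dpfield i y : R := sqgrad y `^ ((p - 2) / 2) * partial i (partial i Q) y +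
  partial i Q y * ((p - 2) / 2 * sqgrad y `^ ((p - 2) / 2 - 1) *
    (2 * \sum_k partial k Q y * partial i (partial k Q) y)).

Lemma sqgradE : sqgrad = fun y => \sum_k partial k Q y * partial k Q y.
Proof. by apply/funext => y; apply: eq_bigr => k _; rewrite !mxE. Qed.

Lemma smooth_sqgrad : smooth setT sqgrad.
Proof.
rewrite sqgradE; apply: smooth_sum => k; apply: smoothM; exact: smooth_partial.
Qed.

Lemma is_derive_pfield i y : 0 < sqgrad y ->
  is_derive y (delta_mx ord0 i) (pfield i) (dpfield i y).
Proof.
move=> s0.
have hs : is_derive y (delta_mx ord0 i) sqgrad
    (2 * \sum_k partial k Q y * partial i (partial k Q) y).
  rewrite sqgradE mulr_sumr; apply: is_derive_sum_fun => k.
  have hk := smooth_is_derive i y (smooth_partial k sQ).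
  have := is_deriveM hk hk; rewrite /GRing.scale /= -mulr2n -[_ *+ 2]mulr_natl.
  by [].
have hp := is_derive_comp1 (is_derive1_powR ((p - 2) / 2) s0) hs.
exact: (is_deriveM hp (smooth_is_derive i y (smooth_partial i sQ))).
Qed.

Lemma pfield_continuous i y : 0 < sqgrad y -> {for y, continuous (pfield i)}.
Proof.
move=> s0; apply: continuousM; last exact: smooth_continuous (smooth_partial i sQ) _.
apply: (@continuous_comp _ _ _ sqgrad (@powR R ^~ ((p - 2) / 2))).
  exact: smooth_continuous smooth_sqgrad _.
apply/differentiable_continuous/derivable1_diffP.
by have [] := is_derive1_powR ((p - 2) / 2) s0.
Qed.

Lemma sqgrad_near_gt0 y : 0 < sqgrad y -> \forall z \near y, 0 < sqgrad z.
Proof.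
move=> s0.
have cs : (fun z => sqgrad z) @ y --> sqgrad y by exact: (smooth_continuous smooth_sqgrad).
exact: (cvgr_gt _ cs _ s0).
Qed.

Lemma partial_pfield_continuous i y : 0 < sqgrad y ->
  {for y, continuous (partial i (pfield i))}.
Proof.
move=> s0.
have near : \forall z \near y, dpfield i z = partial i (pfield i) z.
  apply: filterS (sqgrad_near_gt0 s0) => z z0.
  by rewrite /partial; have [_] := is_derive_pfield i z0.
have E : partial i (pfield i) y = dpfield i y.
  by rewrite /partial; have [_] := is_derive_pfield i s0.
have cpow (q : R) : {for y, continuous (fun z => sqgrad z `^ q)}.
  apply: (@continuous_comp _ _ _ sqgrad (@powR R ^~ q)).
    exact: smooth_continuous smooth_sqgrad _.
  apply/differentiable_continuous/derivable1_diffP.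
  by have [] := is_derive1_powR q s0.
change (partial i (pfield i) z @[z --> y] --> partial i (pfield i) y); rewrite E.
apply: (@cvg_trans _ (dpfield i @ y)).
  exact: (near_eq_cvg near).
have cp k := smooth_continuous (smooth_partial k sQ).
have cpp k l := smooth_continuous (smooth_partial l (smooth_partial k sQ)).
have cs : continuous (fun z => \sum_k partial k Q z * partial i (partial k Q) z).
  apply: smooth_continuous; apply: smooth_sum => k; apply: smoothM; apply: smooth_partial => //.
  exact: smooth_partial.
suff : {for y, continuous (dpfield i)} by [].
apply: for_continuousD; apply: for_continuousM; [exact: cpow|exact: cpp|exact: cp|].
apply: for_continuousM; first apply: for_continuousM.
- exact: cst_continuous.
- exact: cpow.
- by apply: for_continuousM; [exact: cst_continuous|exact: cs].
Qed.

(** Factoring out [|DQ|^(p-4)] leaves the non-divergence form of the p-Laplacian, whose sign is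
    under control. *)
Lemma div_pfield y : 0 < sqgrad y -> \sum_i dpfield i y =
  sqgrad y `^ ((p - 2) / 2 - 1) * (sqgrad y * laplacian y + (p - 2) * infty_laplacian Q y).
Proof.
move=> s0; have E : sqgrad y `^ ((p - 2) / 2) = sqgrad y `^ ((p - 2) / 2 - 1) * sqgrad y.
  transitivity (sqgrad y `^ (((p - 2) / 2 - 1) + 1)); first by rewrite subrK.
  by rewrite powRD ?powRr1 ?(ltW s0)//; apply/implyP => _; rewrite gt_eqF.
have D i : dpfield i y =
    sqgrad y `^ ((p - 2) / 2 - 1) * (sqgrad y * partial i (partial i Q) y) +
    sqgrad y `^ ((p - 2) / 2 - 1) *
      ((p - 2) * \sum_k partial i Q y * partial k Q y * partial i (partial k Q) y).
  have -> : \sum_k partial i Q y * partial k Q y * partial i (partial k Q) y =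
      partial i Q y * \sum_k partial k Q y * partial i (partial k Q) y.
    by rewrite mulr_sumr; apply: eq_bigr => k _; rewrite mulrA.
  rewrite /dpfield E; move: (sqgrad y `^ ((p - 2) / 2 - 1)) (sqgrad y) (partial i Q y) (\sum_k _).
  by move: (partial i (partial i Q) y); clear; move=> *; field.
have S (c s k : R) (F a b : 'I_n -> R) :
    (forall i, F i = c * (s * a i) + c * (k * b i)) ->
    \sum_i F i = c * (s * (\sum_i a i) + k * \sum_i b i).
  move=> h; rewrite (eq_bigr _ (fun i _ => h i)) big_split/= -!mulr_sumr.
  by rewrite mulrDr.
exact: S D.
Qed.

End p_laplace_field.

(** * Truncation of almost minimizers *)

Section compactness.
Context {R : realType} {n : nat}.
Local Notation mu := (@lebesgue_rV R n).
Implicit Types (f : 'rV[R]_n -> R) (x y : 'rV[R]_n).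

Lemma compact_bound (K : set 'rV[R]_n) f : compact K ->
  (forall x, K x -> {for x, continuous f}) ->
  exists2 C : R, 0 <= C & forall x, K x -> `|f x| <= C.
Proof.
move=> cK cf.
have : compact (f @` K).
  apply: continuous_compact cK; apply: continuous_in_subspaceT => x; rewrite inE; exact: cf.
move=> /compact_bounded [M [Mr hM]]; exists (`|M| + 1); first by rewrite addr_ge0.
move=> x Kx; apply: (hM (`|M| + 1)); last by exists x.
by rewrite (le_lt_trans (ler_norm M))// ltrDl.
Qed.

Lemma bounded_bsupp_indic (U : set 'rV[R]_n) : bounded_set U -> measurable U ->
  bounded_bsupp (\1_U : 'rV[R]_n -> R).
Proof.
move=> [M [Mr hM]] mU; split; first exact: measurable_indic.
  by exists 1 => x; rewrite indicE ger0_norm ?ler0n// lern1 leq_b1.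
exists (M + 2) => x [i xi]; rewrite indicE memNset// => Ux.
have := hM (M + 1) _ x Ux; rewrite ltrDl ltr01 => /(_ isT) xM.
have := le_trans (ler_coord_norm x i) xM; have := xi; lra.
Qed.

Lemma LnormE_ge0 f (p : R) : 0 < p -> bounded_bsupp f -> (forall x, 0 <= f x) ->
  'N[mu]_p%:E[EFin \o f]%E = ((\int[mu]_x (f x `^ p)) `^ p^-1)%:E.
Proof.
move=> p0 bf f0.
have -> : (fun x => f x `^ p) = (fun x => `|f x| `^ p).
  by apply/funext => x; rewrite ger0_norm.
exact: LnormE p0 bf.
Qed.

(** Hoelder against the indicator of [U]; it turns the Sobolev accuracy of the approximation into a
    small mean defect. *)
Lemma L1_le_Lnorm (U : set 'rV[R]_n) (p : R) : 1 < p -> bounded_set U -> measurable U ->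
  exists2 M : R, 0 < M & forall f (e : R), measurable_fun setT (f \_ U) ->
    (Lnorm_on U p%:E f <= e%:E)%E ->
    mu.-integrable setT (EFin \o (fun x => `|(f \_ U) x|)) /\
    \int[mu]_x `|(f \_ U) x| <= M * e.
Proof.
move=> p1 bU mU.
have p0 : 0 < p by apply: lt_trans p1.
pose q := p / (p - 1).
have q0 : 0 < q by rewrite divr_gt0// subr_gt0.
have pq : p^-1 + q^-1 = 1.
  by rewrite /q; field; rewrite gt_eqF ?gt_eqF// subr_gt0.
have b1 := bounded_bsupp_indic bU mU; have [bd1 _ _] := b1.
have NE := LnormE q0 b1.
move: (_ `^ q^-1) (powR_ge0 (\int[mu]_x `|(\1_U x : R)| `^ q) q^-1) NE => c c0 NE.
(* [c], the conjugate norm of the indicator, may be zero; the constant has to be positive because it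
   is divided by later. *)
exists (c + 1); first by rewrite ltr_wpDl.
move=> f e mf fe.
have e0 : 0 <= e by rewrite -lee_fin (le_trans _ fe)// Lnorm_ge0.
have := hoelder mu mf bd1 p0 q0 pq; rewrite NE Lnorm1.
have -> : ((f \_ U) \* \1_U)%R = f \_ U.
  by apply/funext => x /=; rewrite patchE indicE; case: ifP => ?; rewrite ?mulr1 ?mul0r.
move=> H.
have H2 : (\int[mu]_x `|(EFin \o f \_ U) x| <= ((c + 1) * e)%:E)%E.
  apply: (le_trans H); rewrite muleC mulrDl mul1r EFinD EFinM -[leLHS]adde0 leeD//.
  by apply: lee_wpmul2l; rewrite ?lee_fin.
have i1 : mu.-integrable setT (EFin \o (f \_ U)).
  by apply/integrableP; split; [exact/measurable_EFinP|exact: le_lt_trans H2 (ltry _)].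
have i2 : mu.-integrable setT (EFin \o (fun x => `|(f \_ U) x|)).
  exact: integrable_norm.
split=> //; rewrite -lee_fin /Rintegral fineK//.
by apply: integrable_fin_num.
Qed.

End compactness.

(** * The truncated competitor and its energy *)

Section energy.
Context {R : realType} {n : nat}.
Local Notation mu := (@lebesgue_rV R n).
Variables (Omega : set 'rV[R]_n) (Q : 'rV[R]_n -> R) (p r : R) (x0 : 'rV[R]_n).
Hypotheses (sQ : smooth setT Q) (p4 : 4 <= p) (r0 : 0 < r).
Implicit Types (x y : 'rV[R]_n) (psi : 'rV[R]_n -> R).

Definition sqdist y : R := dotp (y - x0) (y - x0).

Definition eball : set 'rV[R]_n := [set y | sqdist y <= r ^+ 2].

(** The argument of [step] is 1 at squared distance [r^2/2] and 0 at [r^2]: the function is 1 on the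
    smaller ball and 0 outside [eball]. The squared distance is used because it is smooth at
    [x0]. *)
Definition plateau y : R := step (2 - 2 / r ^+ 2 * sqdist y).

Hypothesis BO : eball `<=` Omega.

Lemma smooth_sqdist : smooth setT sqdist.
Proof.
have -> : sqdist = fun y => \sum_i (y ord0 i - x0 ord0 i) * (y ord0 i - x0 ord0 i).
  by apply/funext => y; apply: eq_bigr => i _; rewrite !mxE.
apply: smooth_sum => i; have := smoothB (smooth_coord i) (smooth_cst (x0 ord0 i)).
move=> h; exact: smoothM.
Qed.

Lemma smooth_plateau : smooth setT plateau.
Proof.
apply: smooth_step; apply: smoothB; first exact: smooth_cst.
apply: smoothM smooth_sqdist; exact: smooth_cst.
Qed.

Lemma closed_eball : closed eball.
Proof.
rewrite (_ : eball = sqdist @^-1` [set t | t <= r ^+ 2])//.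
apply: closed_comp => [y _|]; last exact: closed_le.
exact: smooth_continuous smooth_sqdist y.
Qed.

Lemma compact_eball : compact eball.
Proof.
apply: (@subclosed_compact _ _ (cbox (x0 - const_mx r) (x0 + const_mx r))).
- exact: closed_eball.
- exact: compact_cbox.
move=> y By i; rewrite !mxE.
have : (y ord0 i - x0 ord0 i) ^+ 2 <= r ^+ 2.
  apply: le_trans By; rewrite /sqdist /dotp (bigD1 i)//= !mxE -expr2 lerDl.
  by apply: sumr_ge0 => j _; rewrite -expr2 sqr_ge0.
rewrite -(ger0_norm (ltW r0)) -[X in _ <= X]real_normK ?num_real//.
rewrite -[X in X <= _]real_normK ?num_real// ler_pXn2r ?nnegrE// normr_id (ger0_norm (ltW r0)).
rewrite ler_norml => /andP[h1 h2]; apply/andP; split; move: h1 h2; lra.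
Qed.

Lemma plateau_out y : ~ eball y -> plateau y = 0.
Proof.
move=> /negP; rewrite -ltNge => h; apply: step_le0.
by rewrite subr_le0 mulrAC ler_pdivlMr ?exprn_gt0// ler_pM2l// ltW.
Qed.

Lemma plateau_in y : sqdist y <= r ^+ 2 / 2 -> 1 <= 2 - 2 / r ^+ 2 * sqdist y.
Proof.
move=> h; rewrite lerBrDr -lerBrDl (_ : 2 - 1 = 1); last by ring.
by rewrite mulrAC ler_pdivrMr ?exprn_gt0// mul1r; move: h; lra.
Qed.

Lemma partial_plateau_in i y : sqdist y <= r ^+ 2 / 2 -> partial i plateau y = 0.
Proof.
move=> /plateau_in h; apply: partial_step_ge1 => //.
apply: smoothB; first exact: smooth_cst.
apply: smoothM smooth_sqdist; exact: smooth_cst.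
Qed.

Lemma partial_plateau_out i y : ~ eball y -> partial i plateau y = 0.
Proof. by apply: partial_out => //; [exact: closed_eball|exact: plateau_out]. Qed.

Section competitor.
Variables (psi : 'rV[R]_n -> R) (c : R).
Hypothesis tpsi : test_function Omega psi.

Let spsi : smooth setT psi. Proof. by case: tpsi. Qed.

Definition gap y : R := psi y - Q y + c.
Definition excess y : R := plateau y * cut (gap y).
Definition competitor y : R := psi y - excess y.
(** The weight with which [DQ] replaces [D psi] in the gradient of the competitor. [main_grad] is
    that convex combination; the remaining term comes from the slope of the plateau. *)
Definition mix y : R := plateau y * dcut (gap y).
Definition main_grad y : 'rV[R]_n := (1 - mix y) *: grad psi y + mix y *: grad Q y.

Lemma smooth_gap : smooth setT gap.
Proof. by apply: smoothD; [exact: smoothB|exact: smooth_cst]. Qed.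

Lemma smooth_excess : smooth setT excess.
Proof. apply: smoothM smooth_plateau _; apply: smooth_cut; exact: smooth_gap. Qed.

Lemma excess_out y : ~ eball y -> excess y = 0.
Proof. by move=> /plateau_out h; rewrite /excess h mul0r. Qed.

Lemma mix01 y : 0 <= mix y <= 1.
Proof.
by rewrite mulr_ge0 ?step_ge0 ?dcut_ge0//= mulr_ile1 ?step_ge0 ?dcut_ge0 ?step_le1 ?dcut_le1.
Qed.

Lemma partial_gap i y : partial i gap y = partial i psi y - partial i Q y.
Proof.
have h := is_deriveD (is_deriveB (smooth_is_derive i y spsi) (smooth_is_derive i y sQ))
  (is_derive_cst c y (delta_mx ord0 i)).
by rewrite /partial; have [_] := h; rewrite addr0.
Qed.

Lemma partial_excess i y : partial i excess y =
  mix y * (partial i psi y - partial i Q y) + cut (gap y) * partial i plateau y.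
Proof.
have h := is_deriveM (smooth_is_derive i y smooth_plateau)
  (smooth_is_derive i y (smooth_cut smooth_gap)).
rewrite {1}/partial; have [_ ->] := h.
rewrite partial_cut ?partial_gap; last exact: smooth_gap.
by rewrite /GRing.scale /= /mix mulrA.
Qed.

Lemma grad_competitor y : grad competitor y = main_grad y - cut (gap y) *: grad plateau y.
Proof.
apply/rowP => i; rewrite !mxE.
have h := is_deriveB (smooth_is_derive i y spsi) (smooth_is_derive i y smooth_excess).
rewrite {1}/partial; have [_ ->] := h.
rewrite partial_excess; ring.
Qed.

Lemma test_competitor : test_function Omega competitor.
Proof.
have [K [cK KO] psi0] := test_function_compact tpsi.
apply: (@test_function_of _ _ _ (K `|` eball)).
- exact: smoothB smooth_excess.
- by apply: compactU => //; exact: compact_eball.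
- by rewrite subUset.
- by move=> x /not_orP[nK /excess_out h]; rewrite /competitor psi0// h subr0.
Qed.

Lemma main_grad_bounded_bsupp : bounded_bsupp (fun y => enorm (main_grad y)).
Proof.
apply: continuous_bounded_bsupp.
  move=> y; apply: enorm_continuous => i.
  have -> : (fun y => main_grad y ord0 i) =
      (fun y => (1 - mix y) * partial i psi y + mix y * partial i Q y).
    by apply/funext => z; rewrite !mxE.
  have smix : smooth setT mix by apply: smoothM smooth_plateau _; apply: smooth_dcut; exact: smooth_gap.
  apply: smooth_continuous; apply: smoothD; apply: smoothM => //; last exact: smooth_partial.
    by apply: smoothB smix; exact: smooth_cst.
  exact: smooth_partial.
have [_ cK _] := tpsi.
apply: (compact_bsupp (compactU cK compact_eball)) => y /not_orP[ny /plateau_out nz].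
rewrite /main_grad /mix nz mul0r subr0 scale0r addr0 scale1r.
by rewrite (_ : grad psi y = 0) ?enorm0//; apply/rowP => i; rewrite !mxE partial_out_supp.
Qed.

Variables (m : R).
Hypotheses (m0 : 0 < m) (Bm : forall y, eball y -> m <= sqgrad Q y)
  (Bneg : forall y, eball y ->
    sqgrad Q y * laplacian Q y + (p - 2) * infty_laplacian Q y <= -1).

Let kappa : R := m `^ ((p - 2) / 2 - 1).

(** The linear term of the convexity inequality contains [mix (D psi - DQ)], which is [D excess]
    minus [cut (gap)] times [D plateau]. Adding [excess] times the divergence of [pfield] completes
    it to the divergence of [excess * pfield], and since [div pfield <= - kappa] this addition pays
    for [p * kappa * excess]. *)
Lemma energy_pointwise y :
  enorm (main_grad y) `^ p + p * kappa * excess y <=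
  enorm (grad psi y) `^ p
   - p * (\sum_i (excess y * partial i (pfield Q p i) y + partial i excess y * pfield Q p i y))
   + p * (cut (gap y) * \sum_i pfield Q p i y * partial i plateau y).
Proof.
have [By|nBy] := pselect (eball y); last first.
  rewrite excess_out// big1 => [|i _]; last first.
    rewrite mul0r add0r partial_excess partial_plateau_out//.
    by rewrite /mix plateau_out// !mul0r mulr0 addr0 mul0r.
  rewrite big1 => [|i _]; last by rewrite partial_plateau_out// mulr0.
  by rewrite /main_grad /mix plateau_out// mul0r subr0 scale0r addr0 scale1r !mulr0 !addr0 subr0.
have s0 : 0 < sqgrad Q y by apply: lt_le_trans (Bm By).
have p2 : 2 < p by apply: lt_le_trans p4; rewrite ltr_nat.
have conv := enorm_powR_convex (grad psi y) (grad Q y) p2 (mix01 y).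
have div : \sum_i partial i (pfield Q p i) y <= - kappa.
  rewrite (eq_bigr (fun i => dpfield Q p i y)); last first.
    by move=> i _; rewrite /partial; have [_ ->] := is_derive_pfield p sQ i s0.
  rewrite div_pfield//.
  (* The exponent is nonnegative because [4 <= p], so the power is monotone and [m <= sqgrad Q y]
     bounds it from below. *)
  have k1 : kappa <= sqgrad Q y `^ ((p - 2) / 2 - 1).
    by apply: ge0_ler_powR; rewrite ?nnegrE ?(ltW m0) ?(ltW s0) ?Bm//; move: p4; lra.
  apply: le_trans (_ : sqgrad Q y `^ ((p - 2) / 2 - 1) * -1 <= _).
    by apply: ler_wpM2l; [exact: powR_ge0|exact: Bneg].
  by rewrite mulrN1 lerN2.
have E : mix y * (dotp (grad Q y) (grad Q y) `^ ((p - 2) / 2) *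
      dotp (grad Q y) (grad psi y - grad Q y)) =
    \sum_i (partial i excess y * pfield Q p i y)
    - cut (gap y) * \sum_i pfield Q p i y * partial i plateau y.
  rewrite /dotp -/(dotp _ _) -/(sqgrad Q y) mulrA !mulr_sumr -sumrB; apply: eq_bigr => i _.
  rewrite partial_excess !mxE /pfield; move: (_ `^ _) (mix y) (cut _) => a b d; ring.
have d0 : 0 <= excess y by rewrite mulr_ge0 ?step_ge0 ?cut_ge0.
apply: (le_trans (lerD conv (lexx _))); rewrite E big_split /= -mulr_sumr.
have h : p * kappa * excess y <= - (p * (excess y * \sum_i partial i (pfield Q p i) y)).
  have p0 : 0 < p by apply: lt_trans p2.
  rewrite -mulrA -mulrN ler_pM2l// mulrC -mulrN ler_wpM2l// lerNr; exact: div.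
move: h; move: (_ `^ _) (\sum_i _) (\sum_i _) (\sum_i _) (excess y) (cut _) => a b d e f g.
by rewrite -subr_ge0 => h; rewrite -subr_ge0; apply: le_trans h _; rewrite le_eqVlt; apply/orP; left; apply/eqP; ring.
Qed.

Variables (v : 'rV[R]_n -> R) (C1 C2 a0 : R) (K : set 'rV[R]_n).
Hypotheses (mv : measurable_fun setT ((v \- psi) \_ Omega))
  (vout : forall y, eball y -> r ^+ 2 / 2 < sqdist y -> v y - Q y + c <= 0)
  (C1ge0 : 0 <= C1)
  (hC1 : forall y, eball y -> `|\sum_i pfield Q p i y * partial i plateau y| <= C1)
  (C2ge0 : 0 <= C2) (hC2 : forall y, eball y -> enorm (grad plateau y) <= C2)
  (bK : bounded_set K) (mK : measurable K)
  (Kin : forall y, K y -> sqdist y <= r ^+ 2 / 2)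
  (vin : forall y, K y -> a0 <= v y - Q y + c).

(** The price of working with [psi]: the sign conditions hold for [v - Q + c], and transferring them
    to [gap] costs this quantity. *)
Let defect y : R := `|((v \- psi) \_ Omega) y|.

Let defect_ge0 y : 0 <= defect y. Proof. exact: normr_ge0. Qed.

Let K_eball y : K y -> eball y.
Proof. by move=> /Kin h; apply: le_trans h _; rewrite ler_pdivrMr// ler_peMr ?sqr_ge0// ler1n. Qed.

Let defectE y : eball y -> defect y = `|v y - psi y|.
Proof. by move=> By; rewrite /defect patchE mem_set//; exact: BO. Qed.

(* Where the plateau has a slope, [v - Q + c <= 0], so the truncation is small. *)
Lemma cut_gap_le y : eball y -> r ^+ 2 / 2 < sqdist y -> cut (gap y) <= defect y.
Proof.
move=> By sy; have h := vout By sy; rewrite defectE//.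
have [g0|g0] := leP (gap y) 0; first by rewrite cut_le0.
apply: le_trans (_ : gap y <= _).
  by have := cut_lip (ltW g0); rewrite (cut_le0 (lexx 0)) !subr0 => /andP[].
rewrite distrC; apply: le_trans (ler_norm _); rewrite /gap; move: h; lra.
Qed.

(** The derivatives of the plateau vanish off the annulus between the two balls, and on the annulus
    the truncation is at most the defect. *)
Lemma cut_gap_field y :
  cut (gap y) * (\sum_i pfield Q p i y * partial i plateau y) <= C1 * defect y.
Proof.
have [By|nBy] := pselect (eball y); last first.
  by rewrite big1 ?mulr0 ?mulr_ge0 ?defect_ge0// => i _; rewrite partial_plateau_out// mulr0.
have [sy|sy] := leP (sqdist y) (r ^+ 2 / 2).
  by rewrite big1 ?mulr0 ?mulr_ge0 ?defect_ge0// => i _; rewrite partial_plateau_in// mulr0.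
rewrite mulrC; apply: le_trans (_ : C1 * cut (gap y) <= _).
  by apply: ler_wpM2r; [exact: cut_ge0|exact: le_trans (ler_norm _) (hC1 By)].
by apply: ler_wpM2l => //; exact: cut_gap_le.
Qed.

Lemma cut_gap_grad y : cut (gap y) * enorm (grad plateau y) <= C2 * defect y.
Proof.
have g0 : (forall i, partial i plateau y = 0) -> enorm (grad plateau y) = 0.
  by move=> h; rewrite (_ : grad _ _ = 0) ?enorm0//; apply/rowP => i; rewrite !mxE h.
have [By|nBy] := pselect (eball y); last first.
  by rewrite g0 ?mulr0 ?mulr_ge0 ?defect_ge0// => i; rewrite partial_plateau_out.
have [sy|sy] := leP (sqdist y) (r ^+ 2 / 2).
  by rewrite g0 ?mulr0 ?mulr_ge0 ?defect_ge0// => i; rewrite partial_plateau_in.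
rewrite mulrC; apply: ler_pM; rewrite ?enorm_ge0 ?cut_ge0 ?hC2//.
exact: cut_gap_le.
Qed.

(** On [K] the gap of [psi] falls below [a0] by at most the defect, and [cut] is nondecreasing and
    1-Lipschitz. *)
Lemma excess_ge y : cut a0 * \1_K y <= excess y + defect y.
Proof.
rewrite indicE; have [Ky|nKy] := pselect (K y); last first.
  by rewrite memNset// mulr0 addr_ge0 ?defect_ge0// /excess mulr_ge0 ?step_ge0 ?cut_ge0.
rewrite mem_set// mulr1 /excess /plateau step_ge1; last exact: plateau_in (Kin Ky).
rewrite mul1r defectE; last exact: K_eball.
have [h|h] := leP a0 (gap y).
  by have /andP[+ _] := cut_lip h; rewrite subr_ge0 => /le_trans; apply; rewrite lerDl.
have /andP[_ h2] := cut_lip (ltW h).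
rewrite -lerBlDl; apply: le_trans h2 _; apply: le_trans (ler_norm _).
rewrite /gap; have := vin Ky; lra.
Qed.

(** The divergence integrates to zero, which leaves a fixed gain proportional to the measure of [K]
    against a multiple of the mean defect. *)
Lemma energy_integral : mu.-integrable setT (EFin \o defect) ->
  \int[mu]_y (enorm (main_grad y) `^ p) + p * kappa * cut a0 * \int[mu]_y (\1_K y : R) <=
  \int[mu]_y (enorm (grad psi y) `^ p) + p * (C1 + kappa) * \int[mu]_y defect y.
Proof.
move=> idefect.
have p0 : 0 < p by apply: lt_le_trans p4.
have k0 : 0 <= kappa by exact: powR_ge0.
have pw (f : 'rV[R]_n -> 'rV[R]_n) : bounded_bsupp (fun y => enorm (f y)) -> bounded_bsupp (fun y => enorm (f y) `^ p).
  move=> bf; have := bounded_bsupp_powR p0 bf.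
  by congr bounded_bsupp; apply/funext => y; rewrite ger0_norm ?enorm_ge0.
have b1 := pw main_grad main_grad_bounded_bsupp.
have b2 := pw (grad psi) (test_grad_bounded_bsupp tpsi).
have b3 := bounded_bsupp_indic bK mK.
(* The open set where [pfield] is differentiable; it contains the support of [excess] by [Bm]. *)
pose U := [set y | 0 < sqgrad Q y].
have oU : open U.
  rewrite (_ : U = sqgrad Q @^-1` [set t | 0 < t])//.
  apply: open_comp => [y _|]; last exact: open_gt.
  exact: smooth_continuous (smooth_sqgrad sQ) y.
pose F i y := excess y * partial i (pfield Q p i) y + partial i excess y * pfield Q p i y.
have hF i : bounded_bsupp (F i) /\ \int[mu]_y F i y = 0.
  apply: (integral_cutoff oU compact_eball _ smooth_excess excess_out).
  - by move=> y /Bm; exact: lt_le_trans.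
  - by move=> y Uy; have [] := is_derive_pfield p sQ i Uy.
  - by move=> y Uy; exact: pfield_continuous.
  - by move=> y Uy; exact: partial_pfield_continuous.
have i3 (r' : R) f : bounded_bsupp f -> mu.-integrable setT (EFin \o (fun y => r' * f y)).
  move=> /bounded_bsupp_integrable h.
  exact: (integrableZl measurableT r' h).
have iF : mu.-integrable setT (EFin \o (fun y => \sum_i F i y)) /\
    \int[mu]_y (\sum_i F i y) = 0.
  elim: (index_enum _) => [|i t [IH1 IH2]].
    rewrite (_ : (fun y => _) = cst 0); last by apply/funext => y; rewrite big_nil.
    by split; [exact: integrable0|rewrite Rintegral_cst// mul0r].
  have bi := bounded_bsupp_integrable (hF i).1.
  rewrite (_ : (fun y => _) = (fun y => F i y + \sum_(j <- t) F j y)); last first.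
    by apply/funext => y; rewrite big_cons.
  split; first exact: (integrableD measurableT bi IH1).
  by rewrite RintegralD// (hF i).2 IH2 addr0.
have [iF1 iF0] := iF.
have iD (r' : R) : mu.-integrable setT (EFin \o (fun y => r' * defect y)).
  exact: (integrableZl measurableT r' idefect).
have iFp : mu.-integrable setT (EFin \o (fun y => p * \sum_i F i y)).
  exact: (integrableZl measurableT p iF1).
have I1 := bounded_bsupp_integrable b1.
have I2 := bounded_bsupp_integrable b2.
have I3 := i3 (p * kappa * cut a0) _ b3.
have I12 : mu.-integrable setT
    (EFin \o (fun y => enorm (main_grad y) `^ p + p * kappa * cut a0 * \1_K y)).
  exact: (integrableD measurableT I1 I3).
have I13 := integrableD measurableT I12 iFp.
have I4 := integrableD measurableT I2 (iD (p * (C1 + kappa))).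
have key y : enorm (main_grad y) `^ p + p * kappa * cut a0 * \1_K y + p * \sum_i F i y <=
    enorm (grad psi y) `^ p + p * (C1 + kappa) * defect y.
  have h1 := energy_pointwise y; have h2 := cut_gap_field y; have h3 := excess_ge y.
  have h2' : p * (cut (gap y) * \sum_i pfield Q p i y * partial i plateau y) <=
    p * (C1 * defect y) by rewrite ler_pM2l.
  have h3' : p * kappa * (cut a0 * \1_K y) <= p * kappa * (excess y + defect y).
    by apply: ler_wpM2l => //; rewrite mulr_ge0// ltW.
  rewrite -/(F _ _) in h1; move: h1 h2' h3'; rewrite mulrDr -/(\sum_i F i y).
  rewrite !mulrDr !mulrDl !mulrA.
  move: (enorm _ `^ _) (enorm _ `^ _) (p * \sum_i F i y) (p * kappa * cut a0 * _)
    (p * cut (gap y) * _) (p * C1 * _) (p * kappa * excess y) (p * kappa * defect y).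
  by move=> x1 x2 x3 x4 x5 x6 x7 x8; lra.
have := @le_Rintegral _ _ _ mu setT _ _ measurableT I13 I4 (fun y _ => key y).
rewrite RintegralD// RintegralD// RintegralD// !RintegralZl//; last exact: bounded_bsupp_integrable.
by rewrite iF0 mulr0 addr0.
Qed.

(** Minkowski separates the slope of the plateau, to which convexity does not apply, and
    [cut_gap_grad] bounds that part by the distance from [v] to [psi]. *)
Lemma competitor_norm (e : R) : (Lnorm_on Omega p%:E (v \- psi)%R <= e%:E)%E ->
  ('N[mu]_p%:E[EFin \o (fun y => enorm (grad competitor y))] <=
   ((\int[mu]_y (enorm (main_grad y) `^ p)) `^ p^-1 + C2 * e)%:E)%E.
Proof.
move=> he; have p0 : 0 < p by apply: lt_le_trans p4.
have p1 : 1 <= p by apply: le_trans p4; rewrite ler1n.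
have [m1 _ _] := main_grad_bounded_bsupp.
have mw : measurable_fun setT (fun y => enorm (grad competitor y)).
  by have [] := test_grad_bounded_bsupp test_competitor.
have m2 : measurable_fun setT (fun y => C2 * defect y).
  by apply: measurable_funM => //; exact: measurableT_comp.
have h1 : ('N[mu]_p%:E[EFin \o (fun y => enorm (grad competitor y))] <=
    'N[mu]_p%:E[EFin \o ((fun y => enorm (main_grad y)) \+ (fun y => C2 * defect y))%R])%E.
  apply: le_Lnorm => //; first exact: measurable_funD.
  move=> y; rewrite ger0_norm ?enorm_ge0//; apply: le_trans (ler_norm _).
  rewrite grad_competitor; apply: le_trans (enormD _ _) _.
  rewrite enormN enormZ (ger0_norm (cut_ge0 _)) lerD2l; exact: cut_gap_grad.
apply: (le_trans h1); apply: le_trans (minkowski_EFin _ m1 m2 p1) _.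
have E1 : ('N[mu]_p%:E[EFin \o (fun y => enorm (main_grad y))] =
    ((\int[mu]_y (enorm (main_grad y) `^ p)) `^ p^-1)%:E)%E.
  by apply: LnormE_ge0 p0 main_grad_bounded_bsupp _ => y; exact: enorm_ge0.
rewrite EFinD E1; apply: leeD; first exact: lexx.
rewrite Lnorm_scale//; last exact: measurableT_comp.
rewrite EFinM; apply: lee_wpmul2l; first by rewrite lee_fin.
apply: le_trans he; rewrite /Lnorm_on /defect; apply: le_Lnorm => //.
  exact: measurableT_comp.
by move=> y; rewrite normr_id.
Qed.

End competitor.

End energy.

(** * The contradiction for almost minimizers *)

Section variational.
Context {R : realType} {n : nat}.
Local Notation mu := (@lebesgue_rV R n).
Implicit Types (x y : 'rV[R]_n) (psi : 'rV[R]_n -> R).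

Lemma for_continuous_sum I (t : seq I) (F : I -> 'rV[R]_n -> R) x :
  (forall i, {for x, continuous (F i)}) -> {for x, continuous (fun y => \sum_(i <- t) F i y)}.
Proof.
move=> cF; elim: t => [|i t IH].
  rewrite (_ : (fun y => _) = cst 0); first exact: cst_continuous.
  by apply/funext => y; rewrite big_nil.
rewrite (_ : (fun y => _) = (fun y => F i y + \sum_(j <- t) F j y)).
  exact: for_continuousD.
by apply/funext => y; rewrite big_cons.
Qed.

Lemma bounded_set_ball x (s : R) : bounded_set (ball x s).
Proof.
exists (`|x| + s); split; first exact: num_real.
move=> t lt y; rewrite -ball_normE /= => xy; apply: le_trans (ltW lt).
have := ler_normB x (x - y); rewrite subKr => /le_trans; apply.
by rewrite lerD2l ltW.
Qed.

Lemma ball_integral_gt0 x (s : R) : 0 < s -> 0 < \int[mu]_y (\1_(ball x s) y : R).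
Proof.
move=> s0.
have mB : measurable (ball x s) by apply: open_measurable_rV; exact: ball_open.
have bB : bounded_set (ball x s) by exact: bounded_set_ball.
have iB := bounded_bsupp_integrable (bounded_bsupp_indic bB mB).
rewrite -lte_fin /Rintegral fineK; last by apply: integrable_fin_num.
by rewrite integral_indic// setIT; exact: lebesgue_ball_gt0.
Qed.

Variables (Omega : set 'rV[R]_n) (Q : 'rV[R]_n -> R) (p r : R) (x0 : 'rV[R]_n).
Hypotheses (oO : open Omega) (bO : bounded_set Omega) (sQ : smooth setT Q)
  (p4 : 4 <= p) (r0 : 0 < r).
Local Notation B := (eball r x0).
Hypothesis BO : B `<=` Omega.
Variables (v : 'rV[R]_n -> R) (L m c a0 s : R) (y1 : 'rV[R]_n).
Hypotheses (L0 : 0 <= L) (LE : (L%:E `^ p)%E = Lambda Omega p)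
  (mv : measurable_fun Omega v)
  (happ : forall e : R, 0 < e -> exists psi, [/\ test_function Omega psi,
    (Lnorm_on Omega p%:E (v \- psi)%R <= e%:E)%E &
    ('N[mu]_p%:E[EFin \o (fun x => enorm (grad psi x))] <= (L + e)%:E)%E])
  (m0 : 0 < m) (Bm : forall y, B y -> m <= sqgrad Q y)
  (Bneg : forall y, B y ->
    sqgrad Q y * laplacian Q y + (p - 2) * infty_laplacian Q y <= -1)
  (vout : forall y, B y -> r ^+ 2 / 2 < sqdist x0 y -> v y - Q y + c <= 0)
  (a00 : 0 < a0) (s0 : 0 < s)
  (Kin : forall y, ball x0 s y -> sqdist x0 y <= r ^+ 2 / 2)
  (vin : forall y, ball x0 s y -> a0 <= v y - Q y + c)
  (Oy1 : Omega y1) (nBy1 : ~ B y1) (cv : {for y1, continuous v}) (v1 : 1 <= `|v y1|).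

(* Truncating an almost optimal test function near [x0] keeps its values near
   [y1] but strictly lowers its energy. *)
Lemma no_truncation : False.
Proof.
have p0 : 0 < p by apply: lt_le_trans p4.
have p1 : 1 < p by apply: lt_le_trans p4; rewrite ltr1n.
have sz := smooth_plateau r x0.
have [C1 C10 hC1] : exists2 C : R, 0 <= C &
    forall y, B y -> `|\sum_i pfield Q p i y * partial i (plateau r x0) y| <= C.
  apply: compact_bound; first exact: compact_eball.
  move=> y By; apply: for_continuous_sum => i; apply: for_continuousM.
    by apply: pfield_continuous => //; exact: lt_le_trans (Bm By).
  exact: smooth_continuous (smooth_partial i sz) y.
have [C2 C20 hC2] : exists2 C : R, 0 <= C & forall y, B y -> enorm (grad (plateau r x0) y) <= C.
  have [||C C0 hC] := @compact_bound _ _ B (fun y => enorm (grad (plateau r x0) y)).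
  - exact: compact_eball.
  - move=> y By; apply: enorm_continuous => i.
    rewrite (_ : (fun y => _) = partial i (plateau r x0)).
      exact: smooth_continuous (smooth_partial i sz) y.
    by apply/funext => z; rewrite mxE.
  by exists C => // y /hC; exact/le_trans/ler_norm.
have mO := open_measurable_rV oO.
have [M M0 hM] := L1_le_Lnorm p1 bO mO.
pose kappa : R := m `^ ((p - 2) / 2 - 1).
have k0 : 0 < kappa by exact: powR_gt0.
pose H := p * kappa * cut a0 * \int[mu]_y (\1_(ball x0 s) y : R).
have H0 : 0 < H.
  by apply: mulr_gt0 (ball_integral_gt0 _ s0); rewrite mulr_gt0 ?cut_gt0// mulr_gt0.
pose C3 := p * (C1 + kappa) * M.
have C30 : 0 <= C3.
  by apply: mulr_ge0 (ltW M0); rewrite mulr_ge0 ?(ltW p0)// addr_ge0// ltW.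
have [d /andP[d0 d1] [e1 e10 gap]] := energy_gap p1 L0 H0 C20 C30.
(* A neighbourhood of the maximum point that avoids the truncation and on which [|v|] is still
   nearly 1. *)
have [s1 s10 hs1] : exists2 s1 : R, 0 < s1 & forall y, ball y1 s1 y ->
    [/\ Omega y, ~ B y & 1 - d / 2 < `|v y|].
  have n1 : \forall y \near y1, Omega y by exact: open_nbhs_nbhs.
  have n2 : \forall y \near y1, ~ B y.
    by apply: closed_near_out nBy1; exact: closed_eball.
  have n3 : \forall y \near y1, 1 - d / 2 < `|v y|.
    have cn : (fun y => `|v y|) @ y1 --> `|v y1| 
      by apply: cvg_comp cv _; exact: norm_continuous.
    apply: (cvgr_gt _ cn); apply: lt_le_trans v1; move: d0; lra.
  have : \forall y \near y1, [/\ Omega y, ~ B y & 1 - d / 2 < `|v y|].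
    by apply: filterS3 n1 n2 n3.
  by move=> /nbhs_ballP[s1 /= s10 hs]; exists s1.
pose I1 := \int[mu]_y (\1_(ball y1 s1) y : R).
have I10 : 0 < I1 by exact: ball_integral_gt0.
(* The mean defect, at most [M * e], is then below [d / 2] times the measure of [ball y1 s1]. *)
pose e := Num.min e1 (d / 2 * I1 / (2 * M)).
have e0 : 0 < e by rewrite lt_min e10 divr_gt0 ?mulr_gt0// divr_gt0.
have Me : M * e < d / 2 * I1.
  apply: le_lt_trans (_ : M * (d / 2 * I1 / (2 * M)) < _).
    by rewrite ler_pM2l// ge_min lexx orbT.
  have -> : M * (d / 2 * I1 / (2 * M)) = d / 2 * I1 / 2.
    by field; rewrite gt_eqF.
  have : 0 < d / 2 * I1 by rewrite mulr_gt0// divr_gt0.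
  move: (d / 2 * I1) => z; lra.
have [psi [tpsi Npsi gpsi]] := happ e0.
have spsi : smooth setT psi by case: tpsi.
have mf : measurable_fun setT ((v \- psi) \_ Omega).
  apply: measurable_patch => //; apply: measurable_funB => //.
  by apply: measurable_funS (continuous_measurable_rV (smooth_continuous spsi)).
have [idef ledef] := hM _ _ mf Npsi.
(* If [|psi| < 1 - d] on the whole ball, the defect would be at least [d / 2] there, against the
   choice of [e]. *)
have [y By1 psiy] : exists2 y, ball y1 s1 y & 1 - d <= `|psi y|.
  apply: contrapT => nex.
  have small y : ball y1 s1 y -> `|psi y| < 1 - d.
    by move=> by1; rewrite ltNge; apply/negP => h; apply: nex; exists y.
  have mB : measurable (ball y1 s1) by apply: open_measurable_rV; exact: ball_open.
  have bB : bounded_set (ball y1 s1) by exact: bounded_set_ball.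
  have iB := bounded_bsupp_integrable (bounded_bsupp_indic bB mB).
  have idB : mu.-integrable setT (EFin \o (fun y => d / 2 * \1_(ball y1 s1) y)).
    exact: (integrableZl measurableT (d / 2) iB).
  have key y : d / 2 * \1_(ball y1 s1) y <= `|((v \- psi) \_ Omega) y|.
    rewrite indicE; have [Ky|nKy] := pselect (ball y1 s1 y); last first.
      by rewrite memNset// mulr0.
    have [Oy _ vy] := hs1 _ Ky; rewrite mem_set// mulr1 patchE mem_set//=.
    apply: le_trans (lerB_dist _ _); have := small _ Ky; move: vy; lra.
  have := @le_Rintegral _ _ _ mu setT _ _ measurableT idB idef (fun y _ => key y).
  rewrite RintegralZl// -/I1 => h.
  by have := lt_le_trans Me (le_trans h ledef); rewrite ltxx.
have [_ nBy _] := hs1 _ By1.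
pose A := \int[mu]_z (enorm (main_grad Q r x0 psi c z) `^ p).
have A0 : 0 <= A by apply: Rintegral_ge0 => z _; exact: powR_ge0.
apply: (gap e A e0 _ A0).
- by rewrite ge_min lexx.
- have t := test_competitor sQ r0 BO c tpsi.
  have := Lambda_le_test oO y (ltW p1) LE L0 t.
  (* The point lies outside the truncation ball, so the competitor inherits the large value of
     [psi], and [Lambda] bounds its energy from below. *)
  have -> : competitor Q r x0 psi c y = psi y.
    by rewrite /competitor excess_out ?subr0.
  move=> h1.
  have h2 := competitor_norm sQ p4 r0 BO tpsi mf vout C20 hC2 Npsi.
  have := le_trans h1 h2; rewrite lee_fin; apply: le_trans.
  exact: ler_wpM2l.
- have mK : measurable (ball x0 s) by apply: open_measurable_rV; exact: ball_open.
  have bK : bounded_set (ball x0 s) by exact: bounded_set_ball.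
  have := energy_integral sQ p4 r0 BO tpsi m0 Bm Bneg vout C10 hC1 bK mK Kin vin idef.
  rewrite -/A -/kappa -/H => h.
  have E : \int[mu]_z (enorm (grad psi z) `^ p) <= (L + e) `^ p.
    have J0 : 0 <= \int[mu]_z (enorm (grad psi z) `^ p).
      by apply: Rintegral_ge0 => z _; exact: powR_ge0.
    have E1 : ('N[mu]_p%:E[EFin \o (fun z => enorm (grad psi z))] =
        ((\int[mu]_z (enorm (grad psi z) `^ p)) `^ p^-1)%:E)%E.
      by apply: LnormE_ge0 p0 (test_grad_bounded_bsupp tpsi) _ => z; exact: enorm_ge0.
    move: gpsi; rewrite E1 lee_fin; move: (\int[mu]_z _) J0 => J J0 hJ.
    have := ge0_ler_powR (ltW p0) _ _ hJ; rewrite !nnegrE powR_ge0 addr_ge0 ?(ltW e0)//.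
    by rewrite -powRrM mulVf ?gt_eqF// powRr1// => /(_ isT isT).
  have D : p * (C1 + kappa) * \int[mu]_z `|((v \- psi) \_ Omega) z| <= C3 * e.
    rewrite /C3 -(mulrA _ M); apply: ler_wpM2l => //.
    by rewrite mulr_ge0 ?(ltW p0)// addr_ge0// ltW.
  move: h E D; move: (\int[mu]_z _) ((L + e) `^ p) (\int[mu]_z _ ) => x1 x2 x3; lra.
Qed.

End variational.

(** * Viscosity inequalities *)

Section opposite.
Context {R : realType} {n : nat}.
Implicit Types (f g phi u : 'rV[R]_n -> R) (D : set 'rV[R]_n).

Lemma is_derive_opp_near D f g x w : open D -> D x -> (forall y, D y -> g y = - f y) ->
  derivable f x w -> is_derive x w g (- 'D_w f x).
Proof.
move=> oD Dx gf df; have near : \forall y \near x, - f y = g y.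
  have : \forall y \near x, D y by exact: open_nbhs_nbhs.
  by apply: filterS => y /gf ->.
apply: (near_eq_is_derive near); exact: is_deriveN (DeriveDef df erefl).
Qed.

Lemma class_CN k D f g : open D -> (forall y, D y -> g y = - f y) ->
  class_C k D f -> class_C k D g.
Proof.
move=> oD gf; have cg f' g' : (forall y, D y -> g' y = - f' y) ->
    (forall x, D x -> {for x, continuous f'}) -> forall x, D x -> {for x, continuous g'}.
  move=> gf' cf x Dx; have near : \forall y \near x, - f' y = g' y.
    have : \forall y \near x, D y by exact: open_nbhs_nbhs.
    by apply: filterS => y /gf' ->.
  suff : g' @ x --> g' x by [].
  rewrite (gf' _ Dx); apply: (cvg_trans (near_eq_cvg near)).
  by apply: cvgN; exact: cf.
elim: k f g gf => [|k IH] f g gf [cf hf]; split; try exact: cg gf cf.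
  by [].
move=> i; have [di ci] := hf i; split.
  by move=> x Dx; have [] := is_derive_opp_near oD Dx gf (di x Dx).
apply: (IH (partial i f)) => // y Dy.
by rewrite /partial; have [_ ->] := is_derive_opp_near oD Dy gf (di y Dy).
Qed.

Lemma infty_laplacianN D phi x : open D -> D x -> class_C 2 D phi ->
  infty_laplacian (\- phi) x = - infty_laplacian phi x.
Proof.
move=> oD Dx [_ h].
have gf : forall y, D y -> (\- phi) y = - phi y by [].
have d1 i y : D y -> partial i (\- phi) y = - partial i phi y.
  move=> Dy; have [di _] := h i.
  by rewrite /partial; have [_ ->] := is_derive_opp_near oD Dy gf (di y Dy).
have d2 i j : partial i (partial j (\- phi)) x = - partial i (partial j phi) x.
  have [_ [_ h2]] := h j; have [di _] := h2 i.
  by rewrite {1}/partial; have [_ ->] := is_derive_opp_near oD Dx (d1 j) (di x Dx).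
rewrite /infty_laplacian -sumrN; apply: eq_bigr => i _.
rewrite -sumrN; apply: eq_bigr => j _.
by rewrite d2 !d1//; ring.
Qed.

Lemma touches_belowN D phi u x : open D -> touches_below D phi u x ->
  touches_above D (\- phi) (\- u) x.
Proof.
move=> oD [Dx cphi pu lt]; split; first exact: Dx.
- by apply: (class_CN oD _ cphi) => y _.
- by rewrite /= pu.
- by move=> y Dy yx; rewrite /= ltrN2; exact: lt.
Qed.

Lemma test_functionN Omega psi : test_function Omega psi ->
  test_function Omega (\- psi : 'rV[R]_n -> R).
Proof.
move=> [spsi cpsi sub].
have E : [set x | (\- psi) x != 0] = [set x | psi x != 0].
  by apply/seteqP; split => x /=; rewrite oppr_eq0.
by split; [exact: smoothN|rewrite E|rewrite E].
Qed.

Lemma enorm_gradN psi x : smooth setT psi -> enorm (grad (\- psi) x) = enorm (grad psi x :> 'rV[R]_n).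
Proof.
move=> spsi; rewrite -enormN; congr enorm; apply/rowP => i; rewrite !mxE.
rewrite -[RHS]opprK; congr (- _); rewrite /partial.
by have [_ ->] := is_deriveN (smooth_is_derive i x spsi).
Qed.

End opposite.

Section minimizer.
Context {R : realType} {n : nat} (Omega : set 'rV[R]_n).
Hypothesis oO : open Omega.
Local Notation mu := (@lebesgue_rV R n).
Implicit Types (u v psi : 'rV[R]_n -> R) (p : R).

(* What is retained of an extremal: measurability, and approximation by test
   functions of almost minimal energy. *)
Definition near_minimal p v := measurable_fun Omega v /\ exists L : R,
  [/\ 0 <= L, (L%:E `^ p)%E = Lambda Omega p &
  forall e : R, 0 < e -> exists psi, [/\ test_function Omega psi,
    (Lnorm_on Omega p%:E (v \- psi)%R <= e%:E)%E &
    ('N[mu]_p%:E[EFin \o (fun x => enorm (grad psi x))] <= (L + e)%:E)%E]].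

Lemma near_minimal_extremal p u : 1 <= p -> positive_extremal Omega p u -> near_minimal p u.
Proof.
move=> p1 [su pos _ LE]; have [[mu' ex fin] _] := su; split=> //.
have Lfin : Lnorm_on Omega p%:E (grad_norm Omega u) \is a fin_num.
  rewrite ge0_fin_numE ?Lnorm_ge0//; apply: le_lt_trans fin.
  by rewrite /sobolev_norm leeDr// Lnorm_ge0.
exists (fine (Lnorm_on Omega p%:E (grad_norm Omega u))); split.
- by rewrite fine_ge0// Lnorm_ge0.
- by rewrite fineK.
- by move=> e e0; apply: sobolev0_approx => //; rewrite fineK.
Qed.

(** The opposite of a positive extremal is not one, but the properties retained in [near_minimal] do
    not see the sign. *)
Lemma near_minimalN p v : near_minimal p v -> near_minimal p (\- v).
Proof.
move=> [mv [L [L0 LE h]]]; split; first exact: measurable_funN.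
exists L; split=> // e e0; have [psi [tpsi h1 h2]] := h e e0.
exists (\- psi); split.
- exact: test_functionN.
- rewrite /Lnorm_on (_ : EFin \o _ = (\- (EFin \o ((v \- psi)%R \_ Omega)))%E).
    by rewrite oppe_Lnorm.
  apply/funext => x /=; rewrite !patchE; case: ifP => _ /=; last by rewrite oppr0.
  by rewrite EFinN -EFinN opprD.
- rewrite (_ : (fun x => _) = (fun x => enorm (grad psi x)))//.
  by apply/funext => x; rewrite enorm_gradN//; case: tpsi.
Qed.

Lemma extremal_max_ge1 p u x : positive_extremal Omega p u -> maximum_point Omega u x ->
  1 <= `|u x|.
Proof.
move=> [_ pos N1 _] [Ox umax].
rewrite -lee_fin -N1; apply: Lnorm_on_oo_le => // y Oy.
by rewrite !ger0_norm ?umax// ltW// pos.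
Qed.

End minimizer.

(** * Touching a limit of almost minimizers from above *)

Section touching.
Context {R : realType} {n : nat} (Omega : set 'rV[R]_n).
Hypotheses (oO : open Omega) (bO : bounded_set Omega).
Variables (V : nat -> 'rV[R]_n -> R) (q : nat -> R) (y : nat -> 'rV[R]_n)
  (xstar : 'rV[R]_n) (v : 'rV[R]_n -> R).
Hypotheses (qoo : q k @[k --> \oo] --> +oo) (yx : y k @[k --> \oo] --> xstar)
  (Vmin : \forall k \near \oo, near_minimal Omega (q k) (V k))
  (Vy : \forall k \near \oo, [/\ Omega (y k), {for y k, continuous (V k)} & 1 <= `|V k (y k)|])
  (Vv : forall e : R, 0 < e -> \forall k \near \oo, forall x, Omega x -> `|v x - V k x| < e).

Local Notation D := (Omega `\ xstar).

Let oD : open D.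
Proof.
rewrite setDE; apply: openI => //; apply: closed_openC.
by apply: accessible_closed_set1; apply: hausdorff_accessible; exact: norm_hausdorff.
Qed.

Lemma sqdist_center (x0 : 'rV[R]_n) : sqdist x0 x0 = 0 :> R.
Proof. by rewrite /sqdist subrr /dotp big1// => i _; rewrite mxE mul0r. Qed.

Lemma eball_nbhs (x0 : 'rV[R]_n) (P : 'rV[R]_n -> Prop) : (\forall x \near x0, P x) ->
  exists2 r : R, 0 < r & forall x, eball r x0 x -> P x.
Proof.
move=> /nbhs_ballP[r /= r0 hr]; exists (r / 2); first exact: divr_gt0.
move=> x Bx; apply: hr; apply/ball_rVP => // i.
have h : (x ord0 i - x0 ord0 i) ^+ 2 <= (r / 2) ^+ 2.
  apply: le_trans Bx; rewrite /sqdist /dotp (bigD1 i)//= !mxE -expr2 lerDl.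
  by apply: sumr_ge0 => j _; rewrite -expr2 sqr_ge0.
rewrite distrC; apply: le_lt_trans (_ : _ <= r / 2) _; last by rewrite ltr_pdivrMr// ltr_pMr// ltr1n.
have r2 : 0 <= r / 2 by rewrite ltW// divr_gt0.
by rewrite -(ler_pXn2r (ltn0Sn 1)) ?nnegrE// real_normK ?num_real.
Qed.

(** Used in contrapositive form: a negative infinity-Laplacian excludes a critical point of [Q],
    where the p-Laplacian degenerates. *)
Lemma infty_laplacian_eq0 (Q : 'rV[R]_n -> R) x0 : sqgrad Q x0 = 0 -> infty_laplacian Q x0 = 0.
Proof.
move=> s0; have g0 i : partial i Q x0 = 0.
  have g : partial i Q x0 ^+ 2 <= 0.
    rewrite -s0 sqgradE (bigD1 i)//= -expr2 lerDl.
    by apply: sumr_ge0 => j _; rewrite -expr2 sqr_ge0.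
  by apply/eqP; rewrite -sqrf_eq0 eq_le g sqr_ge0.
by rewrite /infty_laplacian big1// => i _; rewrite big1// => j _; rewrite g0 !mul0r.
Qed.

Lemma smooth_infty_laplacian (Q : 'rV[R]_n -> R) : smooth setT Q -> smooth setT (infty_laplacian Q).
Proof.
move=> sQ; apply: smooth_sum => i; apply: smooth_sum => j.
apply: smoothM; last by do 2 apply: smooth_partial.
by apply: smoothM; exact: smooth_partial.
Qed.

Lemma smooth_laplacian (Q : 'rV[R]_n -> R) : smooth setT Q -> smooth setT (laplacian Q).
Proof. by move=> sQ; apply: smooth_sum => i; do 2 apply: smooth_partial. Qed.

Lemma smooth_near_lt (f : 'rV[R]_n -> R) x0 (a : R) : smooth setT f -> f x0 < a ->
  \forall x \near x0, f x < a.
Proof.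
move=> sf fa; have cf : (fun x => f x) @ x0 --> f x0 by exact: smooth_continuous sf x0.
exact: (cvgr_lt _ cf).
Qed.

Lemma limit_touching_above phi (x0 : 'rV[R]_n) : {for x0, continuous v} ->
  touches_above D phi v x0 -> 0 <= infty_laplacian phi x0.
Proof.
have half_lt (t : R) : 0 < t -> t / 2 < t by move=> t0; rewrite ltr_pdivrMr// ltr_pMr// ltr1n.
have le_sub3 (a b f t : R) : f <= b - t -> a <= f -> a - b <= - t by lra.
have ge_q (a t : R) : 4 + a <= t -> a <= t - 2 by lra.
have le_sum (a t1 t2 t3 : R) : a + 1 <= t1 -> t2 <= - t1 -> t3 <= a -> t3 + t2 <= - 1 by lra.
have vout_le (a b w e t : R) : a - b <= - t -> 8 * e <= t -> 0 < e -> - e < a - w ->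
  w - b + 4 * e <= 0 by lra.
have vin_ge (a b w e : R) : - e <= a - b -> a - w < e -> 2 * e <= w - b + 4 * e by lra.
move=> cv [Dx0 cphi phiv touch]; rewrite leNgt; apply/negP => neg.
have [Q [delta [sQ delta0 Qx0 Qneg nearQ]]] := quadratic_majorant oD Dx0 cphi neg.
pose theta : R := - infty_laplacian Q x0 / 2.
have th0 : 0 < theta by rewrite divr_gt0// oppr_gt0.
have g0 : 0 < sqgrad Q x0.
  rewrite lt_neqAle dotp_ge0 andbT eq_sym; apply/eqP => /infty_laplacian_eq0 h.
  by move: Qneg; rewrite h ltxx.
pose m := sqgrad Q x0 / 2.
have m0 : 0 < m by rewrite divr_gt0.
pose C : R := `|sqgrad Q x0 * laplacian Q x0| + 1.
have sg := smooth_sqgrad sQ.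
have [r r0 hr] : exists2 r : R, 0 < r & forall x, eball r x0 x ->
    [/\ D x, phi x <= Q x - delta * sqdist x0 x, infty_laplacian Q x < - theta, m <= sqgrad Q x &
      sqgrad Q x * laplacian Q x <= C].
  apply: eball_nbhs.
  have n1 : \forall x \near x0, D x by exact: open_nbhs_nbhs.
  have n2 : \forall x \near x0, infty_laplacian Q x < - theta.
    apply: smooth_near_lt; first exact: smooth_infty_laplacian.
    by rewrite /theta mulNr opprK -ltrN2 -mulNr half_lt// oppr_gt0.
  have n3 : \forall x \near x0, - sqgrad Q x < - m.
    apply: smooth_near_lt; first exact: smoothN.
    by rewrite ltrN2 half_lt.
  have n4 : \forall x \near x0, sqgrad Q x * laplacian Q x < C.
    apply: (@smooth_near_lt (fun x => sqgrad Q x * laplacian Q x)).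
      by apply: smoothM => //; exact: smooth_laplacian.
    by rewrite /C (le_lt_trans (ler_norm _))// ltrDl.
  have nI (P P' : 'rV[R]_n -> Prop) : (\forall x \near x0, P x) -> (\forall x \near x0, P' x) ->
    \forall x \near x0, P x /\ P' x by exact: filterI.
  apply: filterS (nI _ _ (nI _ _ n1 nearQ) (nI _ _ n2 (nI _ _ n3 n4))).
  move=> x [[h1 h2] [h3 [h4 h5]]]; split=> //.
    by move: h4; rewrite ltrN2 => /ltW.
  exact: ltW.
have BO x : eball r x0 x -> Omega x by move=> /hr[[]].
have vQ x : eball r x0 x -> v x - Q x <= - (delta * sqdist x0 x).
  move=> Bx; have [Dx h _ _ _] := hr x Bx.
  have vphi : v x <= phi x.
    by have [->|xx0] := eqVneq x x0; [rewrite phiv|exact: ltW (touch _ Dx xx0)].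
  exact: le_sub3 h vphi.
(* On the annulus [v - Q <= - delta * r^2 / 2 = - 8 ep], and near [x0] it is at least [- ep]. With
   [c = 4 ep] and [|v - V k| < ep], the function [V k - Q + c] is at most [- 3 ep] on the annulus
   and at least [2 ep] near [x0]. *)
pose ep := delta * r ^+ 2 / 16.
have ep0 : 0 < ep by rewrite divr_gt0// mulr_gt0// exprn_gt0.
pose c := 4 * ep.
have [s s0 hs] : exists2 s : R, 0 < s & forall x, ball x0 s x ->
    [/\ Omega x, sqdist x0 x <= r ^+ 2 / 2 & - ep <= v x - Q x].
  have n1 : \forall x \near x0, Omega x by apply: open_nbhs_nbhs; split=> //; case: Dx0.
  have n2 : \forall x \near x0, sqdist x0 x < r ^+ 2 / 2.
    apply: smooth_near_lt; first exact: smooth_sqdist.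
    by rewrite sqdist_center divr_gt0// exprn_gt0.
  have n3 : \forall x \near x0, - ep < v x + - Q x.
    have cvQ : (fun x => v x + - Q x) @ x0 --> v x0 + - Q x0.
      apply: for_continuousD => //.
      exact: smooth_continuous (smoothN sQ) x0.
    by apply: (cvgr_gt _ cvQ); rewrite Qx0 phiv subrr oppr_lt0.
  have : \forall x \near x0, [/\ Omega x, sqdist x0 x <= r ^+ 2 / 2 & - ep <= v x - Q x].
    apply: filterS3 n1 n2 n3 => x h1 h2 h3; split=> //; exact: ltW.
  by move=> /nbhs_ballP[s /= s0 hs]; exists s.
(* The ball lies in [Omega] minus [xstar] and is closed, so the points [y k] eventually leave it as
   well. *)
have nBstar : ~ eball r x0 xstar by move=> /hr[[_ /(_ erefl)]].
have n1 : \forall k \near \oo, ~ eball r x0 (y k).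
  have cl : closed (eball r x0) by exact: closed_eball.
  exact: (yx (closed_near_out cl nBstar)).
(* Ensures both [4 <= q k] and [(q k - 2) * theta >= C + 1], so the p-Laplace expression is at most
   [C - (C + 1) = -1]. *)
have n2 : \forall k \near \oo, 4 + (C + 1) / theta <= q k by move/cvgryPge: qoo; exact.
near \oo => k.
have Vk : forall x, Omega x -> `|v x - V k x| < ep by near: k; exact: Vv.
have [mV [L [L0 LE happ]]] : near_minimal Omega (q k) (V k) by near: k.
have [Oyk cVk Vyk] : [/\ Omega (y k), {for y k, continuous (V k)} & 1 <= `|V k (y k)|] by near: k.
have nBy : ~ eball r x0 (y k) by near: k.
have qk : 4 + (C + 1) / theta <= q k by near: k.
have C0 : 0 < C by rewrite /C ltr_wpDl.
have q4 : 4 <= q k by apply: le_trans qk; rewrite lerDl divr_ge0 ?addr_ge0 ?(ltW C0) ?(ltW th0).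
have Bm x : eball r x0 x -> m <= sqgrad Q x by move=> /hr[].
apply: (@no_truncation _ _ Omega Q (q k) r x0 oO bO sQ q4 r0 BO (V k) L m c (2 * ep) s (y k)
  L0 LE mV happ m0 Bm _ _ _ s0 _ _ Oyk nBy cVk Vyk).
- move=> x Bx; have [_ _ h1 _ h2] := hr x Bx.
  have h3 : C + 1 <= (q k - 2) * theta.
    by rewrite -ler_pdivrMr//; exact: ge_q.
  have h4 : (q k - 2) * infty_laplacian Q x <= (q k - 2) * - theta.
    by apply: ler_wpM2l (ltW h1); rewrite subr_ge0 (le_trans _ q4)// ler_nat.
  by rewrite mulrN in h4; exact: le_sum h3 h4 h2.
- move=> x Bx sx; have h1 := vQ x Bx.
  have h2 : delta * (r ^+ 2 / 2) <= delta * sqdist x0 x by apply: ler_wpM2l; exact: ltW.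
  have := Vk x (BO x Bx); rewrite ltr_norml => /andP[h3 h4].
  have h5 : delta * (r ^+ 2 / 2) = 8 * ep by rewrite /ep; field.
  by rewrite h5 in h2; exact: vout_le h1 h2 ep0 h3.
- by rewrite mulr_gt0.
- by move=> x /hs[].
- move=> x /hs[Ox _ h1]; have := Vk x Ox; rewrite ltr_norml => /andP[h3 h4].
  exact: vin_ge h1 h4.
Unshelve. all: by end_near.
Qed.

End touching.

(** * Boundary values *)

Section boundary_distance.
Context {R : realType} {n : nat}.
Implicit Types (A : set 'rV[R]_n) (x y : 'rV[R]_n) (f u : 'rV[R]_n -> R).

Lemma uniform_dist_lt A (F : set_system ('rV[R]_n -> R)) f : Filter F ->
  {uniform A, F --> f} -> forall e : R, 0 < e -> \forall g \near F, forall x, A x -> `|f x - g x| < e.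
Proof.
move=> FF Ff e e0; apply: Ff; apply/uniform_nbhs.
exists [set xy | ball xy.1 e xy.2]; split; first exact: entourage_ball (PosNum e0).
by move=> g h x Ax; exact: h x Ax.
Qed.

Lemma within_continuous_interior A f x : open A -> A x -> {within closure A, continuous f} ->
  {for x, continuous f}.
Proof.
move=> oA Ax cf; have := continuous_subspaceW (@subset_closure _ A) cf.
by rewrite continuous_open_subspace// => /(_ x); apply; rewrite inE.
Qed.

Lemma boundary_out A x : open A -> boundary A x -> closure A x /\ ~ A x.
Proof. by move=> oA [cx]; rewrite (interior_id A).1. Qed.

Lemma has_lbound_dist A x : has_lbound [set enorm (y - x) | y in boundary A].
Proof. by exists 0 => _ [y _ <-]; exact: enorm_ge0. Qed.

Lemma dist_boundary_le A x y : boundary A y -> dist_boundary A x <= enorm (y - x).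
Proof. by move=> by_; apply: ge_inf; [exact: has_lbound_dist|exists y]. Qed.

Lemma dist_boundary_eq0 A x : boundary A x -> dist_boundary A x = 0.
Proof.
move=> bx; apply/eqP; rewrite eq_le; apply/andP; split.
  by rewrite (le_trans (dist_boundary_le x bx))// subrr enorm0.
apply: lb_le_inf; first by exists (enorm (x - x)), x.
by move=> _ [y _ <-]; exact: enorm_ge0.
Qed.

(* Otherwise [A] would be clopen, so its trace on a line would be the line. *)
Lemma boundary_nonempty A x : (0 < n)%N -> open A -> bounded_set A -> A x -> boundary A !=set0.
Proof.
move=> n0 oA bA Ax; apply/set0P/negP => /eqP b0.
have clA : closed A.
  move=> y cy; apply: contrapT => nAy.
  have : boundary A y by split=> //; rewrite (interior_id A).1.
  by rewrite b0.
pose i := Ordinal n0; pose l (t : R) : 'rV[R]_n := x + t *: delta_mx ord0 i.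
have cl : continuous l.
  by move=> t; apply: cvgD; [exact: cvg_cst|apply: cvgZr_tmp; exact: cvg_id].
have /connected_intervalP cT : is_interval [set: R] by [].
have E : l @^-1` A = setT.
  apply: cT.
  - by exists 0; rewrite /l /= scale0r addr0.
  - by exists (l @^-1` A); [apply: open_comp => // t _; exact: cl|rewrite setTI].
  - by exists (l @^-1` A); [apply: closed_comp => // t _; exact: cl|rewrite setTI].
have [M [Mr hM]] := bA.
(* Coordinate [i] of [l t] then exceeds the bound [|M| + 1] valid on [A]. *)
pose t : R := `|M| + 1 + `|x ord0 i| + 1.
have At : A (l t) by have : (l @^-1` A) t by rewrite E.
have M1 : M < `|M| + 1 by rewrite (le_lt_trans (ler_norm M))// ltrDl.
have := le_trans (ler_coord_norm (l t) i) (hM _ M1 _ At).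
rewrite /l !mxE !eqxx mulr1 => h.
have h1 := le_trans (ler_norm _) h.
have h2 : - `|x ord0 i| <= x ord0 i by rewrite lerNl -normrN ler_norm.
by move: h1 h2; rewrite /t; move: (`|M|) (`|_|) (x _ _) => a b d; lra.
Qed.

(** Boundary points lie outside a ball around [x] contained in [A]. The boundary has to be nonempty,
    because the infimum of the empty set is 0. *)
Lemma dist_boundary_gt0 A x : (0 < n)%N -> open A -> bounded_set A -> A x -> 0 < dist_boundary A x.
Proof.
move=> n0 oA bA Ax; have [y0 by0] := boundary_nonempty n0 oA bA Ax.
have /nbhs_ballP[e /= e0 he] : \forall y \near x, A y by exact: open_nbhs_nbhs.
apply: (lt_le_trans e0); apply: lb_le_inf; first by exists (enorm (y0 - x)), y0.
move=> _ [y by_ <-]; rewrite leNgt; apply/negP => ye.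
have [_ nAy] := boundary_out oA by_; apply: nAy; apply: he; apply/ball_rVP => // i.
by rewrite distrC; apply: le_lt_trans ye; have := ler_coord_enorm (y - x) i; rewrite !mxE.
Qed.

(** The bounds hold almost everywhere only, but near [x] the set [A] contains a nonempty open set,
    hence points where they hold. There [u] is at most the distance to [x] divided by [d], and
    continuity on the closure carries this to [x]. *)
Lemma boundary_value A u (d : R) x : open A -> 0 < d -> {within closure A, continuous u} ->
  {ae lebesgue_rV n, forall y, A y -> 0 <= u y <= dist_boundary A y / d} ->
  boundary A x -> u x = 0.
Proof.
move=> oA d0 cu ae bx; have [cx _] := boundary_out oA bx.
apply/eqP; rewrite -normr_le0; apply/ler_addgt0Pr => e e0; rewrite add0r.
have n1 : \forall y \near x, closure A y -> `|u x - u y| < e / 2.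
  have := cu x; rewrite /continuous_at /= => h.
  have e2 : 0 < e / 2 by rewrite divr_gt0.
  have := h _ (nbhsx_ballx (u x) _ e2).
  rewrite nbhs_simpl /= /nbhs /= /nbhs_subspace /=.
  by rewrite mem_set.
have n2 : \forall y \near x, enorm (x - y) < d * (e / 2).
  have ce : {for x, continuous (fun y => enorm (x - y))}.
    apply: enorm_continuous => i.
    rewrite (_ : (fun y => _) = (fun y : 'rV[R]_n => x ord0 i - y ord0 i)).
      exact: smooth_continuous (smoothB (smooth_cst _) (smooth_coord i)) x.
    by apply/funext => y; rewrite !mxE.
  have ce' : (fun y => enorm (x - y)) @ x --> enorm (x - x) by exact: ce.
  by apply: (cvgr_lt _ ce'); rewrite subrr enorm0 mulr_gt0// divr_gt0.
have : \forall y \near x, `|u x - u y| < e / 2 \/ ~ closure A y.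
  by apply: filterS n1 => y h; have [/h|] := pselect (closure A y); [left|right].
move=> n1'; have /nbhs_ballP[s /= s0 hs] : \forall y \near x,
    (`|u x - u y| < e / 2 \/ ~ closure A y) /\ enorm (x - y) < d * (e / 2).
  exact: filterI.
have [z [Az zx]] := cx _ (nbhsx_ballx x _ s0).
have oU : open (A `&` ball x s) by apply: openI => //; exact: ball_open.
have [y [Ay xy] hy] := open_ae_ex oU (conj Az zx) ae.
have [[h1|nA] h2] := hs _ xy; last by case: nA; exact: subset_closure.
have /andP[u0 u1] := hy Ay.
have u2 : u y < e / 2.
  apply: le_lt_trans u1 _; rewrite ltr_pdivrMr// mulrC.
  exact: le_lt_trans (dist_boundary_le y bx) h2.
have -> : u x = (u x - u y) + u y by rewrite subrK.
apply: le_trans (ler_normD _ _) _; rewrite [e]splitr.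
by apply: lerD; [exact: ltW|rewrite ger0_norm// ltW].
Qed.

End boundary_distance.

Unset Implicit Arguments.

Theorem theorem3p11 (R : realType) (N : nat) (Omega : set 'rV[R]_N)
    (u : R -> 'rV[R]_N -> R) (xmax : R -> 'rV[R]_N)
    (p : nat -> R) (xstar : 'rV[R]_N) (uinf : 'rV[R]_N -> R) :
  (2 <= N)%N ->
  bounded_smooth_domain Omega ->
  (forall q : R, N%:R < q ->
     [/\ positive_extremal Omega q (u q),
         {within closure Omega, continuous (u q)} &
         unique (maximum_point Omega (u q)) (xmax q)]) ->
  p n @[n --> \oo] --> +oo ->
  Omega xstar ->
  sobolev0_infty Omega uinf ->
  (* (a) *)
  (forall r : R, N%:R < r ->
     weak_cvg_sobolev0 Omega r (fun n => u (p n)) uinf) ->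
  {uniform closure Omega, (fun n => u (p n)) @ \oo --> uinf} ->
  (* (b) *)
  Lnorm_on Omega +oo%E (grad_norm Omega uinf) = (1 / dist_norm Omega)%:E ->
  (* (c) *)
  {ae lebesgue_rV N, forall x, Omega x ->
     0 <= uinf x <= dist_boundary Omega x / dist_norm Omega} ->
  (* (d) *)
  xmax (p n) @[n --> \oo] --> xstar ->
  (* (e) *)
  uinf xstar = 1 ->
  Lnorm_on Omega +oo%E uinf = 1%E ->
  dist_boundary Omega xstar = dist_norm Omega ->
  infty_harmonic (Omega `\ xstar) uinf /\
  (forall x, ([set xstar] `|` boundary Omega) x ->
     uinf x = dist_boundary Omega x / dist_norm Omega).

Proof.
move=> N2 [_ oO _ bO _] ext poo Oxs _ _ ucvg _ ae xcvg uxs _ dxs.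
set d := dist_norm Omega in ae dxs *.
(* [dist_norm] is the distance at the interior point [xstar], hence positive. *)
have d0 : 0 < d by rewrite -dxs; apply: dist_boundary_gt0 => //; exact: ltn_trans N2.
(* The margin 1 gives both [N < p k] and [1 <= p k]. *)
have pN : \forall k \near \oo, N%:R + 1 <= p k by move/cvgryPge: poo; exact.
have E : \forall k \near \oo, [/\ positive_extremal Omega (p k) (u (p k)),
    {within closure Omega, continuous (u (p k))},
    maximum_point Omega (u (p k)) (xmax (p k)) & 1 <= p k].
  apply: filterS pN => k hk; have Nk : N%:R < p k by apply: lt_le_trans hk; rewrite ltrDl.
  have [h1 h2 [h3 _]] := ext _ Nk; split=> //.
  by apply: le_trans hk; rewrite lerDr.
have cuinf : {within closure Omega, continuous uinf}.
  apply: uniform_limit_continuous_subspace ucvg.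
  by apply: filterS E => k [].
have near_u (e : R) : 0 < e -> \forall k \near \oo, forall x, Omega x -> `|uinf x - u (p k) x| < e.
  move=> e0; have h : \forall k \near \oo, forall x, closure Omega x -> `|uinf x - u (p k) x| < e.
    exact: uniform_dist_lt _ ucvg _ e0.
  by apply: filterS h => k h x Ox; apply: h; exact: subset_closure.
have oD : open (Omega `\ xstar).
  rewrite setDE; apply: openI => //; apply: closed_openC.
  by apply: accessible_closed_set1; apply: hausdorff_accessible; exact: norm_hausdorff.
have cint x : (Omega `\ xstar) x -> {for x, continuous uinf}.
  by move=> [Ox _]; exact: within_continuous_interior cuinf.
split; last first.
  move=> x [->|bx]; first by rewrite uxs dxs divff// gt_eqF.
  by rewrite (boundary_value oO d0 cuinf ae bx) dist_boundary_eq0// mul0r.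
split.
- by apply: continuous_subspaceW cuinf; apply: closureS => x [].
- move=> phi x tch; have Dx : (Omega `\ xstar) x by case: tch.
  apply: (limit_touching_above oO bO poo xcvg _ _ near_u (cint x Dx) tch).
    by apply: filterS E => k [h1 _ _ h4]; exact: near_minimal_extremal.
  apply: filterS E => k [h1 h2 h3 _]; have [Oy _] := h3; split=> //.
    exact: within_continuous_interior h2.
  by apply: extremal_max_ge1 h1 h3.
- move=> phi x tch; have [Dx cphi _ _] := tch.
  (* The sign change keeps [|u (x_p)| >= 1], the only form in which the normalization of the maximum
     is used. *)
  have := touches_belowN oD tch => tch'.
  rewrite -oppr_ge0 -(infty_laplacianN oD Dx cphi).
  apply: (@limit_touching_above _ _ _ oO bO (fun k => \- u (p k)) p (fun k => xmax (p k))
    xstar (\- uinf) poo xcvg _ _ _ _ x _ tch').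
  + apply: filterS E => k [h1 _ _ h4]; apply: near_minimalN.
    exact: near_minimal_extremal.
  + apply: filterS E => k [h1 h2 h3 _]; have [Oy _] := h3; split=> //.
      apply: continuousN; exact: within_continuous_interior h2.
    by rewrite normrN; apply: extremal_max_ge1 h1 h3.
  + move=> e e0; apply: filterS (near_u e e0) => k h y Oy.
    by rewrite /= -opprD normrN; exact: h.
  + by apply: continuousN; exact: cint.
Qed.
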